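(* Let $d, j \in \mathbb{N}$, let $q = 1$ or $q = 2$, and let $\alpha \in (0, d/q)$. Let $f$ be a probability density function on $\mathbb{R}^d$. Suppose $I_{1-\alpha/d}(f) < \infty$ and $r_c(f) > q\alpha d/(d - q\alpha)$. Then, as $n \to \infty$, $$ n^{-1} S_{n,\alpha} \to \omega_d^{-\alpha/d} \left( \frac{\Gamma(j+\alpha/d)}{\Gamma(j)} \right) I_{1-\alpha/d}(f) $$ with convergence in $L^q$.
   Context: $\mathbb{N} = \{1,2,\ldots\}$. For a finite set $\mathcal{X} \subset \mathbb{R}^d$ and $x \in \mathcal{X}$, $D(x,\mathcal{X}) = D_j(x,\mathcal{X})$ denotes the Euclidean distance from $x$ to its $j$th nearest neighbor in $\mathcal{X} \setminus \{x\}$ if $\mathrm{card}(\mathcal{X}) > j$, and $D(x,\mathcal{X}) := 0$ if $\mathrm{card}(\mathcal{X}) \le j$. $(X_i)_{i \in \mathbb{N}}$ is a sequence of independent random vectors in $\mathbb{R}^d$ with common density $f$, $\mathcal{X}_n := \{X_1,\ldots,X_n\}$, and $$S_{n,\alpha} := \sum_{i=1}^n (n^{1/d} D(X_i,\mathcal{X}_n))^{\alpha}.$$ $\omega_d := \pi^{d/2}/\Gamma(1+d/2)$ is the volume of the unit ball in $\mathbb{R}^d$. For $\rho > 0$, $I_\rho(f) := \int_{\mathbb{R}^d} f(y)^\rho\, dy$. With $|\cdot|$ the Euclidean norm, for $r \ge 0$ let $M_r(f) := \mathbb{E}[|X_1|^r] = \int_{\mathbb{R}^d} |x|^r f(x)\,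 dx$, and define the critical moment $r_c(f) := \sup\{r \ge 0 : M_r(f) < \infty\} \in [0,\infty]$. *)

(* Defs.v *)
From HB Require Import structures.
From mathcomp Require Import all_boot all_order all_algebra finmap.
From mathcomp Require Import all_classical all_reals all_analysis.

Set Implicit Arguments.
Unset Strict Implicit.
Unset Printing Implicit Defensive.
Import Order.TTheory GRing.Theory Num.Theory.
Import numFieldNormedType.Exports.

Local Open Scope classical_set_scope.
Local Open Scope ring_scope.

(* R^d is [d.-tuple R], with its coordinatewise (Borel) sigma-algebra. *)

Definition eucl_norm (R : realType) (d : nat) (x : d.-tuple R) : R :=
  Num.sqrt (\sum_(i < d) tnth x i ^+ 2).

Definition eucl_dist (R : realType) (d : nat) (x y : d.-tuple R) : R :=
  eucl_norm [tuple tnth x i - tnth y i | i < d].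

Definition cons_pair (R : realType) (d : nat)
    (p : (d.-tuple R * measurableTypeR R)%type) : d.+1.-tuple R :=
  [tuple of p.2 :: p.1].

Lemma measurable_cons_pair (R : realType) (d : nat) :
  measurable_fun setT (@cons_pair R d).
Proof.
apply: (@measurable_cons _ _ _ R); [exact: measurable_snd|exact: measurable_fst].
Qed.

Definition lebesgue_step (R : realType) (d : nat)
    (m : {measure set (d.-tuple R) -> \bar R}) : set (d.+1.-tuple R) -> \bar R :=
  pushforward (m \x (@lebesgue_measure R))%E (@cons_pair R d).

HB.instance Definition _ (R : realType) (d : nat)
    (m : {measure set (d.-tuple R) -> \bar R}) :=
  Measure.copy (lebesgue_step m)
    (measure_function_pushforward__canonical__measure_function_Measure
       (m \x (@lebesgue_measure R))%E (@measurable_cons_pair R d)).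

Fixpoint lebesgue_meas (R : realType) (d : nat) :
    {measure set (d.-tuple R) -> \bar R} :=
  match d with
  | 0 => \d_([tuple] : 0.-tuple R)
  | d'.+1 => lebesgue_step (lebesgue_meas R d')
  end.

(* Sanity check: the measure of a box is the product of its side lengths. *)
Lemma lebesgue_meas_box (R : realType) (d : nat) (A : 'I_d -> set R) :
  (forall i, measurable (A i)) ->
  lebesgue_meas R d [set x | forall i, A i (tnth x i)] =
  (\prod_(i < d) lebesgue_measure (A i))%E.
Proof.
elim: d A => [|d IH] A mA /=.
  rewrite big_ord0 diracE mem_set//; by case.
rewrite /lebesgue_step /pushforward /=.
rewrite (_ : _ @^-1` _ =
  [set x | forall i : 'I_d, A (lift ord0 i) (tnth x i)] `*` (A ord0)); last first.
  apply/seteqP; split => [[u t]|[u t]] /=.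
    move=> H; split => /= [i|]; first by have := H (lift ord0 i); rewrite /cons_pair tnthS.
    by have := H ord0; rewrite /cons_pair tnth0.
  move=> [H1 H2] i; have [->|] := eqVneq i ord0; first by rewrite /cons_pair tnth0.
  rewrite eq_sym => /unlift_some[k -> _]; rewrite /cons_pair tnthS; exact: H1.
rewrite product_measure1E//.
- by rewrite (IH (fun i => A (lift ord0 i)))// big_ord_recl muleC.
- rewrite (_ : [set x | _] =
    \bigcap_(i in [set: 'I_d]) ((@tnth _ R ^~ i) @^-1` A (lift ord0 i))).
    apply: fin_bigcap_measurable => // i _.
    by rewrite -[X in measurable X]setTI; apply: (@measurable_tnth _ R).
  by apply/seteqP; split => x /= H i; [move=> _|]; exact: H.
- exact: mA.
Qed.

Definition Gamma_fun (R : realType) (s : R) : R :=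
  Rintegral lebesgue_measure `]0, +oo[ (fun t : R => t `^ (s - 1) * expR (- t)).

Definition unit_ball_vol (R : realType) (d : nat) : R :=
  pi `^ (d%:R / 2) / Gamma_fun (1 + d%:R / 2).

Section density.
Context (R : realType) (d : nat).
Implicit Types f : d.-tuple R -> R.

Definition prob_density f : Prop :=
  [/\ measurable_fun setT f, forall x, 0 <= f x &
      (\int[lebesgue_meas R d]_x (f x)%:E = 1)%E].

Definition I_int (rho : R) f : \bar R :=
  (\int[lebesgue_meas R d]_x (f x `^ rho)%:E)%E.

Definition moment (r : R) f : \bar R :=
  (\int[lebesgue_meas R d]_x (eucl_norm x `^ r * f x)%:E)%E.

Definition critical_moment f : \bar R :=
  ereal_sup [set r%:E | r in [set r : R | 0 <= r /\ (moment r f < +oo)%E]].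

End density.

Section sampling.
Context (R : realType) (dO : measure_display) (Omega : measurableType dO)
  (P : probability Omega R) (d : nat).

Definition has_density (Y : {RV P >-> d.-tuple R}) (f : d.-tuple R -> R) : Prop :=
  forall B : set (d.-tuple R), measurable B ->
    P (Y @^-1` B) = (\int[lebesgue_meas R d]_(x in B) (f x)%:E)%E.

Definition mutually_independent (X : nat -> {RV P >-> d.-tuple R}) : Prop :=
  forall (J : {fset nat}) (B : nat -> set (d.-tuple R)),
    (forall i, measurable (B i)) ->
    P (\bigcap_(i in [set` J]) (X i @^-1` B i)) =
    (\prod_(i <- J) P (X i @^-1` B i))%E.

(* Distance to the j-th nearest neighbour (j >= 1): the j-th smallest of the
   distances, counted with repetitions, to the other points of [S]. *)
Definition nn_dist (j : nat) (x : d.-tuple R) (S : {fset d.-tuple R}) : R :=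
  if (j < #|` S|)%N
  then nth 0 (sort <=%R [seq eucl_dist x y | y <- (S `\ x)%fset]) j.-1
  else 0.

(* Sequences are indexed from 0: the first n points are X 0, ..., X (n - 1). *)
Definition sample (X : nat -> {RV P >-> d.-tuple R}) (n : nat) (w : Omega) :
  {fset d.-tuple R} := [fset X i w | i in iota 0 n]%fset.

Definition S_stat (j : nat) (alpha : R) (X : nat -> {RV P >-> d.-tuple R})
    (n : nat) (w : Omega) : R :=
  \sum_(0 <= i < n)
    (n%:R `^ (d%:R)^-1 * nn_dist j (X i w) (sample X n w)) `^ alpha.

Definition cvg_Lspace (p : \bar R) (Z : nat -> Omega -> R) (z : Omega -> R) : Prop :=
  [/\ forall n, Z n \in Lfun P p, z \in Lfun P p &
      Lnorm P p (fun w => (Z n w - z w)%:E) @[n --> \oo] --> 0%E].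

End sampling.

(* Main.v *)
(** The layer-cake formula writes [n^-1 S_(n,alpha)] as the integral over [u > 0] of
    the fraction [Z_n(t)], [t = u^(1/alpha)], of sample points with fewer than [j]
    other points within [t n^(-1/d)].  Around a sample point [x] the number of such
    neighbours is nearly Poisson of mean [omega_d t^d f(x)]: the averages of [f] over
    balls of radius [t n^(-1/d)] tend to [f] in [L^1], so the error vanishes on
    average and Lebesgue points are not needed.  The same comparison for two sample
    points controls the second moment, whence [Z_n(t)] tends in [L^1] to
    [c(t) = E Pois_(<j)(omega_d t^d f(X))].

    A ball of radius [t^(d/(d+rho))] is covered by cells of diameter at most
    [t n^(-1/d)], each of which contains at most [j] points counted by [Z_n(t)];
    with the moment of order [rho] outside the ball this bounds [E Z_n(t)] by
    [C t^(-d rho/(d+rho))].  The hypothesis on [r_c(f)] makes this decay fast enough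
    for dominated convergence in [L^q], through a weighted Cauchy-Schwarz inequality
    when [q = 2].  Finally [Pois_(<j)(l)] is the mass of [(l, oo)] under the gamma
    density of shape [j], which gives the integral of [c(u^(1/alpha))]. *)

From HB Require Import structures.
Require Import Defs.
From mathcomp Require Import all_boot all_order all_algebra finmap.
From mathcomp Require Import all_classical all_reals all_analysis.
From mathcomp Require Import ring lra zify.

Set Implicit Arguments.
Unset Strict Implicit.
Unset Printing Implicit Defensive.
Import Order.TTheory GRing.Theory Num.Theory.
Import numFieldNormedType.Exports.
Import measurable_realfun.
Local Open Scope classical_set_scope.
Local Open Scope ring_scope.

(** * Lebesgue measure on tuples and Euclidean balls *)

(* The Lebesgue integral of a nonnegative function is a supremum over simple
   functions, so it is monotone without any measurability assumption. *)
Lemma ge0_le_integralT dT (T : measurableType dT) (R : realType)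
    (mu : {measure set T -> \bar R}) (f g : T -> \bar R) :
  (forall x, 0 <= f x)%E -> (forall x, f x <= g x)%E ->
  (\int[mu]_x f x <= \int[mu]_x g x)%E.
Proof.
move=> f0 fg; have g0 x : (0 <= g x)%E by exact: le_trans (fg x).
rewrite !ge0_integralTE//; apply: ereal_sup_le => _ [h hf <-].
by exists h => // x; exact: le_trans (hf x) (fg x).
Qed.

Lemma norm_integralB_le dT (T : measurableType dT) (R : realType)
    (mu : {measure set T -> \bar R}) (f g : T -> R) (a b : R) :
  measurable_fun setT f -> measurable_fun setT g ->
  (forall x, 0 <= f x) -> (forall x, 0 <= g x) ->
  (\int[mu]_x (f x)%:E = a%:E)%E -> (\int[mu]_x (g x)%:E = b%:E)%E ->
  ((`|a - b|)%:E <= \int[mu]_x (`|f x - g x|)%:E)%E.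
Proof.
move=> mf mg f0 g0 fa gb.
have md : measurable_fun setT (fun x => (`|f x - g x|)%:E : \bar R).
  by apply/measurable_EFinP; apply: measurableT_comp => //; exact: measurable_funB.
have c1 : (a%:E <= b%:E + \int[mu]_x (`|f x - g x|)%:E)%E.
  rewrite -fa -gb -ge0_integralD//; last 2 first.
  - by move=> x _; rewrite lee_fin.
  - exact/measurable_EFinP.
  apply: ge0_le_integralT => x; first by rewrite lee_fin.
  rewrite -EFinD lee_fin.
  by have := ler_norm (f x - g x); lra.
have c2 : (b%:E <= a%:E + \int[mu]_x (`|f x - g x|)%:E)%E.
  rewrite -fa -gb -ge0_integralD//; last 2 first.
  - by move=> x _; rewrite lee_fin.
  - exact/measurable_EFinP.
  apply: ge0_le_integralT => x; first by rewrite lee_fin.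
  rewrite -EFinD lee_fin.
  by have := ler_norm (g x - f x); rewrite distrC; lra.
have : (0 <= \int[mu]_x (`|f x - g x|)%:E)%E by exact: integral_ge0.
move: (\int[mu]_x (`|f x - g x|)%:E)%E c1 c2 => [r||]; rewrite ?leey// => + + _.
rewrite -!EFinD !lee_fin ler_norml => h1 h2; apply/andP; split; lra.
Qed.

Lemma measurable_section1 d1 d2 d3 (T1 : measurableType d1) (T2 : measurableType d2)
    (U : measurableType d3) (F : T1 -> T2 -> U) x :
  measurable_fun setT (fun z : T1 * T2 => F z.1 z.2) -> measurable_fun setT (F x).
Proof.
move=> mF; apply: (measurableT_comp mF (g := fun y => (x, y))).
exact: measurable_fun_pair.
Qed.

Lemma measurable_section2 d1 d2 d3 (T1 : measurableType d1) (T2 : measurableType d2)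
    (U : measurableType d3) (F : T1 -> T2 -> U) y :
  measurable_fun setT (fun z : T1 * T2 => F z.1 z.2) ->
  measurable_fun setT (fun x => F x y).
Proof.
move=> mF; apply: (measurableT_comp mF (g := fun x => (x, y))).
exact: measurable_fun_pair.
Qed.

Definition push_measure d1 d2 (T1 : measurableType d1) (T2 : measurableType d2)
    (R : realType) (m : {measure set T1 -> \bar R}) (f : T1 -> T2)
    (mf : measurable_fun setT f) : {measure set T2 -> \bar R} :=
  measure_function_pushforward__canonical__measure_function_Measure m mf.

Section tuple_measures.
Context d (T : measurableType d) (R : realType) (n : nat).

Definition box (A : 'I_n -> set T) : set (n.-tuple T) :=
  [set x | forall i, A i (tnth x i)].

Lemma measurable_box (A : 'I_n -> set T) :
  (forall i, measurable (A i)) -> measurable (box A).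
Proof.
move=> mA; rewrite (_ : box A =
    \bigcap_(i in [set: 'I_n]) ((@tnth _ T ^~ i) @^-1` A i)).
  apply: fin_bigcap_measurable => // i _.
  by rewrite -[X in measurable X]setTI; apply: (@measurable_tnth _ T).
by apply/seteqP; split => x /= H i; [move=> _|]; exact: H.
Qed.

Let boxes := [set box A | A in [set A | forall i, measurable (A i)]].

Lemma measurable_tuple_boxes :
  (measurable : set (set (n.-tuple T))) = <<s boxes >>.
Proof.
apply/seteqP; split.
- apply: smallest_sub; first exact: smallest_sigma_algebra.
  move=> B; rewrite -bigcup_seq => -[i _ [C mC <-]].
  apply: sub_sigma_algebra.
  exists (fun k => if k == i then C else setT).
    by move=> k; case: ifP.
  rewrite setTI; apply/seteqP; split => x /=.
    by move=> /(_ i); rewrite eqxx.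
  by move=> Cx k; case: eqP => [->|].
- apply: smallest_sub; first exact: sigma_algebra_measurable.
  by move=> _ [A mA <-]; exact: measurable_box.
Qed.

Lemma tuple_measure_unique (m1 m2 : {measure set (n.-tuple T) -> \bar R})
    (Q : nat -> set T) :
  (forall k, measurable (Q k)) -> nondecreasing_seq Q -> \bigcup_k Q k = setT ->
  (forall k, m1 (box (fun=> Q k)) < +oo)%E ->
  (forall A, (forall i, measurable (A i)) -> m1 (box A) = m2 (box A)) ->
  forall B, measurable B -> m1 B = m2 B.
Proof.
move=> mQ ndQ UQ fQ m12.
apply: (measure_unique boxes (fun k => box (fun=> Q k))) => //.
- exact: measurable_tuple_boxes.
- move=> _ _ [A mA <-] [B mB <-]; exists (fun i => A i `&` B i).
    by move=> i; exact: measurableI.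
  apply/seteqP; split => x /=; first by move=> H; split => i; case: (H i).
  by move=> [H1 H2] i.
- by move=> k; exists (fun=> Q k).
- apply/seteqP; split => // x _.
  have /choice[f fP] (i : 'I_n) : exists k, Q k (tnth x i).
    by have : setT (tnth x i) by []; rewrite -UQ => -[k _ ?]; exists k.
  exists (\max_(i < n) f i)%N => //= i.
  by have /subsetPset := ndQ _ _ (leq_bigmax i : (f i <= _)%N); apply.
- by move=> _ [A mA <-]; exact: m12.
Qed.

End tuple_measures.

Section lebesgue_tuple.
Context {R : realType}.
Implicit Types d : nat.

Let itvk (k : nat) : set R := `[- k%:R, k%:R]%classic.

Let itvk_nd : nondecreasing_seq itvk.
Proof.
move=> m n mn; apply/subsetPset => x; rewrite /itvk/= !in_itv/= => /andP[h1 h2].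
have : m%:R <= n%:R :> R by rewrite ler_nat.
by move=> h; apply/andP; split; lra.
Qed.

Let itvk_cover : \bigcup_k itvk k = setT.
Proof.
apply/seteqP; split => // x _; exists (Num.trunc `|x|).+1 => //.
rewrite /itvk/= in_itv/= -ler_norml ltW//; exact: truncnS_gt.
Qed.

Let mitvk k : measurable (itvk k).
Proof. exact: measurable_itv. Qed.

Lemma lebesgue_meas_itv_fin d k :
  (lebesgue_meas R d (box (fun=> itvk k)) < +oo)%E.
Proof.
rewrite /box (lebesgue_meas_box (A := fun=> itvk k))//.
suff /andP[] : (0 <= \prod_(i < d) lebesgue_measure (itvk k) < +oo)%E by [].
apply: (big_ind (fun x : \bar R => (0 <= x < +oo)%E)) => [|x y|i _].
- by rewrite lee_fin ler01 ltry.
- by move=> /andP[x0 xy] /andP[y0 yy]; rewrite mule_ge0//= lte_mul_pinfty// ge0_fin_numE.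
- rewrite measure_ge0/= lebesgue_measure_itv/=.
  by case: ifPn => _; rewrite -?EFinN -?EFinD ltry.
Qed.

Lemma lebesgue_meas_sigma_finite d : sigma_finite setT (lebesgue_meas R d).
Proof.
exists (fun k => box (fun=> itvk k)).
  apply/seteqP; split => // x _.
  exists (\max_(i < d) (Num.trunc `|tnth x i|).+1)%N => //= i.
  have /itvk_nd/subsetPset := @leq_bigmax _
    (fun i : 'I_d => (Num.trunc `|tnth x i|).+1) i; apply.
  by rewrite /itvk/= in_itv/= -ler_norml ltW//; exact: truncnS_gt.
move=> k; split; last exact: lebesgue_meas_itv_fin.
by apply: measurable_box => _; exact: mitvk.
Qed.

(* [lebesgue_meas] with its sigma-finite structure; opaque from the end of the
   section on, lest conversion unfold the recursion on [d]. *)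
Definition leb d : set (d.-tuple R) -> \bar R := lebesgue_meas R d.
Arguments leb d : clear implicits.

HB.instance Definition _ d := Measure.copy (leb d) (lebesgue_meas R d).

HB.instance Definition _ d := @Measure_isSigmaFinite.Build _ _ _
  (leb d) (lebesgue_meas_sigma_finite d).

Lemma integral_lebE d (f : d.-tuple R -> \bar R) :
  (\int[lebesgue_meas R d]_x f x = \int[leb d]_x f x)%E.
Proof. by []. Qed.

Lemma leb_cube_fin d k : (leb d (box (fun=> itvk k)) < +oo)%E.
Proof. exact: lebesgue_meas_itv_fin. Qed.

Lemma measurable_affine (a b : R) :
  measurable_fun [set: measurableTypeR R]
    (fun x => a * x + b : measurableTypeR R).
Proof. by apply: measurable_funD => //; exact: measurable_funM. Qed.

Lemma lebesgue_measure_affine (a b : R) (A : set R) : 0 < a -> measurable A ->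
  lebesgue_measure [set x : R | A (a * x + b)] = (a^-1%:E * lebesgue_measure A)%E.
Proof.
move=> a0 mA.
have ha : 0 <= a by exact: ltW.
pose m := mscale (NngNum ha)
  (push_measure lebesgue_measure (measurable_affine a b)).
suff -> : lebesgue_measure A = m A.
  by rewrite /m /mscale/= muleA -EFinM mulVf ?gt_eqF// mul1e.
apply: (@lebesgue_measure_unique _ m) => // _ [[u v] /= uv <-].
rewrite /m /mscale/= /pushforward.
rewrite (_ : _ @^-1` _ = `](u - b) / a, (v - b) / a]%classic); last first.
  apply/seteqP; split => x /=; rewrite !in_itv/=.
    by rewrite ltr_pdivrMr// ler_pdivlMr// ltrBlDr lerBrDr [x * a]mulrC.
  by rewrite ltr_pdivrMr// ler_pdivlMr// ltrBlDr lerBrDr [x * a]mulrC.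
rewrite !lebesgue_measure_itv/= !lte_fin ltr_pM2r ?invr_gt0// ltrD2r.
case: ifPn => h1; last by rewrite mule0.
rewrite -!EFinD -EFinM; congr EFin.
by field; rewrite gt_eqF.
Qed.

Definition affine_tuple d (a : R) (b x : d.-tuple R) : d.-tuple R :=
  [tuple a * tnth x i + tnth b i | i < d].

Lemma measurable_affine_tuple d (a : R) (b : d.-tuple R) :
  measurable_fun [set: d.-tuple R] (affine_tuple a b).
Proof.
apply/measurable_fun_tnthP => i.
rewrite (_ : _ \o _ = fun x => a * tnth x i + tnth b i); last first.
  by apply/funext => x /=; rewrite tnth_mktuple.
apply: measurable_funD => //; apply: measurable_funM => //.
exact: (@measurable_tnth _ (measurableTypeR R)).
Qed.

Lemma lebesgue_meas_affine d (a : R) (b : d.-tuple R) (A : set (d.-tuple R)) :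
  0 < a -> measurable A ->
  leb d (affine_tuple a b @^-1` A) = ((a^-1 ^+ d)%:E * leb d A)%E.
Proof.
move=> a0 mA.
have ha : 0 <= a ^+ d by rewrite exprn_ge0// ltW.
pose m := mscale (NngNum ha)
  (push_measure (leb d) (measurable_affine_tuple a b)).
suff -> : leb d A = m A.
  rewrite /m /mscale/= muleA -EFinM exprVn mulVf ?mul1e//.
  by rewrite expf_neq0// gt_eqF.
apply: (@tuple_measure_unique _ R R d (leb d) m
  _ mitvk itvk_nd itvk_cover) => // [k|B mB].
  exact: lebesgue_meas_itv_fin.
rewrite {1}/leb /box (lebesgue_meas_box mB).
transitivity ((a ^+ d)%R%:E * lebesgue_meas R d
    [set x | forall i, [set y | B i (a * y + tnth b i)%R] (tnth x i)])%E.
rewrite (lebesgue_meas_box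
  (A := fun i => [set y | B i (a * y + tnth b i)])) => [|i]; last first.
  by have := @measurable_affine a (tnth b i) measurableT _ (mB i); rewrite setTI.
under [in RHS]eq_bigr do rewrite lebesgue_measure_affine//.
rewrite big_split/= muleA.
rewrite (_ : (\prod_(i < d) a^-1%:E)%E = ((a ^- d)%:E)%E); last first.
  by rewrite prodEFin prodr_const card_ord exprVn.
  by rewrite -EFinM divff ?mul1e// expf_neq0// gt_eqF.
congr (_ * lebesgue_meas R d _)%E.
by apply/seteqP; split => x /= H i; have := H i; rewrite tnth_mktuple.
Qed.

End lebesgue_tuple.
Arguments leb {R} d _.

Section euclidean.
Context {R : realType} {d : nat}.
Implicit Types x y : d.-tuple R.

Lemma eucl_dist_ge0 x y : 0 <= eucl_dist x y.
Proof. exact: sqrtr_ge0. Qed.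

Lemma eucl_distC x y : eucl_dist x y = eucl_dist y x.
Proof.
by rewrite /eucl_dist /eucl_norm; congr Num.sqrt; apply: eq_bigr => i _;
  rewrite !tnth_mktuple -sqrrN opprB.
Qed.

Lemma eucl_norm_coord x i : `|tnth x i| <= eucl_norm x.
Proof.
rewrite -sqrtr_sqr ler_sqrt ?sqr_ge0//.
  by rewrite (bigD1 i)//= lerDl sumr_ge0// => k _; exact: sqr_ge0.
by apply: sumr_ge0 => k _; exact: sqr_ge0.
Qed.

Lemma eucl_dist_coord x y i : `|tnth x i - tnth y i| <= eucl_dist x y.
Proof. by have := eucl_norm_coord [tuple tnth x i - tnth y i | i < d] i; rewrite tnth_mktuple. Qed.

Lemma eucl_dist_le x y (e : R) : 0 <= e ->
  (forall i, `|tnth x i - tnth y i| <= e) ->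
  eucl_dist x y <= Num.sqrt d%:R * e.
Proof.
move=> e0 xye; rewrite -[e in leRHS]ger0_norm// -sqrtr_sqr -sqrtrM ?ler0n//.
rewrite ler_sqrt; last by rewrite mulr_ge0// sqr_ge0.
apply: (@le_trans _ _ (\sum_(i < d) e ^+ 2)); last first.
  by rewrite sumr_const card_ord mulr_natl.
apply: ler_sum => i _; rewrite tnth_mktuple -real_normK ?num_real//.
by rewrite ler_pXn2r// nnegrE.
Qed.

Lemma eucl_dist_eq0 x y : (eucl_dist x y == 0) = (x == y).
Proof.
apply/eqP/eqP => [xy0|->]; last first.
  apply/eqP; rewrite eq_le eucl_dist_ge0 andbT -[leRHS](mulr0 (Num.sqrt d%:R)).
  by apply: eucl_dist_le => // i; rewrite subrr normr0.
apply: eq_from_tnth => i; apply/eqP; rewrite -subr_eq0 -normr_le0 -xy0.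
exact: eucl_dist_coord.
Qed.

Lemma measurable_eucl_norm : measurable_fun setT (@eucl_norm R d).
Proof.
apply: (@measurableT_comp _ _ _ _ _ _ (@Num.sqrt R)).
  exact: continuous_measurable_fun (@sqrt_continuous R).
by apply: measurable_sum => i; apply: measurable_funX; exact: measurable_tnth.
Qed.

Lemma measurable_eucl_dist dT (T : measurableType dT) (f g : T -> d.-tuple R) :
  measurable_fun setT f -> measurable_fun setT g ->
  measurable_fun setT (fun w => eucl_dist (f w) (g w)).
Proof.
move=> mf mg.
apply: (@measurableT_comp _ _ _ _ _ _ (@eucl_norm R d)).
  exact: measurable_eucl_norm.
apply/measurable_fun_tnthP => i.
rewrite (_ : _ \o _ = fun w => tnth (f w) i - tnth (g w) i); last first.
  by apply/funext => w /=; rewrite tnth_mktuple.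
by apply: measurable_funB;
  [move: mf|move: mg] => /measurable_fun_tnthP; exact.
Qed.

Definition eball x (r : R) : set (d.-tuple R) := [set y | eucl_dist x y <= r].

Lemma measurable_eball x r : measurable (eball x r).
Proof.
rewrite -[X in measurable X]setTI.
by apply: (measurable_fun_le (f := fun y => eucl_dist x y) (g := cst r)) => //; exact: measurable_eucl_dist.
Qed.

Definition ball_vol : R := fine (leb d [set x | eucl_norm x <= 1]).

Lemma ball_volE : leb d [set x | eucl_norm x <= 1] = ball_vol%:E.
Proof.
rewrite fineK// ge0_fin_numE//.
apply: le_lt_trans (lebesgue_meas_itv_fin d 1).
apply: le_measure; rewrite ?inE.
- rewrite -[X in measurable X]setTI.
  by apply: (measurable_fun_le (g := cst 1)) => //; exact: measurable_eucl_norm.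
- by apply: measurable_box => i; exact: measurable_itv.
- move=> x /= x1 i; rewrite /= in_itv/= -ler_norml.
  exact: le_trans (eucl_norm_coord _ _) x1.
Qed.

Lemma leb_eball x r : 0 < r -> leb d (eball x r) = (r ^+ d * ball_vol)%:E.
Proof.
move=> r0; rewrite EFinM -ball_volE.
rewrite -[r in (r ^+ d)%:E]invrK -(lebesgue_meas_affine
  [tuple - (r^-1 * tnth x i) | i < d]) ?invr_gt0//; last first.
  rewrite -[X in measurable X]setTI.
  by apply: (measurable_fun_le (g := cst 1)) => //; exact: measurable_eucl_norm.
congr (leb d _); apply/seteqP.
suff E y : eucl_norm (affine_tuple r^-1 [tuple - (r^-1 * tnth x i) | i < d] y) =
    r^-1 * eucl_dist x y.
  by split => y /=; rewrite E mulrC ler_pdivrMr// mul1r.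
rewrite eucl_distC -[r^-1 in RHS]ger0_norm ?invr_ge0 ?ltW// -sqrtr_sqr.
rewrite -sqrtrM ?sqr_ge0//; congr Num.sqrt.
rewrite mulr_sumr; apply: eq_bigr => i _; rewrite !tnth_mktuple; ring.
Qed.

End euclidean.
Arguments ball_vol : clear implicits.

Section ball_volume.
Context {R : realType}.
Local Open Scope ereal_scope.

Lemma integral_expRN (s : R) :
  \int[lebesgue_measure]_(t in `[s, +oo[) (expR (- t))%:E = (expR (- s))%:E.
Proof.
rewrite (@ge0_continuous_FTC2y _ _ (fun t => - expR (- t))%R _ 0%R).
- by rewrite sub0e -EFinN opprK.
- by move=> x _; exact: expR_ge0.
- apply: continuous_subspaceT => x.
  by apply: (@continuous_comp _ _ _ -%R expR); [exact: opp_continuous|exact: continuous_expR].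
- rewrite -[X in _ --> X]oppr0; apply: cvgN; exact: cvgr_expR.
- by move=> x _; apply: ex_derive.
- apply: cvg_at_right_filter; apply: cvgN.
  by apply: (@continuous_comp _ _ _ -%R expR); [exact: opp_continuous|exact: continuous_expR].
- move=> x _; rewrite derive1E derive_val; ring.
Qed.

Lemma measurable_gauss_tuple d :
  measurable_fun setT (fun x : d.-tuple R => expR (- eucl_norm x ^+ 2)).
Proof.
apply: (@measurableT_comp _ _ _ _ _ _ (@expR R)) => //.
apply: (@measurableT_comp _ _ _ _ _ _ (fun t : R => - t ^+ 2)%R).
  by apply: measurableT_comp => //; exact: measurableT_comp.
exact: measurable_eucl_norm.
Qed.

Lemma eucl_norm_cons d (x : d.-tuple R) (t : R) :
  (eucl_norm (cons_pair (x, t)) ^+ 2 = t ^+ 2 + eucl_norm x ^+ 2)%R.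
Proof.
rewrite !sqr_sqrtr; try by apply: sumr_ge0 => k _; exact: sqr_ge0.
rewrite big_ord_recl; congr (_ + _)%R.
by apply: eq_bigr => k _; rewrite tnthS.
Qed.

Lemma integral_gauss_tuple d :
  \int[leb d]_x (expR (- eucl_norm x ^+ 2))%:E = (Num.sqrt pi ^+ d : R)%:E.
Proof.
elim: d => [|d IH].
  rewrite (_ : _ _ _ _ = \int[\d_([tuple] : 0.-tuple R)]_x
    (expR (- eucl_norm x ^+ 2))%:E)//.
  rewrite integral_dirac//=; last first.
    by apply/measurable_EFinP; exact: measurable_gauss_tuple.
  by rewrite diracT mul1e /eucl_norm big_ord0 sqrtr0 expr0n/= oppr0 expR0 expr0.
have mg (d' : nat) : measurable_fun setT
    (fun x : d'.-tuple R => (expR (- eucl_norm x ^+ 2))%:E).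
  by apply/measurable_EFinP; exact: measurable_gauss_tuple.
apply: etrans; first exact: (ge0_integral_pushforward (@measurable_cons_pair R d)
  (leb d \x lebesgue_measure) measurableT (mg d.+1)).
rewrite preimage_setT.
apply: etrans; first apply: (@fubini_tonelli1 _ _ _ _ _ (leb d) lebesgue_measure).
- by apply: measurableT_comp; [exact: mg|exact: measurable_cons_pair].
- by move=> z /=; rewrite lee_fin expR_ge0.
rewrite /fubini_F/=.
transitivity (\int[leb d]_x ((expR (- eucl_norm x ^+ 2))%:E * (Num.sqrt (pi : R))%:E)).
  apply: eq_integral => x _; rewrite -integralT_gauss -ge0_integralZl//=.
  - apply: eq_integral => t _.
    by rewrite eucl_norm_cons opprD expRD mulrC EFinM.
  - by apply/measurable_EFinP; exact: measurable_gauss_fun.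
  - by move=> t _; rewrite lee_fin expR_ge0.
rewrite ge0_integralZr//.
- by rewrite IH -EFinM exprSr.
- exact: mg.
Qed.

Lemma eucl_norm_scale_vol d (t : R) : (0 < t)%R ->
  leb d [set x | (eucl_norm x ^+ 2 <= t)%R] =
  (t `^ (d%:R / 2) * ball_vol R d)%:E.
Proof.
move=> t0; have st : (0 < Num.sqrt t)%R by rewrite sqrtr_gt0.
have -> : (t `^ (d%:R / 2) = Num.sqrt t ^+ d)%R.
  by rewrite mulrC powRrM powR12_sqrt ?ltW// powR_mulrn ?ltW.
rewrite -(leb_eball [tuple 0%R | i < d])//; congr (leb d _).
have E y : eucl_dist [tuple 0%R | i < d] y = eucl_norm y.
  rewrite eucl_distC /eucl_dist /eucl_norm; congr Num.sqrt.
  by apply: eq_bigr => k _; rewrite !tnth_mktuple subr0.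
apply/seteqP; split => y /=; rewrite /eball/= E => h.
  by rewrite -(ger0_norm (sqrtr_ge0 _ : 0 <= eucl_norm y)%R) -sqrtr_sqr ler_sqrt// ltW.
rewrite -[t in leRHS]sqr_sqrtr; last exact: ltW.
by rewrite ler_pXn2r ?nnegrE ?sqrtr_ge0.
Qed.
Lemma leb_indic d (A : set (d.-tuple R)) : measurable A ->
  \int[leb d]_x (\1_A x)%:E = leb d A.
Proof. by move=> mA; rewrite integral_indic// setIT. Qed.

Lemma measurable_sqr_norm d (t : R) :
  measurable [set x : d.-tuple R | (eucl_norm x ^+ 2 <= t)%R].
Proof.
rewrite -[X in measurable X]setTI; apply: measurable_fun_le => //.
by apply: measurable_funX; exact: measurable_eucl_norm.
Qed.

Lemma leb_set0_norm d : (0 < d)%N ->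
  leb d [set x : d.-tuple R | (eucl_norm x ^+ 2 <= 0)%R] = 0.
Proof.
case: d => // d _; apply/eqP; rewrite -measure_le0.
apply: (@le_trans _ _ (leb d.+1 [set x | forall i, [set 0%R] (tnth x i)])).
  apply: le_measure; rewrite ?inE; first exact: measurable_sqr_norm.
    by apply: (@measurable_box _ R d.+1 (fun=> [set 0%R])).
  move=> x /= x0 i; apply/eqP; rewrite -normr_le0.
  apply: le_trans (eucl_norm_coord _ _) _.
  by rewrite -(ger0_norm (sqrtr_ge0 _ : 0 <= eucl_norm x)%R) normr_le0 -sqrf_eq0 eq_le x0 sqr_ge0.
rewrite /leb (lebesgue_meas_box (A := fun=> [set 0%R])) => [|i]; last exact: measurable_set1.
by rewrite big_ord_recl lebesgue_measure_set1 mul0e.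
Qed.

Lemma ball_vol_gamma d : (0 < d)%N -> (ball_vol R d * Gamma_fun (1 + d%:R / 2) = pi `^ (d%:R / 2))%R /\
  (0 < Gamma_fun (1 + d%:R / 2 : R))%R.
Proof.
move=> d_gt0.
pose h (z : d.-tuple R * measurableTypeR R) :=
  ((expR (- z.2))%:E * (\1_[set z | (eucl_norm z.1 ^+ 2 <= z.2)%R] z)%:E).
have mh : measurable_fun setT h.
  apply: emeasurable_funM.
    apply/measurable_EFinP; apply: (@measurableT_comp _ _ _ _ _ _ (@expR R)) => //.
    exact: measurable_funN.
  apply/measurable_EFinP; apply: measurable_indic.
  rewrite -[X in measurable X]setTI.
  apply: measurable_fun_le => //.
  apply: measurable_funX.
  by apply: measurableT_comp => //; exact: measurable_eucl_norm.
have h0 z : 0 <= h z by rewrite mule_ge0// lee_fin expR_ge0.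
have : \int[leb d]_x \int[lebesgue_measure]_t h (x, t) =
       \int[lebesgue_measure]_t \int[leb d]_x h (x, t).
  exact: (@fubini_tonelli _ _ _ _ _ (leb d) lebesgue_measure h mh h0).
have -> : \int[leb d]_x \int[lebesgue_measure]_t h (x, t) = (pi `^ (d%:R / 2) : R)%:E.
  rewrite mulrC powRrM powR12_sqrt ?pi_ge0// powR_mulrn ?sqrtr_ge0//.
  rewrite -integral_gauss_tuple; apply: eq_integral => x _.
  rewrite -integral_expRN [RHS]integral_mkcond; apply: eq_integral => t _.
  rewrite /h patchE/= indicE/=.
  case: ifPn => [/set_mem|/negP tx].
    by rewrite /= in_itv/= andbT => tx; rewrite mem_set// mule1.
  rewrite memNset ?mule0// => /= tx'; apply: tx; apply/mem_set => /=.
  by rewrite in_itv/= andbT.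
have -> : \int[lebesgue_measure]_t \int[leb d]_x h (x, t) =
    (ball_vol R d)%:E * \int[lebesgue_measure]_(t in `]0%R, +oo[)
      (t `^ (1 + d%:R / 2 - 1) * expR (- t))%:E.
  rewrite -ge0_integralZl//=; last 3 first.
  - apply/measurable_EFinP; apply: measurable_funTS; apply: measurable_funM => //.
    by apply: measurableT_comp => //.
  - by move=> t _; rewrite lee_fin mulr_ge0 ?powR_ge0 ?expR_ge0.
  - by rewrite lee_fin fine_ge0.
  rewrite [in RHS]integral_mkcond; apply: eq_integral => t _.
  rewrite patchE; case: ifPn => [/set_mem/=|/negP tx].
    rewrite in_itv/= andbT => t0.
    transitivity ((expR (- t))%:E * \int[leb d]_x
        (\1_[set x : d.-tuple R | (eucl_norm x ^+ 2 <= t)%R] x)%:E).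
      rewrite -ge0_integralZl ?lee_fin ?expR_ge0//.
        by apply/measurable_EFinP; apply: measurable_indic; exact: measurable_sqr_norm.
    rewrite leb_indic; last exact: measurable_sqr_norm.
    rewrite eucl_norm_scale_vol// -!EFinM; congr EFin.
    by rewrite addrAC subrr add0r; ring.
  have : (t <= 0)%R.
    rewrite leNgt; apply/negP => t0; apply: tx; apply/mem_set => /=.
    by rewrite in_itv/= t0.
  rewrite le_eqVlt => /predU1P[->|t0]; last first.
    rewrite integral0_eq// => x _; rewrite /h indicE memNset ?mule0//=.
    by apply/negP; rewrite -ltNge (lt_le_trans t0)// sqr_ge0.
  rewrite (_ : (fun x => h (x, 0%R)) =
      (fun x => (\1_[set x : d.-tuple R | (eucl_norm x ^+ 2 <= 0)%R] x)%:E)).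
    by rewrite leb_indic ?leb_set0_norm//; exact: measurable_sqr_norm.
  by apply/funext => x; rewrite /h /= oppr0 expR0 mul1e.
have p0 : (0 < pi `^ (d%:R / 2) :> R)%R by rewrite powR_gt0// pi_gt0.
have J0 : 0 <= \int[lebesgue_measure]_(t in `]0%R, +oo[)
      (t `^ (1 + d%:R / 2 - 1) * expR (- t) : R)%:E.
  by apply: integral_ge0 => t _; rewrite lee_fin mulr_ge0 ?powR_ge0 ?expR_ge0.
rewrite /Gamma_fun /Rintegral; case: (\int[_]_(t in _) _) J0 => //= [r|] r0.
  rewrite -EFinM => -[pE]; split => //.
  rewrite lt_neqAle -lee_fin r0 andbT; apply/eqP => r00.
  by move: p0; rewrite pE -r00 mulr0 ltxx.
have [->|v0] := eqVneq (ball_vol R d) 0%R.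
  by rewrite mul0e => -[pE]; rewrite pE ltxx in p0.
by rewrite gt0_muley ?lte_fin ?lt_neqAle 1?eq_sym ?v0//= fine_ge0.
Qed.

Lemma ball_vol_unit_ball d : (0 < d)%N -> ball_vol R d = unit_ball_vol R d.
Proof.
move=> d0; rewrite /unit_ball_vol; have [<- G0] := ball_vol_gamma d0; by rewrite mulfK ?gt_eqF.
Qed.

End ball_volume.

Section tonelli.
Local Open Scope ereal_scope.
Context d1 d2 (T1 : measurableType d1) (T2 : measurableType d2) (R : realType).
Context (m1 : {sigma_finite_measure set T1 -> \bar R})
  (m2 : {sigma_finite_measure set T2 -> \bar R}).
Variable F : T1 -> T2 -> \bar R.
Hypothesis mF : measurable_fun setT (fun z => F z.1 z.2).
Hypothesis F0 : forall x y, 0 <= F x y.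

Lemma tonelli_swap :
  \int[m1]_x \int[m2]_y F x y = \int[m2]_y \int[m1]_x F x y.
Proof. by apply: (fubini_tonelli (fun z => F z.1 z.2)) => // -[]. Qed.

Lemma tonelli_prod :
  \int[m1 \x m2]_z F z.1 z.2 = \int[m1]_x \int[m2]_y F x y.
Proof. by apply: (fubini_tonelli1 (fun z => F z.1 z.2)) => // -[]. Qed.

Lemma measurable_tonelli : measurable_fun setT (fun x => \int[m2]_y F x y).
Proof.
by apply: (measurable_fun_fubini_tonelli_F (fun z => F z.1 z.2)) => // -[].
Qed.

End tonelli.

#[global] Opaque leb.

(** * Ball averages in L^1 *)

Definition vanishes (R : realType) (u : nat -> \bar R) :=
  forall e : R, 0 < e -> \forall n \near \oo, (u n <= e%:E)%E.

Section vanishes.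
Context {R : realType}.
Local Open Scope ereal_scope.
Implicit Types u v w : nat -> \bar R.

Lemma vanishes_le u v : (forall n, u n <= v n) -> vanishes v -> vanishes u.
Proof.
by move=> uv v0 e e0; near=> n; rewrite (le_trans (uv n))//; near: n; exact: v0.
Unshelve. all: by end_near. Qed.

Lemma vanishesD u v : vanishes u -> vanishes v -> vanishes (fun n => u n + v n).
Proof.
move=> u0 v0 e e0; have e2 : (0 < e / 2)%R by rewrite divr_gt0.
near=> n; rewrite [e]splitr EFinD leeD//; near: n; [exact: u0|exact: v0].
Unshelve. all: by end_near. Qed.

Lemma vanishesZ (c : R) u : (0 <= c)%R -> (forall n, 0 <= u n) -> vanishes u ->
  vanishes (fun n => c%:E * u n).
Proof.
move=> c0 un0 u0 e e0; have c1 : (0 < c + 1)%R by rewrite ltr_wpDl.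
near=> n.
rewrite (@le_trans _ _ ((c + 1)%:E * u n))//.
  by rewrite lee_wpmul2r// lee_fin lerDl.
rewrite muleC -lee_pdivlMr// -EFinM.
by near: n; apply: u0; rewrite divr_gt0.
Unshelve. all: by end_near. Qed.

Lemma cvg_vanishes u : u @ \oo --> 0 -> vanishes u.
Proof.
move=> u0 e e0.
apply: (u0 [set x | x <= e%:E]); rewrite /nbhs/=; apply/nbhs_ballP; exists e => //= x.
by rewrite /ball/= sub0r normrN lee_fin => /ltW; exact: le_trans (ler_norm _).
Qed.

Lemma vanishes_cvg u : (forall n, 0 <= u n) -> vanishes u -> u @ \oo --> 0.
Proof.
move=> un0 u0 P; rewrite /nbhs/= => /nbhs_ballP[e /= e0 eP]; rewrite /nbhs/=.
have e2 : (0 < e / 2)%R by rewrite divr_gt0.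
apply: filterS (u0 _ e2) => n; have := un0 n.
rewrite /preimage/=; case: (u n) => //= x; rewrite !lee_fin => x0 xe; apply: eP.
by rewrite /ball/= sub0r normrN ger0_norm//; lra.
Qed.

Lemma vanishes0 : vanishes (fun=> 0 : \bar R).
Proof. by move=> e e0; near=> n; rewrite lee_fin ltW.
Unshelve. all: by end_near. Qed.

Lemma vanishes_sum k (u : 'I_k -> nat -> \bar R) :
  (forall i, vanishes (u i)) -> vanishes (fun n => \sum_(i < k) u i n).
Proof.
elim: k u => [|k IH] u u0.
  by apply: vanishes_le vanishes0 => n; rewrite big_ord0.
apply: (@vanishes_le _ (fun n => \sum_(i < k) u (widen_ord (leqnSn k) i) n + u ord_max n)).
  by move=> n; rewrite big_ord_recr.
by apply: vanishesD => //; exact: (IH (fun i => u (widen_ord (leqnSn k) i))).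
Qed.

Lemma vanishes_approx u :
  (forall e : R, (0 < e)%R -> exists2 v, vanishes v & forall n, u n <= v n + e%:E) ->
  vanishes u.
Proof.
move=> H e e0; have e2 : (0 < e / 2)%R by rewrite divr_gt0.
have [v v0 uv] := H _ e2.
near=> n; rewrite (le_trans (uv n))// [e in leRHS]splitr EFinD leeD2r//.
near: n; exact: v0.
Unshelve. all: by end_near. Qed.

Lemma dominated_vanishes dT (T : measurableType dT)
    (mu : {measure set T -> \bar R}) (D : set T) (f_ : nat -> T -> \bar R)
    (g : T -> \bar R) : measurable D ->
  (forall n, measurable_fun D (f_ n)) -> (forall n x, D x -> 0 <= f_ n x) ->
  (forall x, D x -> vanishes (f_ ^~ x)) ->
  mu.-integrable D g -> (forall n x, D x -> f_ n x <= g x) ->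
  vanishes (fun n => \int[mu]_(x in D) f_ n x).
Proof.
move=> mD mf f0 fv ig fg.
have H : {ae mu, forall x, D x -> f_ ^~ x @ \oo --> cst 0 x}.
  by apply: aeW => x Dx; apply: vanishes_cvg; [move=> n; exact: f0|exact: fv].
have H' : {ae mu, forall x n, D x -> `|f_ n x| <= g x}.
  by apply: aeW => x n Dx; rewrite gee0_abs ?f0// fg.
have [_ _] := dominated_convergence mD mf (measurable_cst _) H ig H'.
by rewrite integral0; exact: cvg_vanishes.
Qed.

End vanishes.

Lemma indic_bool (R : pzRingType) (T : Type) (P : pred T) x :
  \1_[set y | P y] x = (P x)%:R :> R.
Proof.
rewrite indicE; have [Px|/negP Px] := boolP (P x).
  by rewrite mem_set.
by rewrite memNset.
Qed.

Section kernel_averages.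
Context {R : realType} {d : nat}.
Variable r : nat -> R.
Hypothesis r_gt0 : forall n, 0 < r n.
Hypothesis r_cvg0 : r @ \oo --> 0.
Local Notation T := (d.-tuple R).
Implicit Types (h : T -> R) (A : set T).

Definition ker n (x y : T) : R := r n ^- d * (eucl_dist x y <= r n)%R%:R.

Lemma ker_ge0 n x y : 0 <= ker n x y.
Proof. by rewrite mulr_ge0// invr_ge0 exprn_ge0// ltW. Qed.

Lemma kerC n x y : ker n x y = ker n y x.
Proof. by rewrite /ker eucl_distC. Qed.

Lemma measurable_ker dS (S : measurableType dS) (f g : S -> T) n :
  measurable_fun setT f -> measurable_fun setT g ->
  measurable_fun setT (fun w => ker n (f w) (g w)).
Proof.
move=> mf mg; apply: measurable_funM => //.
rewrite (_ : (fun w => _) = \1_[set w | eucl_dist (f w) (g w) <= r n]).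
  apply: measurable_indic; rewrite -[X in measurable X]setTI.
  by apply: measurable_fun_le => //; exact: measurable_eucl_dist.
by apply/funext => w; rewrite indic_bool.
Qed.

Lemma integral_ker n x : (\int[leb d]_y (ker n x y)%:E = (ball_vol R d)%:E)%E.
Proof.
transitivity (\int[leb d]_y ((r n ^- d)%:E * (\1_(eball x (r n)) y)%:E))%E.
  by apply: eq_integral => y _; rewrite -EFinM /ker /eball indic_bool.
rewrite ge0_integralZl//.
- rewrite leb_indic; last exact: measurable_eball.
  by rewrite leb_eball// -EFinM mulrA mulVf ?mul1r// expf_neq0// gt_eqF.
- by apply/measurable_EFinP; apply: measurable_indic; exact: measurable_eball.
- by rewrite lee_fin invr_ge0 exprn_ge0// ltW.
Qed.

Definition osc n h : \bar R :=
  (\int[leb d]_x \int[leb d]_y (ker n x y * `|h x - h y|)%:E)%E.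

Lemma measurable_ker_osc h n : measurable_fun setT h ->
  measurable_fun setT (fun z : T * T => (ker n z.1 z.2 * `|h z.1 - h z.2|)%:E).
Proof.
move=> mh; apply/measurable_EFinP; apply: measurable_funM.
  exact: measurable_ker.
apply: measurableT_comp => //; apply: measurable_funB;
  exact: (measurableT_comp mh).
Qed.

Lemma measurable_ker1 (g : T -> R) n : measurable_fun setT g ->
  measurable_fun setT (fun z : T * T => (ker n z.1 z.2 * g z.1)%:E).
Proof.
move=> mg; apply/measurable_EFinP; apply: measurable_funM.
  exact: measurable_ker.
exact: (measurableT_comp mg).
Qed.

Lemma measurable_ker2 (g : T -> R) n : measurable_fun setT g ->
  measurable_fun setT (fun z : T * T => (ker n z.1 z.2 * g z.2)%:E).
Proof.
move=> mg; apply/measurable_EFinP; apply: measurable_funM.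
  exact: measurable_ker.
exact: (measurableT_comp mg).
Qed.

Lemma ball_vol_ge0 : 0 <= ball_vol R d.
Proof. exact: fine_ge0. Qed.

Lemma integral_ker1 n (g : T -> R) : measurable_fun setT g -> (forall x, 0 <= g x) ->
  (\int[leb d]_x \int[leb d]_y (ker n x y * g x)%:E =
   (ball_vol R d)%:E * \int[leb d]_x (g x)%:E)%E.
Proof.
move=> mg g0.
transitivity (\int[leb d]_x ((ball_vol R d)%:E * (g x)%:E))%E; last first.
  apply: ge0_integralZl => //.
  - exact/measurable_EFinP.
  - by move=> x _; rewrite lee_fin.
  - by rewrite lee_fin ball_vol_ge0.
apply: eq_integral => x _; rewrite -(integral_ker n x).
under eq_integral do rewrite EFinM.
apply: ge0_integralZr => //.
- by apply/measurable_EFinP; exact: measurable_ker.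
- by move=> y _; rewrite lee_fin ker_ge0.
- by rewrite lee_fin.
Qed.

Lemma integral_ker2 n (g : T -> R) : measurable_fun setT g -> (forall x, 0 <= g x) ->
  (\int[leb d]_x \int[leb d]_y (ker n x y * g y)%:E =
   (ball_vol R d)%:E * \int[leb d]_x (g x)%:E)%E.
Proof.
move=> mg g0; apply: etrans (integral_ker1 n mg g0).
apply: etrans; first apply: (@tonelli_swap _ _ _ _ _ (leb d) (leb d)
  (fun x y => (ker n x y * g y)%:E)).
- exact: measurable_ker2.
- by move=> x y; rewrite lee_fin mulr_ge0// ker_ge0.
- by apply: eq_integral => y _; apply: eq_integral => x _; rewrite kerC.
Qed.

(* The two [g] terms each integrate to [ball_vol * \int g]. *)
Lemma osc_le n h (k : nat) (c : 'I_k -> R) (H : 'I_k -> T -> R) (g : T -> R) :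
  measurable_fun setT h -> (forall i, measurable_fun setT (H i)) ->
  measurable_fun setT g -> (forall x, 0 <= g x) -> (forall i, 0 <= c i) ->
  (forall x y, `|h x - h y| <=
     \sum_(i < k) c i * `|H i x - H i y| + (g x + g y)) ->
  (osc n h <= \sum_(i < k) (c i)%:E * osc n (H i) +
    (2 * ball_vol R d)%:E * \int[leb d]_x (g x)%:E)%E.
Proof.
move=> mh mH mg g0 c0 hH.
pose G (z : T * T) := (\sum_(i < k) (c i)%:E * (ker n z.1 z.2 * `|H i z.1 - H i z.2|)%:E
   + ((ker n z.1 z.2 * g z.1)%:E + (ker n z.1 z.2 * g z.2)%:E))%E.
have mc i : measurable_fun setT (fun z : T * T =>
    ((c i)%:E * (ker n z.1 z.2 * `|H i z.1 - H i z.2|)%:E)%E).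
  by apply: emeasurable_funM => //; exact: measurable_ker_osc.
have mG : measurable_fun setT G.
  apply: emeasurable_funD; last by apply: emeasurable_funD; [exact: measurable_ker1|exact: measurable_ker2].
  exact: emeasurable_sum.
have k0 := ker_ge0.
have c00 i z : (0 <= (c i)%:E * (ker n z.1 z.2 * `|H i z.1 - H i z.2|)%:E)%E.
  by rewrite mule_ge0// lee_fin// mulr_ge0.
have s00 z : (0 <= \sum_(i < k) (c i)%:E * (ker n z.1 z.2 * `|H i z.1 - H i z.2|)%:E)%E.
  by apply: sume_ge0.
have g1 z : (0 <= (ker n z.1 z.2 * g z.1)%:E)%E by rewrite lee_fin mulr_ge0.
have g2 z : (0 <= (ker n z.1 z.2 * g z.2)%:E)%E by rewrite lee_fin mulr_ge0.
have osc2 h' : measurable_fun setT h' ->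
    osc n h' = (\int[leb d \x leb d]_z (ker n z.1 z.2 * `|h' z.1 - h' z.2|)%:E)%E.
  move=> mh'; apply/esym; apply: (@tonelli_prod _ _ _ _ _ (leb d) (leb d)
    (fun x y => (ker n x y * `|h' x - h' y|)%:E)); first exact: measurable_ker_osc.
  by move=> x y; rewrite lee_fin mulr_ge0.
rewrite osc2//.
apply: (@le_trans _ _ (\int[leb d \x leb d]_z G z)%E).
  apply: ge0_le_integralT => z; first by rewrite lee_fin mulr_ge0.
  rewrite /G; under eq_bigr do rewrite -EFinM.
  rewrite sumEFin -!EFinD lee_fin -mulrDr.
  apply: le_trans (ler_wpM2l (k0 _ _ _) (hH _ _)) _.
  rewrite [leLHS]mulrDr lerD//= mulr_sumr; apply: ler_sum => i _.
  by rewrite mulrCA.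
rewrite ge0_integralD//; last 3 first.
- exact: emeasurable_sum.
- by move=> z _; rewrite adde_ge0.
- by apply: emeasurable_funD; [exact: measurable_ker1|exact: measurable_ker2].
rewrite ge0_integral_sum//.
rewrite ge0_integralD//; [|exact: measurable_ker1|exact: measurable_ker2].
apply: leeD.
  apply: lee_sum => i _; rewrite ge0_integralZl//.
  - by rewrite osc2.
  - exact: measurable_ker_osc.
  - by move=> z _; rewrite lee_fin mulr_ge0.
  - by rewrite lee_fin.
have I1 := @tonelli_prod _ _ _ _ _ (leb d) (leb d)
  (fun x y => (ker n x y * g x)%:E) (measurable_ker1 n mg) (fun x y => g1 (x, y)).
have I2 := @tonelli_prod _ _ _ _ _ (leb d) (leb d)
  (fun x y => (ker n x y * g y)%:E) (measurable_ker2 n mg) (fun x y => g2 (x, y)).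
rewrite I1 I2 integral_ker1// integral_ker2//.
by rewrite mulr2n mulrDl mul1r EFinD ge0_muleDl ?lee_fin ?ball_vol_ge0.
Qed.

Lemma osc_ge0 n h : (0 <= osc n h)%E.
Proof.
by apply: integral_ge0 => x _; apply: integral_ge0 => y _; rewrite lee_fin mulr_ge0// ker_ge0.
Qed.

Definition osc_small h := measurable_fun setT h /\ vanishes (fun n => osc n h).

Lemma osc_small_le h (k : nat) (c : 'I_k -> R) (H : 'I_k -> T -> R) :
  measurable_fun setT h -> (forall i, osc_small (H i)) -> (forall i, 0 <= c i) ->
  (forall x y, `|h x - h y| <= \sum_(i < k) c i * `|H i x - H i y|) ->
  osc_small h.
Proof.
move=> mh sH c0 hH; split => //.
apply: (@vanishes_le _ _ (fun n => \sum_(i < k) (c i)%:E * osc n (H i))%E).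
  move=> n; have := @osc_le n h k c H (fun=> 0) mh _ (measurable_cst _) _ c0.
  rewrite integral0 mule0 adde0; apply => //.
  - by move=> i; have [] := sH i.
  - by move=> x y; rewrite !addr0.
apply: vanishes_sum => i; apply: vanishesZ => //; last exact: (sH i).2.
by move=> n; exact: osc_ge0.
Qed.

Lemma osc_small_le2 h H1 H2 : measurable_fun setT h ->
  osc_small H1 -> osc_small H2 ->
  (forall x y, `|h x - h y| <= `|H1 x - H1 y| + `|H2 x - H2 y|) -> osc_small h.
Proof.
move=> mh s1 s2 hH.
pose H (i : 'I_2) : T -> R := if i == ord0 then H1 else H2.
apply: (@osc_small_le h 2 (fun=> 1) H mh) => [i|i|x y].
- by rewrite /H; case: ifP.
- exact: ler01.
- by rewrite big_ord_recl big_ord1 !mul1r; exact: hH.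
Qed.

Lemma osc_small_approx h : measurable_fun setT h ->
  (forall e : R, 0 < e -> exists (h1 g : T -> R), [/\ osc_small h1,
    measurable_fun setT g, forall x, 0 <= g x,
    (\int[leb d]_x (g x)%:E <= e%:E)%E &
    forall x y, `|h x - h y| <= `|h1 x - h1 y| + (g x + g y)]) ->
  osc_small h.
Proof.
move=> mh H; split => //; apply: vanishes_approx => e e0.
have v1 : 0 < 2 * ball_vol R d + 1 by rewrite ltr_wpDl// mulr_ge0// ball_vol_ge0.
have [//|h1 [g [sh1 mg g0 ge hg]]] := H (e / (2 * ball_vol R d + 1)).
  by rewrite divr_gt0.
exists (fun n => osc n h1); first exact: sh1.2.
move=> n; have := @osc_le n h 1 (fun=> 1) (fun=> h1) g mh (fun=> sh1.1) mg g0 (fun=> ler01).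
rewrite big_ord1 mul1e => /(_ _)/le_trans; apply => [x y|].
  by rewrite big_ord1 mul1r.
rewrite leeD2l//; apply: (@le_trans _ _ ((2 * ball_vol R d + 1)%:E *
    (e / (2 * ball_vol R d + 1))%:E)%E).
  apply: lee_pmul => //; rewrite ?lee_fin ?lerDl//.
    by rewrite mulr_ge0// ball_vol_ge0.
  by apply: integral_ge0 => x _; rewrite lee_fin.
by rewrite -EFinM mulrCA mulfV ?mulr1// gt_eqF.
Qed.

Lemma osc_small_open A : measurable A -> (leb d A < +oo)%E ->
  (forall x, A x -> \forall n \near \oo, eball x (r n) `<=` A) ->
  osc_small \1_A.
Proof.
move=> mA Afin Aop.
have m1A : measurable_fun setT (\1_A : T -> R) by exact: measurable_indic.
have i1 y : \1_A y <= 1 :> R by rewrite indicE; case: (_ \in _).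
split => //.
pose phi n x y : R := ker n x y * (\1_A x * (1 - \1_A y)).
have phi0 n x y : 0 <= phi n x y.
  by rewrite /phi mulr_ge0 ?ker_ge0// mulr_ge0// subr_ge0.
have mphi2 n dS (S : measurableType dS) (u v : S -> T) :
    measurable_fun setT u -> measurable_fun setT v ->
    measurable_fun setT (fun z => (phi n (u z) (v z))%:E).
  move=> mu mv; apply/measurable_EFinP; apply: measurable_funM; first exact: measurable_ker.
  apply: measurable_funM; first exact: (measurableT_comp m1A).
  by apply: measurable_funB => //; exact: (measurableT_comp m1A).
have mphi n : measurable_fun setT (fun z => (phi n z.1 z.2)%:E) by exact: mphi2.
have phi1 n x : (\int[leb d]_y (phi n x y)%:E <= (ball_vol R d * \1_A x)%:E)%E.
  rewrite EFinM -(integral_ker n x) -ge0_integralZr//; last 2 first.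
  - by apply/measurable_EFinP; exact: measurable_ker.
  - by move=> y _; rewrite lee_fin ker_ge0.
  apply: ge0_le_integralT => y; first by rewrite lee_fin.
  rewrite -EFinM lee_fin ler_wpM2l ?ker_ge0// ler_piMr//.
apply: (@vanishes_le _ _ (fun n => \int[leb d]_x \int[leb d]_y (phi n x y)%:E +
    \int[leb d]_x \int[leb d]_y (phi n x y)%:E)%E).
  move=> n.
  have mphiC : measurable_fun setT (fun z => (phi n z.2 z.1)%:E).
    exact: mphi2.
  rewrite [X in (_ <= _ + X)%E](@tonelli_swap _ _ _ _ _ (leb d) (leb d)
    (fun x y => (phi n x y)%:E)) //; last by move=> x y; rewrite lee_fin.
  rewrite -ge0_integralD//; last 4 first.
  - by move=> x _; apply: integral_ge0 => y _; rewrite lee_fin.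
  - by apply: (@measurable_tonelli _ _ _ _ _ (leb d) (fun x y => (phi n x y)%:E)) => // x y; rewrite lee_fin.
  - by move=> x _; apply: integral_ge0 => y _; rewrite lee_fin.
  - by apply: (@measurable_tonelli _ _ _ _ _ (leb d) (fun x y => (phi n y x)%:E)) => // x y; rewrite lee_fin.
  rewrite le_eqVlt; apply/orP; left; apply/eqP; apply: eq_integral => x _.
  rewrite -ge0_integralD//; last 4 first.
  - by move=> y _; rewrite lee_fin.
  - exact: mphi2.
  - by move=> y _; rewrite lee_fin.
  - exact: mphi2.
  apply: eq_integral => y _; rewrite -EFinD; congr EFin.
  rewrite /phi (kerC n y x) -mulrDr; congr (_ * _).
  by rewrite !indicE; do 2 case: (_ \in _);
    rewrite /= ?subrr ?subr0 ?sub0r ?normrN ?normr1 ?normr0 ?mulr0 ?mul0r ?mulr1 ?addr0 ?add0r.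
suff cvg0 : vanishes (fun n => \int[leb d]_x \int[leb d]_y (phi n x y)%:E)%E.
  exact: vanishesD.
apply: (@dominated_vanishes _ _ _ (leb d) setT _
  (fun x => (ball_vol R d * \1_A x)%:E)) => //.
- move=> n; apply: (@measurable_tonelli _ _ _ _ _ (leb d) (fun x y => (phi n x y)%:E)) => // x y.
  by rewrite lee_fin.
- by move=> n x _; apply: integral_ge0 => y _; rewrite lee_fin.
- move=> x _ e e0; have [xA|xA] := pselect (A x).
    apply: filterS (Aop x xA) => n xrA.
    rewrite integral0_eq ?lee_fin ?ltW// => y _.
    rewrite /phi /ker; have [xy|xy] := leP (eucl_dist x y) (r n).
      by rewrite [\1_A y]indicE mem_set ?subrr ?mulr0//; exact: xrA.
    by rewrite mulr0 mul0r.
  near=> n; rewrite integral0_eq ?lee_fin ?ltW// => y _.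
  by rewrite /phi [\1_A x]indicE memNset// mul0r mulr0.
- apply/integrableP; split; first by apply/measurable_EFinP; exact: measurable_funM.
  under eq_integral do rewrite gee0_abs ?lee_fin ?mulr_ge0 ?ball_vol_ge0// EFinM.
  rewrite ge0_integralZl ?lee_fin ?ball_vol_ge0//; last exact/measurable_EFinP.
  by rewrite leb_indic// lte_mul_pinfty ?lee_fin ?ball_vol_ge0.
Unshelve. all: by end_near. Qed.

Lemma osc_small_indicU (A B : set T) : measurable A -> measurable B ->
  osc_small \1_A -> osc_small \1_B -> osc_small \1_(A `|` B).
Proof.
move=> mA mB sA sB.
apply: (osc_small_le2 _ sA sB).
  by apply: measurable_indic; exact: measurableU.
move=> x y; rewrite !indicE !in_setU.
by do 4 case: (_ \in _) => /=; rewrite ?subrr ?subr0 ?sub0r ?normrN ?normr1 ?normr0; lra.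
Qed.

Lemma osc_small_indicDI (A B : set T) : measurable A -> measurable B ->
  osc_small \1_(A `&` B) -> osc_small \1_B -> osc_small \1_(~` A `&` B).
Proof.
move=> mA mB sA sB.
apply: (osc_small_le2 _ sA sB).
  by apply: measurable_indic; apply: measurableI => //; exact: measurableC.
move=> x y; rewrite !indicE !in_setI !in_setC.
by do 4 case: (_ \in _) => /=; rewrite ?subrr ?subr0 ?sub0r ?normrN ?normr1 ?normr0; lra.
Qed.

(* Continuity from below of Lebesgue measure on sets of finite measure. *)
Lemma osc_small_bigcup (A : nat -> set T) :
  (forall k, measurable (A k)) -> nondecreasing_seq A ->
  (leb d (\bigcup_k A k) < +oo)%E ->
  (forall k, osc_small \1_(A k)) -> osc_small \1_(\bigcup_k A k).
Proof.
move=> mA ndA fA sA.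
have mU : measurable (\bigcup_k A k) by exact: bigcup_measurable.
apply: osc_small_approx; first exact: measurable_indic.
move=> e e0.
have cA : (fun k => leb d (\bigcup_k A k `\` A k)) @ \oo --> 0%E.
  rewrite -(measure0 (leb d)) (_ : set0 = \bigcap_k (\bigcup_k A k `\` A k)).
    apply: (@nonincreasing_cvg_mu _ _ _ (leb d)
      (fun k => \bigcup_k A k `\` A k)) => //.
    - apply: le_lt_trans fA; apply: le_measure; rewrite ?inE//.
      exact: measurableD.
    - by move=> k; exact: measurableD.
    - by apply: bigcap_measurableType => k _; exact: measurableD.
    - move=> m n mn; apply/subsetPset => x [Ux nx]; split => // mx; apply: nx.
      by have /subsetPset := ndA _ _ mn; apply.
  apply/seteqP; split => // x H; have [[k _ Akx] _] := H 0%N I.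
  by have [_] := H k I.
have [k _ /(_ k (leqnn k)) ke] := cvg_vanishes cA e0.
exists \1_(A k), \1_(\bigcup_k A k `\` A k); split => //.
- by apply: measurable_indic; exact: measurableD.
- by rewrite leb_indic//; exact: measurableD.
- move=> x y; rewrite !indicE !in_setD.
  have U z : z \in A k -> z \in \bigcup_k A k.
    by move=> /set_mem zA; apply/mem_set; exists k.
  have := U x; have := U y.
  by do 4 case: (_ \in _) => /=; rewrite ?subrr ?subr0 ?sub0r ?normrN ?normr1 ?normr0 => // *; lra.
Qed.

Lemma osc_small_open_box (I : 'I_d -> set R) :
  (forall i, open (I i)) -> (leb d (box I) < +oo)%E -> osc_small \1_(box I).
Proof.
move=> oI fI; apply: osc_small_open => //.
  by apply: measurable_box => i; exact: open_measurable.
move=> x Ix.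
have : \forall n \near \oo, forall i, ball (tnth x i) (r n + r n) `<=` I i.
  apply: filter_forall => i.
  have /nbhs_ballP[e /= e0 eI] := oI i _ (Ix i).
  have e2 : 0 < e / 2 by rewrite divr_gt0.
  near=> n; apply: subset_trans eI; apply: le_ball.
  suff : r n < e / 2 by lra.
  by near: n; apply: (cvgr_lt 0).
apply: filterS => n rI y xy i; apply: rI.
rewrite /ball/=; apply: le_lt_trans (eucl_dist_coord x y i) _.
by apply: le_lt_trans xy _; rewrite ltrDl.
Unshelve. all: by end_near. Qed.

Lemma osc_small_indic A : measurable A -> (leb d A < +oo)%E -> osc_small \1_A.
Proof.
pose B (k : nat) : set T := box (fun=> (`]- k%:R, k%:R[%classic : set R)).
have mB k : measurable (B k) by apply: measurable_box => _; exact: measurable_itv.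
have Bfin k : (leb d (B k) < +oo)%E.
  apply: le_lt_trans (leb_cube_fin d k).
  apply: le_measure; rewrite ?inE//.
    by apply: measurable_box => _; exact: measurable_itv.
  by move=> x Bx i; exact: subset_itvW (Bx i).
have sB k : osc_small \1_(B k) by apply: osc_small_open_box; [move=> i; exact: interval_open|exact: Bfin].
pose G : set (set T) := [set A | measurable A /\ forall k, osc_small \1_(A `&` B k)].
have GC C : G C -> G (~` C).
  move=> [mC sC]; split; first exact: measurableC.
  by move=> k; exact: osc_small_indicDI.
have GU (C : nat -> set T) : (forall k, G (C k)) -> G (\bigcup_k (C k)).
  move=> GCk; split; first by apply: bigcup_measurable => k _; exact: (GCk k).1.
  move=> k; rewrite setI_bigcupl.
  pose D m := \big[setU/set0]_(i < m.+1) (C i `&` B k).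
  have mD m : measurable (D m).
    by apply: bigsetU_measurable => i _; apply: measurableI => //; exact: (GCk i).1.
  have -> : \bigcup_i (C i `&` B k) = \bigcup_m (D m).
    by rewrite /D (bigcup_bigsetU_bigcup (fun i => C i `&` B k)).
  apply: osc_small_bigcup.
  - exact: mD.
  - move=> a b ab; apply/subsetPset.
    by have := @subset_bigsetU _ (fun i => C i `&` B k) a.+1 b.+1; apply.
  - rewrite /D (bigcup_bigsetU_bigcup (fun i => C i `&` B k)) -setI_bigcupl.
    apply: le_lt_trans (Bfin k); apply: le_measure; rewrite ?inE//.
    by apply: measurableI => //; apply: bigcup_measurable => i _; exact: (GCk i).1.
  - elim=> [|m IH].
      by rewrite /D big_ord_recl big_ord0 setU0; exact: (GCk 0).2.
    rewrite /D big_ord_recr; apply: osc_small_indicU; [exact: mD| |exact: IH|].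
      by apply: measurableI => //; exact: (GCk _).1.
    exact: (GCk m.+1).2.
have G0 : G set0.
  split; first exact: measurable0.
  move=> k; rewrite set0I; apply: osc_small_open => [||x []].
    exact: measurable0.
  by rewrite measure0.
have GR i D : measurable D -> G ((@tnth _ R ^~ i) @^-1` D).
  pose H : set (set R) := [set D | G ((@tnth _ R ^~ i) @^-1` D)].
  suff : (@ocitv R).-sigma.-measurable `<=` H by apply.
  rewrite RGenOInfty.measurableE; apply: smallest_sub.
    split; rewrite /H/=.
    - by rewrite preimage_set0.
    - by move=> C HC; rewrite setTD preimage_setC; exact: GC.
    - by move=> C HC; rewrite preimage_bigcup; exact: GU.
  move=> _ [a ->]; rewrite /H/=; split.
    by rewrite -[X in measurable X]setTI; apply: (@measurable_tnth _ R).
  move=> k.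
  pose J : set R := `]- k%:R, k%:R[%classic.
  pose I l : set R := if l == i then `]a, +oo[%classic `&` J else J.
  have -> : (@tnth _ R ^~ i) @^-1` `]a, +oo[%classic `&` B k = box I.
    apply/seteqP; split => x /=.
      by move=> [xi Bx] l; rewrite /I; case: eqP => [->|_]; [split => //|]; exact: Bx.
    move=> Ix; split; first by have := Ix i; rewrite /I eqxx => -[].
    by move=> l; have := Ix l; rewrite /I; case: eqP => [_ []|].
  have oJ : open J by exact: interval_open.
  apply: osc_small_open_box.
    by move=> l; rewrite /I; case: ifP => _ //; apply: openI => //; exact: interval_open.
  apply: le_lt_trans (Bfin k); apply: le_measure; rewrite ?inE; [|exact: mB|].
    apply: measurable_box => l; rewrite /I; case: ifP => _; last exact: measurable_itv.
    by apply: measurableI; exact: measurable_itv.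
  by move=> x Ix l; have := Ix l; rewrite /I; case: ifP => _ // [].
have GT : forall C, measurable C -> G C.
  apply: smallest_sub.
    by split; [exact: G0|move=> C GC'; rewrite setTD; exact: GC|exact: GU].
  move=> C; rewrite -bigcup_seq => -[i _ [D mD <-]]; rewrite setTI; exact: GR.
move=> mA Afin.
have -> : A = \bigcup_k (A `&` B k).
  rewrite -setI_bigcupr (_ : \bigcup_k B k = setT) ?setIT//.
  apply/seteqP; split => // x _.
  exists (\max_(i < d) (Num.trunc `|tnth x i|).+1)%N => // i.
  rewrite /= in_itv/= -ltr_norml; apply: lt_le_trans (truncnS_gt _) _.
  by rewrite ler_nat; exact: (@leq_bigmax _ (fun i : 'I_d => (Num.trunc `|tnth x i|).+1)).
apply: osc_small_bigcup.
- by move=> k; exact: measurableI.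
- move=> m n mn; apply/subsetPset => x [Ax Bx]; split => // i.
  have := Bx i; rewrite /= !in_itv/= -!ltr_norml => /lt_le_trans; apply.
  by rewrite ler_nat.
- by rewrite -setI_bigcupr; apply: le_lt_trans Afin; apply: le_measure;
    rewrite ?inE//; apply: measurableI => //; exact: bigcup_measurable.
- by move=> k; exact: (GT A mA).2.
Qed.

Import HBSimple.

Lemma osc_small_integrable h : (leb d).-integrable setT (EFin \o h) -> osc_small h.
Proof.
move=> ih; have mh : measurable_fun setT h by apply/measurable_EFinP; exact: measurable_int ih.
have [g [ig _ gh]] := approximation_sfun_integrable measurableT ih.
apply: osc_small_approx => // e e0.
have [k _ /(_ k (leqnn k)) ke] := cvg_vanishes gh e0.
exists (g k), (fun x => `|h x - g k x|); split => //.
- pose E y := g k @^-1` [set y].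
  have mE y : measurable (E y) by rewrite /E; exact: measurable_funPTI.
  have finE y : y != 0 -> (leb d (E y) < +oo)%E.
    move=> y0; have y0' : 0 < `|y| by rewrite normr_gt0.
    have /integrableP[mg gfin] := ig k.
    have := le_integral_abse (leb d) measurableT mg y0'.
    move=> /le_lt_trans/(_ gfin) H.
    have : (`|y|%:E * leb d (E y) < +oo)%E.
      apply: le_lt_trans H; rewrite lee_wpmul2l//; apply: le_measure; rewrite ?inE//.
        apply: emeasurable_fun_c_infty => //; exact: measurableT_comp.
      by move=> x; rewrite /E/= => ->.
    by case: (leb d (E y)) (measure_ge0 (leb d) (E y)) => //= [z|]; rewrite ?ltry// gt0_muley ?lte_fin.
  pose s := fset_set (range (g k)).
  have gE x : g k x = \sum_(i < size s) nth 0 s i * \1_(E (nth 0 s i)) x.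
    rewrite {1}fimfunE fsbig_finite//= (big_nth 0) big_mkord.
    by apply: eq_bigr => i _.
  pose H (i : 'I_(size s)) : T -> R := if nth 0 s i == 0 then cst 0 else \1_(E (nth 0 s i)).
  apply: (@osc_small_le _ _ (fun i => `|nth 0 s i|) H).
  + exact: measurable_funPT.
  + move=> i; rewrite /H; case: eqVneq => [_|i0]; last exact: osc_small_indic (finE _ i0).
    split => //; apply: vanishes_le vanishes0 => n; rewrite /osc integral0_eq// => x _.
    by rewrite integral0_eq// => y _; rewrite /= subrr normr0 mulr0.
  + by move=> i.
  + move=> x y; rewrite !gE -sumrB; apply: le_trans (ler_norm_sum _ _ _) _.
    apply: ler_sum => i _; rewrite -mulrBr normrM /H.
    by case: eqVneq => [->|//]; rewrite normr0 !mul0r.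
- by apply: measurableT_comp => //; exact: measurable_funB.
- move=> x y.
  have -> : h x - h y = (g k x - g k y) + ((h x - g k x) - (h y - g k y)) by ring.
  apply: le_trans (ler_normD _ _) _; rewrite lerD2l.
  by apply: le_trans (ler_normB _ _) _.
Qed.

End kernel_averages.

(** * Poisson approximation *)

Section poisson_cdf.
Context {R : realType}.
Implicit Types l p : R.

Definition pois_lt (m : nat) l : R :=
  (\sum_(k < m) l ^+ k / k`!%:R) * expR (- l).

Lemma pois_lt0 l : pois_lt 0 l = 0.
Proof. by rewrite /pois_lt big_ord0 mul0r. Qed.

Lemma pois_ltS m l : pois_lt m.+1 l = pois_lt m l + l ^+ m / m`!%:R * expR (- l).
Proof. by rewrite /pois_lt big_ord_recr mulrDl. Qed.

Lemma pois_lt_at0 m : pois_lt m 0 = (0 < m)%N%:R.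
Proof.
case: m => [|m]; first by rewrite pois_lt0.
rewrite /pois_lt big_ord_recl big1 => [|i _].
  by rewrite expr0 fact0 divr1 addr0 mul1r oppr0 expR0.
by rewrite expr0n mul0r.
Qed.

Lemma is_derive_pois_lt m l :
  is_derive l 1 (pois_lt m) (pois_lt m.-1 l - pois_lt m l).
Proof.
elim: m => [|m IH].
  rewrite (_ : pois_lt 0 = cst 0); last by apply/funext => x; rewrite pois_lt0.
  by rewrite subrr; exact: is_derive_cst.
have -> : pois_lt m.+1 = (fun x => pois_lt m x + x ^+ m * (m`!%:R^-1 * expR (- x))).
  by apply/funext => x; rewrite pois_ltS mulrA.
have D1 := is_deriveX m (is_derive_id l (1 : R)).
have D2 := is_derive1_comp (is_derive_expR (- l)) (is_deriveNid l (1 : R)).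
have D := is_deriveD IH (is_deriveM D1 (is_deriveZ m`!%:R^-1 D2)).
have -> : (fun x => pois_lt m x + x ^+ m * (m`!%:R^-1 * expR (- x))) =
    pois_lt m + id ^+ m * (m`!%:R^-1 \*: (expR \o -%R)).
  by apply/funext => x; rewrite !fctE.
apply: (is_derive_eq D); rewrite !fctE /GRing.scale/= {IH D1 D2 D}.
rewrite [_ *: expR (- l)](_ : _ = m`!%:R^-1 * expR (- l))//.
case: m => [|m]; first by rewrite pois_lt0 fact0 expr0 invr1; ring.
rewrite !pois_ltS/= factS natrM.
have m0 : (m`!%:R : R) != 0 by rewrite pnatr_eq0 -lt0n fact_gt0.
have m1 : 0 < m%:R + 1 :> R by rewrite ltr_wpDl.
rewrite -natr1; field; rewrite m0 gt_eqF//.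
Qed.

Lemma pois_lt_ge0 m l : 0 <= l -> 0 <= pois_lt m l.
Proof.
move=> l0; rewrite mulr_ge0 ?expR_ge0// sumr_ge0// => k _.
by rewrite divr_ge0 ?exprn_ge0.
Qed.

Lemma pois_lt_le1 m l : 0 <= l -> pois_lt m l <= 1.
Proof.
move=> l0; rewrite /pois_lt expRN ler_pdivrMr ?expR_gt0// mul1r.
rewrite -(big_mkord xpredT (fun k => l ^+ k / k`!%:R)).
apply: nondecreasing_cvgn_le.
  by apply: nondecreasing_series => k _ _; exact: exp_coeff_ge0.
exact: is_cvg_series_exp_coeff.
Qed.

Lemma derivable_within_pois_lt m a b : {within `[a, b], continuous (pois_lt m)}.
Proof.
apply: continuous_subspaceT => x; apply: differentiable_continuous.
by apply/derivable1_diffP; have [] := is_derive_pois_lt m x.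
Qed.

Lemma pois_lt_lip m l l' : 0 <= l -> 0 <= l' ->
  `|pois_lt m l - pois_lt m l'| <= `|l - l'|.
Proof.
wlog ll : l l' / l <= l'.
  move=> H l0 l0'; have [h|/ltW] := leP l l'; first exact: H.
  move=> h; rewrite (distrC (pois_lt m l)) (distrC l); exact: H.
move=> l0 l0'; rewrite distrC [leRHS]distrC.
have [c] := MVT_segment ll (fun x _ => is_derive_pois_lt m x)
  (@derivable_within_pois_lt m l l').
rewrite in_itv/= => /andP[lc _] ->; rewrite normrM ler_piMl//.
have c0 : 0 <= c by exact: le_trans lc.
have := pois_lt_ge0 m c0; have := pois_lt_le1 m c0.
have := pois_lt_ge0 m.-1 c0; have := pois_lt_le1 m.-1 c0.
by rewrite ler_norml => *; apply/andP; split; lra.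
Qed.

Lemma pois_lt_taylor m l p : 0 <= l -> 0 <= p ->
  `|pois_lt m (l + p) - pois_lt m l - p * (pois_lt m.-1 l - pois_lt m l)|
    <= 2 * p ^+ 2.
Proof.
move=> l0 p0; have ll : l <= l + p by rewrite lerDl.
have [c] := MVT_segment ll (fun x _ => is_derive_pois_lt m x)
  (@derivable_within_pois_lt m l (l + p)).
rewrite in_itv/= => /andP[lc cl] ->.
have c0 : 0 <= c by exact: le_trans lc.
have := pois_lt_lip m c0 l0; have := pois_lt_lip m.-1 c0 l0.
rewrite (ger0_norm (_ : 0 <= c - l)) ?subr_ge0//; move: (pois_lt m c) (pois_lt m l) (pois_lt m.-1 c) (pois_lt m.-1 l) => A B C D CD AB.
have -> : (C - A) * (l + p - l) - p * (D - B) = p * ((C - D) - (A - B)) by ring.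
rewrite normrM ger0_norm// expr2 mulrCA ler_wpM2l//.
apply: le_trans (ler_normB _ _) _; lra.
Qed.

(* Lindeberg's replacement argument: the recursion says that [u m a b] is the
   probability that among [m] independent points less than [a] fall in a first
   set and less than [b] in a second, disjoint one; each point is replaced by a
   pair of independent Poisson variables at cost [O((p1 + p2)^2)]. *)
Lemma pois_lt_approx (u : nat -> nat -> nat -> R) p1 p2 :
  0 <= p1 -> 0 <= p2 -> p1 + p2 <= 1 ->
  (forall a b, u 0 a b = (0 < a)%N%:R * (0 < b)%N%:R) ->
  (forall m a b, u m.+1 a b =
     (1 - p1 - p2) * u m a b + p1 * u m a.-1 b + p2 * u m a b.-1) ->
  forall m a b, `|u m a b - pois_lt a (m%:R * p1) * pois_lt b (m%:R * p2)| <=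
    2 * m%:R * (p1 + p2) ^+ 2.
Proof.
move=> p10 p20 p121 u0 uS; elim=> [|m IH] a b.
  by rewrite u0 !mul0r !pois_lt_at0 subrr normr0 mulr0 mul0r.
rewrite uS -natr1.
set l1 := m%:R * p1; set l2 := m%:R * p2.
have l10 : 0 <= l1 by rewrite mulr_ge0.
have l20 : 0 <= l2 by rewrite mulr_ge0.
have -> : (m%:R + 1) * p1 = l1 + p1 by rewrite /l1; ring.
have -> : (m%:R + 1) * p2 = l2 + p2 by rewrite /l2; ring.
have T1 := pois_lt_taylor a l10 p10; have T2 := pois_lt_taylor b l20 p20.
have Y0 := pois_lt_ge0 b (addr_ge0 l20 p20).
have Y1 := pois_lt_le1 b (addr_ge0 l20 p20).
have A0 := pois_lt_ge0 a l10; have A1 := pois_lt_le1 a l10.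
have A0' := pois_lt_ge0 a.-1 l10; have A1' := pois_lt_le1 a.-1 l10.
have B0 := pois_lt_ge0 b l20; have B1 := pois_lt_le1 b l20.
have B0' := pois_lt_ge0 b.-1 l20; have B1' := pois_lt_le1 b.-1 l20.
have H1 := IH a b; have H2 := IH a.-1 b; have H3 := IH a b.-1.
rewrite -/l1 -/l2 in H1 H2 H3.
move: (pois_lt a (l1 + p1)) (pois_lt b (l2 + p2)) T1 T2 Y0 Y1 => X Y.
move: (pois_lt a l1) (pois_lt a.-1 l1) (pois_lt b l2) (pois_lt b.-1 l2)
  A0 A1 A0' A1' B0 B1 B0' B1' H1 H2 H3 => A A' B B' A0 A1 A0' A1' B0 B1 B0' B1'.
move: (u m a b) (u m a.-1 b) (u m a b.-1) => u1 u2 u3 H1 H2 H3 T1 T2 Y0 Y1.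
set e := 2 * m%:R * (p1 + p2) ^+ 2 in H1 H2 H3.
set R1 := X - A - p1 * (A' - A) in T1; set R2 := Y - B - p2 * (B' - B) in T2.
have -> : (1 - p1 - p2) * u1 + p1 * u2 + p2 * u3 - X * Y =
    ((1 - p1 - p2) * (u1 - A * B) + p1 * (u2 - A' * B) + p2 * (u3 - A * B')) -
    (p1 * p2 * ((A - A') * (B - B')) + R1 * Y + ((1 - p1) * A + p1 * A') * R2).
  by rewrite /R1 /R2; ring.
have -> : 2 * (m%:R + 1) * (p1 + p2) ^+ 2 = e + 2 * (p1 + p2) ^+ 2.
  by rewrite /e; ring.
apply: le_trans (ler_normB _ _) _; apply: lerD.
  have -> : e = (1 - p1 - p2) * e + p1 * e + p2 * e by ring.
  have q0 : 0 <= 1 - p1 - p2 by lra.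
  have K c x : 0 <= c -> `|x| <= e -> `|c * x| <= c * e.
    by move=> c0 xe; rewrite normrM ger0_norm// ler_wpM2l.
  apply: le_trans (ler_normD _ _) _; apply: lerD; last exact: K.
  by apply: le_trans (ler_normD _ _) _; apply: lerD; exact: K.
apply: (@le_trans _ _ (p1 * p2 + 2 * p1 ^+ 2 + 2 * p2 ^+ 2)); last by nra.
apply: le_trans (ler_normD _ _) _; apply: lerD; first
  (apply: le_trans (ler_normD _ _) _; apply: lerD).
- rewrite normrM ger0_norm ?mulr_ge0// ler_piMr ?mulr_ge0// normrM mulr_ile1//.
    by rewrite ler_norml; apply/andP; split; lra.
  by rewrite ler_norml; apply/andP; split; lra.
- by rewrite normrM (ger0_norm Y0); apply: le_trans T1; rewrite ler_piMr.
- rewrite normrM; apply: le_trans T2; rewrite ler_piMl// ger0_norm; nra.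
Qed.

End poisson_cdf.

(** * Joint laws of sample points *)

Lemma distribution_density (R : realType) dO (Omega : measurableType dO)
    (P : probability Omega R) d (Y : {RV P >-> d.-tuple R}) f (A : set (d.-tuple R)) :
  has_density Y f -> measurable A ->
  distribution P Y A = (\int[leb d]_(x in A) (f x)%:E)%E.
Proof.
move=> fY mA; transitivity (\int[lebesgue_meas R d]_(x in A) (f x)%:E)%E; first exact: fY.
by rewrite integral_mkcond integral_lebE -integral_mkcond.
Qed.

Section sampling_law.
Context {R : realType} {dO : measure_display} {Omega : measurableType dO}
  {P : probability Omega R} {d : nat}.
Local Notation T := (d.-tuple R).
Variable X : nat -> {RV P >-> T}.

Definition sample_tuple m (s : m.-tuple nat) (w : Omega) : m.-tuple T :=
  [tuple X (tnth s i) w | i < m].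
Arguments sample_tuple : simpl never.

Lemma measurable_sample_tuple m (s : m.-tuple nat) :
  measurable_fun setT (sample_tuple s).
Proof.
apply/measurable_fun_tnthP => i.
rewrite (_ : _ \o _ = X (tnth s i)); last first.
  by apply/funext => w /=; rewrite tnth_mktuple.
exact: measurable_funPT.
Qed.

HB.instance Definition _ m (s : m.-tuple nat) :=
  isMeasurableFun.Build _ _ _ _ (sample_tuple s) (measurable_sample_tuple s).

Hypothesis indX : mutually_independent X.

Lemma prob_box m (s : m.-tuple nat) (A : 'I_m -> set T) : uniq s ->
  (forall i, measurable (A i)) ->
  P (sample_tuple s @^-1` box A) = (\prod_(i < m) P (X (tnth s i) @^-1` A i))%E.
Proof.
move=> us mA.
pose B n : set T := [set y | forall i, tnth s i = n -> A i y].
have BE i : B (tnth s i) = A i.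
  apply/seteqP; split => y /=; first exact.
  by move=> Aiy k /(tuple_uniqP s us) ->.
have mB n : measurable (B n).
  rewrite (_ : B n = \bigcap_(i in [set: 'I_m])
      (if tnth s i == n then A i else setT)).
    by apply: fin_bigcap_measurable => // i _; case: ifP.
  apply/seteqP; split => y /= H i => [_|].
    by case: eqP => // sin; exact: H.
  by move=> sin; have := H i I; rewrite sin eqxx.
have := indX [fset x in (s : seq nat)]%fset mB.
rewrite (perm_big (s : seq nat)) /=; last first.
  apply: uniq_perm => //; first exact: fset_uniq.
  by move=> x; rewrite inE.
rewrite big_tuple => H; rewrite -(eq_bigr _ (fun i _ => congr1 (fun C => P (X (tnth s i) @^-1` C)) (BE i))) -H.
congr (P _); apply/seteqP; split => w /=.
  move=> Aw n /=; rewrite !inE => /tnthP[i ->].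
  by rewrite /preimage/= BE; have := Aw i; rewrite tnth_mktuple.
move=> H' i; rewrite tnth_mktuple -BE; apply: H'.
by rewrite /= !inE mem_tnth.
Qed.

Lemma sample_tuple_cons m k (s : m.-tuple nat) w :
  sample_tuple [tuple of k :: s] w = [tuple of X k w :: sample_tuple s w].
Proof.
apply: eq_from_tnth => i; rewrite tnth_mktuple.
have [->|] := eqVneq i ord0; first by rewrite !tnth0.
by rewrite eq_sym => /unlift_some[j -> _]; rewrite !tnthS tnth_mktuple.
Qed.

Lemma indep_cons m k (s : m.-tuple nat) (B : set T) (A : set (m.-tuple T)) :
  uniq (k :: s) -> measurable B -> measurable A ->
  P (X k @^-1` B `&` sample_tuple s @^-1` A) =
  (P (X k @^-1` B) * P (sample_tuple s @^-1` A))%E.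
Proof.
move=> uks mB mA; have us : uniq s by case/andP: uks.
have mXB : measurable (X k @^-1` B) by exact: measurable_funPTI.
pose m1 := push_measure (mrestr P mXB) (measurable_sample_tuple s).
have PB0 : 0 <= fine (P (X k @^-1` B)) by exact: fine_ge0.
pose m2 := mscale (NngNum PB0) (push_measure P (measurable_sample_tuple s)).
have : m1 A = m2 A.
  apply: (@tuple_measure_unique _ T R m m1 m2 (fun=> setT)) => //.
  - by apply/seteqP; split => // x _; exists 0%N.
  - move=> _; rewrite /m1/= /pushforward/= /mrestr.
    apply: (@le_lt_trans _ _ (P setT)); last by rewrite probability_setT ltry.
    apply: le_measure; rewrite ?inE//; apply: measurableI => //.
    by rewrite -[X in measurable X]setTI; apply: measurable_sample_tuple => //; exact: measurable_box.
  - move=> C mC; rewrite /m1 /m2/= /mscale/= /pushforward/= /mrestr/=.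
    rewrite fineK ?fin_num_measure// prob_box// setIC.
    have := @prob_box _ [tuple of k :: s]
      (fun i => if unlift ord0 i is Some j then C j else B) uks.
    rewrite big_ord_recl unlift_none tnth0.
    under eq_bigr do rewrite liftK tnthS.
    move=> <-; last by move=> i; case: unliftP.
    congr (P _); apply/seteqP; split => w /=.
      move=> [Bw Cw] i; rewrite sample_tuple_cons.
      by case: unliftP => [j|] ->; rewrite ?tnthS ?tnth0.
    move=> H; split; first by have := H ord0; rewrite unlift_none sample_tuple_cons tnth0.
    by move=> i; have := H (lift ord0 i); rewrite liftK sample_tuple_cons tnthS.
rewrite /m1 /m2/= /mscale/= /pushforward/= /mrestr/= fineK ?fin_num_measure//.
by rewrite setIC.
Qed.

Hypothesis identX : forall i B, measurable B ->
  P (X i @^-1` B) = P (X 0%N @^-1` B).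

Let F := distribution P (X 0%N).

Lemma law_cons m k (s : m.-tuple nat) (C : set (T * m.-tuple T)) :
  uniq (k :: s) -> measurable C ->
  P [set w | C (X k w, sample_tuple s w)] =
  (\int[F]_x P [set w | C (x, sample_tuple s w)])%E.
Proof.
move=> uks mC.
have mf : measurable_fun setT (fun w => (X k w, sample_tuple s w)).
  by apply: measurable_fun_pair; [exact: measurable_funPT|exact: measurable_sample_tuple].
have H A B : measurable A -> measurable B -> push_measure P mf (A `*` B) =
    (F A * distribution P (sample_tuple s) B)%E.
  move=> mA mB.
  by rewrite /= /pushforward/= /F /distribution/= /pushforward -(identX k)// -indep_cons.
rewrite -[LHS]/(push_measure P mf C) -(product_measure_unique H mC).
apply: eq_integral => x _ /=; rewrite /distribution/pushforward/=.
by congr (P _); apply/seteqP; split => w; rewrite /preimage/= /xsection/= ?inE//= in_setE.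
Qed.

Lemma law_cons2 m i k (s : m.-tuple nat) (C : set (T * (T * m.-tuple T))) :
  uniq [:: i, k & s] -> measurable C ->
  P [set w | C (X i w, (X k w, sample_tuple s w))] =
  (\int[F]_x \int[F]_y P [set w | C (x, (y, sample_tuple s w))])%E.
Proof.
move=> uiks mC; have uks : uniq (k :: s) by case/andP: uiks.
pose g (z : T * m.+1.-tuple T) := (z.1, (thead z.2, [tuple of behead z.2] : m.-tuple T)).
have mg : measurable_fun setT g.
  apply: measurable_fun_pair => //; apply: measurable_fun_pair.
    exact: (measurableT_comp (measurable_tnth ord0)).
  exact: (measurableT_comp (@measurable_behead _ T m) measurable_snd).
have E w : g (X i w, sample_tuple [tuple of k :: s] w) = (X i w, (X k w, sample_tuple s w)).
  rewrite /g sample_tuple_cons; congr (_, (_, _)); exact/val_inj.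
have mgC : measurable (g @^-1` C) by rewrite -[X in measurable X]setTI; exact: mg.
have := @law_cons _ i [tuple of k :: s] (g @^-1` C) uiks mgC.
rewrite (_ : [set w | _] = [set w | C (X i w, (X k w, sample_tuple s w))]); last first.
  by apply/seteqP; split => w; rewrite /preimage/= E.
move=> ->; apply: eq_integral => x _.
rewrite -(@law_cons _ k s [set z | C (x, z)]) //; last first.
  by have := measurable_xsection x mC; rewrite xsectionE.
have E' w : g (x, sample_tuple [tuple of k :: s] w) = (x, (X k w, sample_tuple s w)).
  by rewrite /g sample_tuple_cons; congr (_, (_, _)); exact/val_inj.
by congr (P _); apply/seteqP; split => w; rewrite /preimage/= E'.
Qed.

(* The counting recursion of [pois_lt_approx]. *)
Fixpoint count_lt (p1 p2 : R) (m a b : nat) : R :=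
  if m is m'.+1 then (1 - p1 - p2) * count_lt p1 p2 m' a b +
    p1 * count_lt p1 p2 m' a.-1 b + p2 * count_lt p1 p2 m' a b.-1
  else (0 < a)%N%:R * (0 < b)%N%:R.

Lemma measurable_count_lt dS (S : measurableType dS) m (p : 'I_m -> S -> bool) a :
  (forall i, measurable [set z | p i z]) ->
  measurable [set z | (\sum_(i < m) p i z < a)%N].
Proof.
move=> mp.
have mf : measurable_fun setT (fun z => \sum_(i < m) \1_[set z | p i z] z : R).
  by apply: measurable_sum => i; exact: measurable_indic.
rewrite (_ : [set _ | _] = setT `&` [set z |
    \sum_(i < m) \1_[set z | p i z] z <= a.-1%:R + - (a == 0)%:R :> R]).
  by apply: measurable_fun_le.
rewrite setTI; apply/seteqP.
suff E z : (\sum_(i < m) \1_[set z | p i z] z <= a.-1%:R + - (a == 0)%:R :> R) =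
    (\sum_(i < m) p i z < a)%N by split => z /=; rewrite E.
under eq_bigr do rewrite indic_bool.
rewrite -natr_sum; case: a => [|a] /=; last by rewrite subr0 ler_nat.
by apply/negbTE; rewrite -ltNge sub0r (lt_le_trans (_ : _ < 0))// ltrN10.
Qed.

Lemma count_tuple m (p : pred T) (v : m.-tuple T) :
  count p v = (\sum_(i < m) p (tnth v i))%N.
Proof. by rewrite -sumn_count sumnE big_map big_tuple. Qed.

Definition counts_in m (s : m.-tuple nat) (p1 p2 : pred T) a b : set Omega :=
  [set w | (count p1 (sample_tuple s w) < a)%N && (count p2 (sample_tuple s w) < b)%N].

Lemma prob_counts_in m (s : m.-tuple nat) (p1 p2 : pred T) a b : uniq s ->
  measurable [set y | p1 y] -> measurable [set y | p2 y] ->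
  (forall y, p1 y -> ~~ p2 y) ->
  P (counts_in s p1 p2 a b) =
  (count_lt (fine (F [set y | p1 y])) (fine (F [set y | p2 y])) m a b)%:E.
Proof.
move=> + mp1 mp2 p12; elim: m s a b => [|m IH] s a b.
  move=> _; have -> : counts_in s p1 p2 a b = [set w | (0 < a)%N && (0 < b)%N].
    have E p w : count p (sample_tuple s w) = 0%N by rewrite tuple0.
    by apply/seteqP; split => w; rewrite /counts_in/= !E.
  rewrite /= -natrM mulnb; case: (_ && _).
    by rewrite (_ : [set _ | _] = setT) ?probability_setT//; apply/seteqP.
  have -> : [set w : Omega | false] = set0 by apply/seteqP; split => w.
  by rewrite measure0.
case/tupleP: s => k s uks; have us : uniq s by case/andP: uks.
have mv a' b' : measurable [set v : m.-tuple T | (count p1 v < a')%N && (count p2 v < b')%N].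
  rewrite (_ : [set _ | _] =
    [set v : m.-tuple T | (\sum_(i < m) p1 (tnth v i) < a')%N] `&`
    [set v : m.-tuple T | (\sum_(i < m) p2 (tnth v i) < b')%N]); last first.
    by apply/seteqP; split => v; rewrite /= !count_tuple => /andP.
  apply: measurableI; apply: measurable_count_lt => i.
    by have := @measurable_tnth _ T m i measurableT _ mp1; rewrite setTI.
  by have := @measurable_tnth _ T m i measurableT _ mp2; rewrite setTI.
have H (q : pred T) a' b' : measurable [set y | q y] ->
    P (X k @^-1` [set y | q y] `&` counts_in s p1 p2 a' b') =
    (F [set y | q y] * (count_lt (fine (F [set y | p1 y])) (fine (F [set y | p2 y])) m a' b')%:E)%E.
  move=> mq; rewrite -(IH s)// /F /distribution/= /pushforward -(identX k mq).
  exact: (@indep_cons _ k s _ _ uks mq (mv a' b')).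
pose q y := ~~ p1 y && ~~ p2 y.
have mq : measurable [set y | q y].
  rewrite (_ : [set _ | _] = ~` [set y | p1 y] `&` ~` [set y | p2 y]).
    by apply: measurableI; exact: measurableC.
  apply/seteqP; split => y /=; rewrite /q; first by move=> /andP[/negP ? /negP ?].
  by move=> [/negP ? /negP ?]; apply/andP.
have mc a' b' : measurable (counts_in s p1 p2 a' b').
  by have := measurable_sample_tuple s measurableT (mv a' b'); rewrite setTI.
have mX (r : pred T) : measurable [set y | r y] -> measurable (X k @^-1` [set y | r y]).
  by move=> mr; exact: measurable_funPTI.
have -> : counts_in [tuple of k :: s] p1 p2 a b =
    X k @^-1` [set y | q y] `&` counts_in s p1 p2 a b `|`
    X k @^-1` [set y | p1 y] `&` counts_in s p1 p2 a.-1 b `|`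
    X k @^-1` [set y | p2 y] `&` counts_in s p1 p2 a b.-1.
  have S w (p : pred T) : count p (sample_tuple [tuple of k :: s] w) =
    (p (X k w) + count p (sample_tuple s w))%N by rewrite sample_tuple_cons.
  apply/seteqP; split => w;
      rewrite /counts_in /setU /setI /preimage /mkset !S /q;
      move: (count p1 (sample_tuple s w)) (count p2 (sample_tuple s w)) => c1 c2;
      have := p12 (X k w); case: (p1 (X k w)); case: (p2 (X k w)) => /= [] pp;
      rewrite ?add0n; try by have := pp isT.
  - by move=> /andP[h1 h2]; left; right; split => //; apply/andP; split; lia.
  - by move=> /andP[h1 h2]; right; split => //; apply/andP; split; lia.
  - by move=> h; left; left.
  - by move=> [[[]|[_ /andP[h1 h2]]]|[]]//; apply/andP; split; lia.
  - by move=> [[[]|[]]|[_ /andP[h1 h2]]]//; apply/andP; split; lia.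
  - by move=> [[[]|[]]|[]].
rewrite !measureU//; last 6 first.
- by apply: measurableI; [exact: mX|exact: mc].
- by apply: measurableI; [exact: mX|exact: mc].
- by apply/seteqP; split => // w /= [[+ _] [+ _]]; rewrite /q/= => /andP[/negP].
- by apply: measurableU; apply: measurableI; [exact: mX|exact: mc|exact: mX|exact: mc].
- by apply: measurableI; [exact: mX|exact: mc].
- apply/seteqP; split => // w /= [[[+ _]|[+ _]] [+ _]]; rewrite /q/=.
    by move=> /andP[_ /negP].
  by move=> /p12/negP.
set c := count_lt _ _ in H *.
transitivity (F [set y | q y] * (c m a b)%:E + F [set y | p1 y] * (c m a.-1 b)%:E +
    F [set y | p2 y] * (c m a b.-1)%:E)%E.
  by congr (_ + _ + _)%E; exact: H.
rewrite {H} [RHS](_ : _ = ((1 - fine (F [set y | p1 y]) - fine (F [set y | p2 y])) * c m a b +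
  fine (F [set y | p1 y]) * c m a.-1 b + fine (F [set y | p2 y]) * c m a b.-1)%:E)//.
rewrite !EFinD !EFinM !fineK ?fin_num_measure//.
congr (_ * _ + _ + _)%E.
have := probability_setT F; rewrite (_ : setT = [set y | q y] `|` [set y | p1 y] `|` [set y | p2 y]).
  rewrite !measureU//; last 3 first.
  - by apply/seteqP; split => // y /= []; rewrite /q => /andP[/negP].
  - exact: measurableU.
  - by apply/seteqP; split => // y /= [[|]]; [rewrite /q => /andP[_ /negP]|move=> /p12/negP].
  move=> E1; have : ((fine (F [set y | q y]))%:E + (fine (F [set y | p1 y]))%:E +
      (fine (F [set y | p2 y]))%:E = 1)%E by rewrite !fineK ?fin_num_measure.
  rewrite -!EFinD => -[E2]; rewrite -[LHS]fineK ?fin_num_measure//; congr EFin.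
  by rewrite -E2; ring.
apply/seteqP; split => // y _; rewrite /q /=; case: (p1 y); first by left; right.
by case: (p2 y); [right|left; left].
Qed.

End sampling_law.

(** * Local mass of the density *)

Section layer_cake.
Context {R : realType}.
Local Open Scope ereal_scope.

Definition layer (y t : R) : R := ((0 < t) && (t < y))%R%:R.

Lemma measurable_layer dS (S : measurableType dS) (y t : S -> R) :
  measurable_fun setT y -> measurable_fun setT t ->
  measurable_fun setT (fun z => layer (y z) (t z)).
Proof.
move=> my mt; rewrite (_ : (fun z => _) =
    \1_[set z | (0 < t z) && (t z < y z)]%R); last first.
  by apply/funext => z; rewrite indic_bool.
apply: measurable_indic.
rewrite (_ : [set _ | _] = ~` [set z | t z <= 0]%R `&` ~` [set z | y z <= t z]%R).
  apply: measurableI; apply: measurableC; rewrite -[X in measurable X]setTI;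
    exact: measurable_fun_le.
apply/seteqP; split => z /=; first by move=> /andP[/lt_geF h1 /lt_geF h2]; rewrite h1 h2.
by move=> [/negP h1 /negP h2]; rewrite !ltNge h1 h2.
Qed.

Lemma integral_layer (y : R) : (0 <= y)%R ->
  \int[lebesgue_measure]_t (layer y t)%:E = y%:E.
Proof.
move=> y0; transitivity (\int[lebesgue_measure]_t (\1_(`]0%R, y[%classic : set R) t)%:E).
  by apply: eq_integral => t _; rewrite /layer -(indic_bool _ (fun t => (0 < t) && (t < y))%R);
    congr (\1_ _ _)%:E; apply/seteqP; split => z; rewrite /= in_itv.
rewrite integral_indic//= setIT lebesgue_measure_itv/= lte_fin.
case: ltgtP y0 => // [y0 _|<- _]; first by rewrite -EFinD subr0.
by [].
Qed.

Lemma integral_density dT (T : measurableType dT)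
    (mu m : {sigma_finite_measure set T -> \bar R}) (f g : T -> R) :
  measurable_fun setT f -> (forall x, 0 <= f x)%R ->
  (forall A, measurable A -> m A = \int[mu]_(x in A) (f x)%:E) ->
  measurable_fun setT g -> (forall x, 0 <= g x)%R ->
  \int[m]_x (g x)%:E = \int[mu]_x (g x * f x)%:E.
Proof.
move=> mf f0 mE mg g0.
have l0 y t : (0 <= layer y t)%R by rewrite /layer.
transitivity (\int[m]_x \int[lebesgue_measure]_t (layer (g x) t)%:E).
  by apply: eq_integral => x _; rewrite integral_layer.
rewrite (@tonelli_swap _ _ _ _ _ m lebesgue_measure (fun x t => (layer (g x) t)%:E)); last 2 first.
- apply/measurable_EFinP; apply: measurable_layer => //.
  exact: (measurableT_comp mg).
- by move=> x t; rewrite lee_fin.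
transitivity (\int[lebesgue_measure]_t \int[mu]_x (layer (g x) t * f x)%:E).
  apply: eq_integral => t _.
  pose A := [set x | (0 < t) && (t < g x)]%R.
  have mA : measurable A.
    have /measurable_indicP : measurable_fun setT (\1_A : T -> R).
      rewrite (_ : \1_A = fun x => layer (g x) t).
        exact: measurable_layer.
      by apply/funext => x; rewrite indic_bool.
    by [].
  transitivity (m A).
    transitivity (\int[m]_x (\1_A x)%:E); last by rewrite integral_indic// setIT.
    by apply: eq_integral => x _; rewrite indic_bool.
  rewrite mE// integral_mkcond; apply: eq_integral => x _.
  rewrite /layer -(indic_bool _ (fun x => (0 < t) && (t < g x))%R x) -/A patchE indicE.
  by case: (x \in A); rewrite ?mul1r ?mul0r.
rewrite -(@tonelli_swap _ _ _ _ _ mu lebesgue_measure (fun x t => (layer (g x) t * f x)%:E)); last 2 first.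
- apply/measurable_EFinP; apply: measurable_funM; last exact: (measurableT_comp mf).
  by apply: measurable_layer => //; exact: (measurableT_comp mg).
- by move=> x t; rewrite lee_fin mulr_ge0.
apply: eq_integral => x _; under eq_integral do rewrite EFinM.
rewrite ge0_integralZr//.
- by rewrite integral_layer.
- by apply/measurable_EFinP; exact: measurable_layer.
- by move=> t _; rewrite lee_fin.
- by rewrite lee_fin.
Qed.

End layer_cake.

Section local_density.
Context {R : realType} {d : nat}.
Local Notation T := (d.-tuple R).
Variables (F : probability T R) (f : T -> R) (t : R).
Hypothesis d_gt0 : (0 < d)%N.
Hypothesis t_gt0 : 0 < t.
Hypothesis fF : prob_density f.
Hypothesis FE : forall A, measurable A -> (F A = \int[leb d]_(x in A) (f x)%:E)%E.

Let mf : measurable_fun setT f. Proof. by case: fF. Qed.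
Let f0 x : 0 <= f x. Proof. by case: fF. Qed.

(* [rad 0 = t], so that the radius is positive for all [n]. *)
Definition rad n : R := t * (maxn 1 n)%:R `^ (- d%:R^-1).

Lemma rad_gt0 n : 0 < rad n.
Proof. by rewrite mulr_gt0// powR_gt0// ltr0n leq_max. Qed.

Lemma rad_exp n : (0 < n)%N -> n%:R * rad n ^+ d = t ^+ d.
Proof.
move=> n0; rewrite /rad (maxn_idPr n0) exprMn -[X in _ * (_ * X)]powR_mulrn ?powR_ge0//.
rewrite -powRrM mulNr mulVf ?pnatr_eq0 -?lt0n//.
by rewrite powRN powRr1// mulrCA mulfV ?mulr1// pnatr_eq0 -lt0n.
Qed.

Lemma rad_cvg0 : rad @ \oo --> 0.
Proof.
apply/cvgrPdist_lt => e e0; near=> n.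
have n0 : (0 < n)%N by near: n; exact: nbhs_infty_gt.
rewrite sub0r normrN gtr0_norm ?rad_gt0//.
rewrite -(@ltr_pXn2r _ d) ?nnegrE ?ltW ?rad_gt0//.
have n0' : 0 < n%:R :> R by rewrite ltr0n.
rewrite -(ltr_pM2l n0') rad_exp// -ltr_pdivrMr ?exprn_gt0//.
by near: n; exact: nbhs_infty_gtr.
Unshelve. all: by end_near. Qed.

Definition ballmass n x : R := fine (F (eball x (rad n))).

Lemma measurable_dist_le dS (S : measurableType dS) (u v : S -> T) (a : R) :
  measurable_fun setT u -> measurable_fun setT v ->
  measurable [set z | eucl_dist (u z) (v z) <= a].
Proof.
move=> mu mv; rewrite -[X in measurable X]setTI.
by apply: measurable_fun_le => //; exact: measurable_eucl_dist.
Qed.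

Lemma measurable_ballmass n : measurable_fun setT (ballmass n).
Proof.
apply: (measurableT_comp (fine_measurable measurableT)) => //.
have -> : (fun x => F (eball x (rad n))) =
    (fun x => \int[F]_y (\1_[set z : T * T | eucl_dist z.1 z.2 <= rad n] (x, y))%:E)%E.
  apply/funext => x.
  transitivity (\int[F]_y (\1_(eball x (rad n)) y)%:E)%E.
    by rewrite integral_indic ?setIT//; exact: measurable_eball.
  by apply: eq_integral => y _; rewrite !indicE.
apply: (@measurable_tonelli _ _ _ _ _ F (fun x y => (\1_[set z : T * T | eucl_dist z.1 z.2 <= rad n] (x, y))%:E)).
  apply/measurable_EFinP; rewrite [X in measurable_fun _ X](_ : _ =
      \1_[set z : T * T | eucl_dist z.1 z.2 <= rad n]).
    by apply: measurable_indic; exact: measurable_dist_le.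
  by apply/funext => -[].
by move=> x y; rewrite lee_fin.
Qed.

Definition density_err n x : R :=
  `|n%:R * ballmass n x - ball_vol R d * t ^+ d * f x|.

Lemma measurable_density_err n : measurable_fun setT (density_err n).
Proof.
apply: measurableT_comp => //; apply: measurable_funB; apply: measurable_funM => //.
exact: measurable_ballmass.
Qed.

Lemma density_err_le n x : (0 < n)%N -> ((density_err n x)%:E <=
  (t ^+ d)%:E * \int[leb d]_y (ker rad n x y * `|f x - f y|)%:E)%E.
Proof.
move=> n0; have rd0 : 0 < rad n ^+ d by rewrite exprn_gt0// rad_gt0.
have k0 := ker_ge0 rad_gt0.
have mk (g : T -> R) : measurable_fun setT g -> measurable_fun setT (fun y => (ker rad n x y * g y)%:E).
  move=> mg; apply/measurable_EFinP; apply: measurable_funM => //.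
  exact: measurable_ker.
have k1 : (\int[leb d]_y (ker rad n x y * f y)%:E = (rad n ^- d * ballmass n x)%:E)%E.
  rewrite EFinM fineK ?fin_num_measure//; last exact: measurable_eball.
  rewrite FE; last exact: measurable_eball.
  rewrite -ge0_integralZl//; last 4 first.
  - exact: measurable_eball.
  - by apply: measurable_funTS; exact/measurable_EFinP.
  - by move=> y _; rewrite lee_fin.
  - by rewrite lee_fin invr_ge0 ltW.
  rewrite [RHS]integral_mkcond.
  apply: eq_integral => y _; rewrite patchE /ker -(indic_bool R (fun y => eucl_dist x y <= rad n)) indicE.
  by rewrite -[mkset _]/(eball x (rad n)); case: ifPn => yE; rewrite ?mulr1 ?mulr0 ?mul0r// -EFinM.
have k2 : (\int[leb d]_y (ker rad n x y * f x)%:E = (ball_vol R d * f x)%:E)%E.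
  under eq_integral do rewrite EFinM.
  rewrite ge0_integralZr//; first by rewrite integral_ker//; exact: rad_gt0.
  - by apply/measurable_EFinP; exact: measurable_ker.
  - by move=> y _; rewrite lee_fin.
  - by rewrite lee_fin.
have -> : density_err n x = t ^+ d * `|rad n ^- d * ballmass n x - ball_vol R d * f x|.
  rewrite -[X in X * `|_|]gtr0_norm ?exprn_gt0// -normrM mulrBr /density_err.
  by rewrite mulrA -(rad_exp n0) mulfK ?gt_eqF//; congr (`|_ - _|); ring.
have td0 : (0 <= (t ^+ d)%:E)%E by rewrite lee_fin exprn_ge0// ltW.
rewrite EFinM; apply: lee_wpmul2l => //.
apply: le_trans (norm_integralB_le _ _ _ _ k1 k2) _.
- by apply/measurable_EFinP; exact: mk.
- by apply/measurable_EFinP; exact: mk.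
- by move=> y; rewrite mulr_ge0.
- by move=> y; rewrite mulr_ge0.
apply: ge0_le_integralT => y; rewrite lee_fin//.
by rewrite -mulrBr normrM ger0_norm// distrC.
Qed.

Lemma density_err_vanishes :
  vanishes (fun n => \int[leb d]_x (density_err n x)%:E)%E.
Proof.
have i_f : (leb d).-integrable setT (EFin \o f).
  apply/integrableP; split; first exact/measurable_EFinP.
  rewrite (eq_integral (fun x => (f x)%:E)); last first.
    by move=> x _ /=; rewrite ger0_norm.
  by rewrite -FE// probability_setT ltry.
have [_ of0] := osc_small_integrable rad_gt0 rad_cvg0 i_f.
have td0 : 0 <= t ^+ d by rewrite exprn_ge0// ltW.
have := vanishesZ td0 (fun n => osc_ge0 rad_gt0 n f) of0.
move=> H e e0; near=> n.
have n0 : (0 < n)%N by near: n; exact: nbhs_infty_gt.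
apply: (@le_trans _ _ ((t ^+ d)%:E * osc rad n f)%E); last by near: n; exact: H.
have mk : measurable_fun setT (fun x => \int[leb d]_y (ker rad n x y * `|f x - f y|)%:E)%E.
  apply: (@measurable_tonelli _ _ _ _ _ (leb d) (fun x y => (ker rad n x y * `|f x - f y|)%:E)).
    exact: measurable_ker_osc.
  by move=> x y; rewrite lee_fin mulr_ge0// ker_ge0//; exact: rad_gt0.
rewrite /osc -ge0_integralZl//; last first.
  by move=> x _; apply: integral_ge0 => y _; rewrite lee_fin mulr_ge0// ker_ge0//; exact: rad_gt0.
apply: ge0_le_integralT => x; first by rewrite lee_fin /density_err.
exact: density_err_le.
Unshelve. all: end_near. Qed.

End local_density.

Lemma vanishes_div_nat (R : realType) (c : R) :
  vanishes (fun n => (c / n%:R)%:E).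
Proof.
move=> e e0; near=> n.
have n0 : 0 < n%:R :> R by rewrite ltr0n; near: n; exact: nbhs_infty_gt.
rewrite lee_fin ler_pdivrMr// mulrC -ler_pdivrMr// ltW//.
by near: n; exact: nbhs_infty_gtr.
Unshelve. all: by end_near. Qed.

Lemma integral_cst_probability dT (T : measurableType dT) (R : realType)
    (P : probability T R) (c : R) : (\int[P]_x c%:E = c%:E)%E.
Proof.
rewrite integral_cst//; transitivity (c%:E * P setT)%E => //.
by rewrite probability_setT mule1.
Qed.

Section local_poisson.
Context {R : realType} {d : nat}.
Local Notation T := (d.-tuple R).
Variables (F : probability T R) (f : T -> R) (j : nat) (t : R).
Hypothesis d_gt0 : (0 < d)%N.
Hypothesis t_gt0 : 0 < t.
Hypothesis fF : prob_density f.
Hypothesis FE : forall A, measurable A -> (F A = \int[leb d]_(x in A) (f x)%:E)%E.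

Let mf : measurable_fun setT f. Proof. by case: fF. Qed.
Let f0 x : 0 <= f x. Proof. by case: fF. Qed.
Local Notation p := (ballmass F t).
Local Notation D := (density_err F f t).

Definition pois_err n x : R :=
  Num.min 1 (D n x + (2 * (n%:R * p n x) + 4 * (n%:R * p n x) ^+ 2) / n%:R).

Lemma measurable_pois_err n : measurable_fun setT (pois_err n).
Proof.
have mq : measurable_fun setT (fun x => n%:R * p n x).
  by apply: measurable_funM => //; exact: measurable_ballmass.
apply: measurable_minr => //; apply: measurable_funD.
  exact: measurable_density_err.
apply: measurable_funM => //; apply: measurable_funD.
  exact: measurable_funM.
by apply: measurable_funM => //; exact: (measurableT_comp (exprn_measurable 2)).
Qed.

Lemma ballmass_ge0 n x : 0 <= p n x. Proof. exact: fine_ge0. Qed.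

Lemma ballmass_le1 n x : p n x <= 1.
Proof.
rewrite -lee_fin fineK ?fin_num_measure//; last exact: measurable_eball.
by apply: probability_le1; exact: measurable_eball.
Qed.

Lemma pois_err_ge0 n x : 0 <= pois_err n x.
Proof.
have q0 : 0 <= n%:R * p n x by rewrite mulr_ge0// ballmass_ge0.
rewrite le_min ler01/=; apply: addr_ge0; first by rewrite /density_err.
by rewrite divr_ge0// addr_ge0// mulr_ge0// exprn_ge0.
Qed.

Lemma pois_err_le1 n x : pois_err n x <= 1. Proof. by rewrite ge_min lexx. Qed.

Lemma pois_err_integral n :
  exists2 e : R, 0 <= e & (\int[F]_x (pois_err n x)%:E = e%:E)%E.
Proof.
have : (\int[F]_x (pois_err n x)%:E <= \int[F]_x 1%:E)%E.
  by apply: ge0_le_integralT => x; rewrite lee_fin ?pois_err_ge0// pois_err_le1.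
rewrite integral_cst_probability; have : (0 <= \int[F]_x (pois_err n x)%:E)%E.
  by apply: integral_ge0 => x _; rewrite lee_fin pois_err_ge0.
case: (\int[F]_x _)%E => [e||]// e0 _.
by exists e => //; rewrite -lee_fin.
Qed.

Lemma pois_err_le (a c : R) n x : 0 <= a -> f x <= a ->
  c = ball_vol R d * t ^+ d * a + 1 ->
  pois_err n x <= D n x + (2 * c + 4 * c ^+ 2) / n%:R.
Proof.
move=> a0 fa cE.
have [D1|D1] := leP 1 (D n x).
  rewrite (le_trans (pois_err_le1 n x))// (le_trans D1)// lerDl.
  have c0 : 0 <= c by rewrite ?cE addr_ge0// !mulr_ge0 ?ball_vol_ge0// exprn_ge0// ltW.
  by rewrite divr_ge0// addr_ge0// mulr_ge0// exprn_ge0.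
rewrite /pois_err ge_min; apply/orP; right; rewrite lerD2l ler_wpM2r ?invr_ge0//.
have q0 : 0 <= n%:R * p n x by rewrite mulr_ge0// ballmass_ge0.
have qc : n%:R * p n x <= c.
  have := ler_norm (n%:R * p n x - ball_vol R d * t ^+ d * f x).
  rewrite -/(density_err F f t n x).
  have : ball_vol R d * t ^+ d * f x <= ball_vol R d * t ^+ d * a.
    by rewrite ler_wpM2l// mulr_ge0 ?ball_vol_ge0// exprn_ge0// ltW.
  rewrite cE; lra.
nra.
Qed.

Lemma pois_err_vanishes : vanishes (fun n => \int[F]_x (pois_err n x)%:E)%E.
Proof.
apply: vanishes_approx => e e0.
pose A k := [set x | (k%:R < f x)].
have mA k : measurable (A k).
  by rewrite -[A k]setTI; apply: (measurable_fun_ltr) => //.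
have : (F \o A) @ \oo --> F (\bigcap_k A k).
  apply: nonincreasing_cvg_mu => //.
  - by rewrite (le_lt_trans (probability_le1 _ _))// ltry.
  - exact: bigcap_measurableType.
  - move=> m n mn; rewrite subsetEset => x /=; apply: le_lt_trans; by rewrite ler_nat.
rewrite (_ : \bigcap_k A k = set0); last first.
  apply/seteqP; split => // x Ax.
  have := Ax (Num.truncn (f x)).+1 I; rewrite /A/= ltNge (ltW (truncnS_gt _))//.
rewrite measure0 => /cvg_vanishes/(_ _ e0)[k _ /(_ k (leqnn _))] /= Ake.
pose c := ball_vol R d * t ^+ d * k%:R + 1.
exists (fun n => k%:R%:E * \int[leb d]_x (D n x)%:E + ((2 * c + 4 * c ^+ 2) / n%:R)%:E)%E.
  apply: vanishesD.
    apply: vanishesZ => //; last exact: density_err_vanishes.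
    by move=> n; apply: integral_ge0 => x _; rewrite lee_fin /density_err.
  exact: vanishes_div_nat.
move=> n.
pose c' := (2 * c + 4 * c ^+ 2) / n%:R.
have c0 : 0 <= c by rewrite ?cE addr_ge0// !mulr_ge0 ?ball_vol_ge0// exprn_ge0// ltW.
have c'0 : 0 <= c' by rewrite divr_ge0// addr_ge0// mulr_ge0// exprn_ge0.
have mD := measurable_density_err F t fF n.
pose h x : R := (1 - \1_(A k) x) * D n x.
have mh : measurable_fun setT h.
  by apply: measurable_funM => //; apply: measurable_funB => //; exact: measurable_indic.
have i01 x : 0 <= (\1_(A k) x : R) <= 1 by rewrite indicE ler0n lern1 leq_b1.
have h0 x : 0 <= h x by rewrite mulr_ge0 ?/density_err// subr_ge0; case/andP: (i01 x).
apply: (@le_trans _ _ (\int[F]_x ((h x)%:E + (\1_(A k) x)%:E + c'%:E))%E).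
  apply: ge0_le_integralT => x; first by rewrite lee_fin pois_err_ge0.
  rewrite -!EFinD lee_fin /h.
  have [Ax|nAx] := pselect (A k x).
    rewrite indicE mem_set//= subrr mul0r add0r (le_trans (pois_err_le1 n x))//.
    by rewrite lerDl.
  rewrite indicE memNset//= subr0 mul1r addr0 (@pois_err_le k%:R)//.
  by move/negP : nAx; rewrite -leNgt.
have m1 : measurable_fun setT (fun x => (\1_(A k) x)%:E : \bar R).
  by apply/measurable_EFinP; exact: measurable_indic.
rewrite ge0_integralD//; last 2 first.
- by move=> x _; rewrite -EFinD lee_fin addr_ge0//; case/andP: (i01 x).
- by apply: emeasurable_funD => //; exact/measurable_EFinP.
rewrite ge0_integralD//; last 2 first.
- by move=> x _; rewrite lee_fin.
- exact/measurable_EFinP.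
rewrite integral_indic// setIT (integral_cst_probability F).
rewrite addeAC; apply: leeD => //; apply: leeD => //.
rewrite (integral_density mf f0 FE mh h0).
rewrite -ge0_integralZl//; last 2 first.
- exact/measurable_EFinP.
- by move=> x _; rewrite lee_fin /density_err.
apply: ge0_le_integralT => x; first by rewrite lee_fin mulr_ge0.
rewrite -EFinM lee_fin /h mulrAC ler_wpM2r ?/density_err//.
have [Ax|nAx] := pselect (A k x).
  by rewrite indicE mem_set//= subrr mul0r.
rewrite indicE memNset//= subr0 mul1r.
by move/negP : nAx; rewrite -leNgt.
Unshelve. all: end_near. Qed.

Definition pois_avg : R := fine (\int[F]_x (pois_lt j (ball_vol R d * t ^+ d * f x))%:E).

Local Notation G := (fun x => pois_lt j (ball_vol R d * t ^+ d * f x)).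

Lemma pois_arg_ge0 x : 0 <= ball_vol R d * t ^+ d * f x.
Proof. by rewrite !mulr_ge0// ?ball_vol_ge0// exprn_ge0// ltW. Qed.

Lemma measurable_pois_avg : measurable_fun setT G.
Proof.
have c : continuous (pois_lt j : R -> R).
  move=> x; apply: differentiable_continuous.
  by apply/derivable1_diffP; have [] := is_derive_pois_lt j x.
apply: (measurableT_comp (continuous_measurable_fun c)).
exact: measurable_funM.
Qed.

Lemma pois_avgE : (\int[F]_x (G x)%:E = pois_avg%:E)%E.
Proof.
rewrite /pois_avg fineK// ge0_fin_numE; last first.
  by apply: integral_ge0 => x _; rewrite lee_fin pois_lt_ge0// pois_arg_ge0.
apply: (@le_lt_trans _ _ (\int[F]_x 1)%E).
  apply: ge0_le_integralT => x.
    by rewrite lee_fin pois_lt_ge0// pois_arg_ge0.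
  by rewrite lee_fin pois_lt_le1// pois_arg_ge0.
by rewrite (integral_cst_probability F 1) ltry.
Qed.

Lemma pois_lt_ballmass m n x : (0 < n)%N -> (n <= m + 2)%N -> (m <= n)%N ->
  `|pois_lt j (m%:R * p n x) - G x| <= D n x + 2 * p n x.
Proof.
move=> n0 nm mn; have p0 := ballmass_ge0 n x.
apply: le_trans (pois_lt_lip _ _ _) _.
- by rewrite mulr_ge0.
- exact: pois_arg_ge0.
rewrite /density_err.
have -> : m%:R * p n x - ball_vol R d * t ^+ d * f x =
  (n%:R * p n x - ball_vol R d * t ^+ d * f x) - (n%:R - m%:R) * p n x by ring.
apply: le_trans (ler_normB _ _) _; rewrite lerD2l normrM (ger0_norm p0) ler_wpM2r//.
by rewrite ger0_norm ?subr_ge0 ?ler_nat// lerBlDr -natrD ler_nat addnC.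
Qed.

End local_poisson.

(** * Isolated points: mean and second moment *)

Lemma count_iota (a : pred nat) n : count a (iota 0 n) = (\sum_(k < n) a k)%N.
Proof. by rewrite -sumn_count sumnE big_map -[X in iota 0 X]subn0 big_mkord. Qed.

Definition nbrs {R : realType} {d : nat} (r : R) (x : nat -> d.-tuple R) (n i : nat) : nat :=
  count (fun k => (k != i) && (eucl_dist (x i) (x k) <= r)) (iota 0 n).

Definition isolated {R : realType} {d : nat} j (r : R) (x : nat -> d.-tuple R) (n i : nat) : bool :=
  (nbrs r x n i < j)%N.

Lemma far_balls_disjoint {R : realType} {d : nat} (r : R) (x y z : d.-tuple R) :
  0 <= r -> 2 * Num.sqrt d%:R * r < eucl_dist x y ->
  eucl_dist x z <= r -> ~~ (eucl_dist y z <= r).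
Proof.
move=> r0 xy xz; apply/negP => yz; move: xy; apply/negP; rewrite -leNgt.
have -> : 2 * Num.sqrt d%:R * r = Num.sqrt d%:R * (2 * r) :> R by ring.
apply: eucl_dist_le => [|i]; first by rewrite mulr_ge0.
have := le_trans (eucl_dist_coord x z i) xz.
have := le_trans (eucl_dist_coord y z i) yz.
have -> : tnth x i - tnth y i = (tnth x i - tnth z i) - (tnth y i - tnth z i) by ring.
by have := ler_normB (tnth x i - tnth z i) (tnth y i - tnth z i); lra.
Qed.

Lemma measurable_ball_count {R : realType} {d : nat} dS (S : measurableType dS) m (u : S -> d.-tuple R)
    (v : S -> m.-tuple (d.-tuple R)) (r : R) a :
  measurable_fun setT u -> measurable_fun setT v ->
  measurable [set z | (count (fun y => eucl_dist (u z) y <= r)%R (v z) < a)%N].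
Proof.
move=> mu mv.
rewrite (_ : [set _ | _] = [set z | (\sum_(i < m) (eucl_dist (u z) (tnth (v z) i) <= r)%R < a)%N]); last first.
  by apply/seteqP; split => z /=; rewrite count_tuple.
apply: (@measurable_count_lt R) => i; apply: measurable_dist_le => //.
by apply: (measurableT_comp (measurable_tnth i)).
Qed.

Lemma norm_mulB_le {R : realDomainType} (a b c e A B : R) : 0 <= b -> b <= 1 ->
  0 <= c -> c <= 1 -> `|a - c| <= A -> `|b - e| <= B -> `|a * b - c * e| <= A + B.
Proof.
move=> b0 b1 c0 c1 ac be.
have -> : a * b - c * e = (a - c) * b + c * (b - e) by ring.
apply: le_trans (ler_normD _ _) _; rewrite !normrM (ger0_norm b0) (ger0_norm c0).
by apply: lerD; [apply: le_trans ac; rewrite ler_piMr|apply: le_trans be; rewrite ler_piMl].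
Qed.

Section isolation_probability.
Context {R : realType} {dO : measure_display} {Omega : measurableType dO}
  {P : probability Omega R} {d : nat}.
Local Notation T := (d.-tuple R).
Variables (X : nat -> {RV P >-> T}) (f : T -> R) (j : nat) (t : R).
Hypothesis indX : mutually_independent X.
Hypothesis d_gt0 : (0 < d)%N.
Hypothesis t_gt0 : 0 < t.
Hypothesis fF : prob_density f.
Hypothesis fX : forall i, has_density (X i) f.

Let F : probability T R := distribution P (X 0%N).

Let identX i B : measurable B -> P (X i @^-1` B) = P (X 0%N @^-1` B).
Proof. by move=> mB; rewrite !fX. Qed.

Let FE A (mA : measurable A) := distribution_density (fX 0%N) mA.

Let mf : measurable_fun setT f. Proof. by case: fF. Qed.
Let f0 x : 0 <= f x. Proof. by case: fF. Qed.

Local Notation p := (ballmass F t).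
Local Notation G := (fun x => pois_lt j (ball_vol R d * t ^+ d * f x)).

Lemma measurable_nbrs_lt r n i a : measurable [set w | (nbrs r (X ^~ w) n i < a)%N].
Proof.
rewrite (_ : [set _ | _] = [set w | (\sum_(k < n)
    (((k : nat) != i) && (eucl_dist (X i w) (X k w) <= r)%R) < a)%N]); last first.
  by apply/seteqP; split => w /=; rewrite /nbrs count_iota.
apply: (@measurable_count_lt R) => k.
case: (_ != _) => /=; last by rewrite (_ : [set _ | _] = set0)//; apply/seteqP; split.
by apply: measurable_dist_le; exact: measurable_funPT.
Qed.

Lemma measurable_eball_pred x r : measurable [set y : T | eucl_dist x y <= r].
Proof. exact: measurable_eball. Qed.

Lemma pois_lt_mul_le m n x y : (0 < n)%N -> (n <= m + 2)%N -> (m <= n)%N ->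
  `|pois_lt j (m%:R * p n x) * pois_lt j (m%:R * p n y) - G x * G y| <=
  (density_err F f t n x + 2 * p n x) + (density_err F f t n y + 2 * p n y).
Proof.
move=> n0 nm mn.
have hx := pois_lt_ballmass F j t_gt0 fF x n0 nm mn.
have hy := pois_lt_ballmass F j t_gt0 fF y n0 nm mn.
have g0 := pois_lt_ge0 j (pois_arg_ge0 t_gt0 fF x).
have g1 := pois_lt_le1 j (pois_arg_ge0 t_gt0 fF x).
have a0 z : 0 <= m%:R * p n z by rewrite mulr_ge0// ballmass_ge0.
have u0 := pois_lt_ge0 j (a0 y).
have u1 := pois_lt_le1 j (a0 y).
move: hx hy g0 g1 u0 u1.
set a := pois_lt j (_ * p n x); set b := pois_lt j (_ * p n y).
set gx := pois_lt j (_ * f x); set gy := pois_lt j (_ * f y) => hx hy g0 g1 u0 u1.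
exact: norm_mulB_le.
Qed.

Lemma count_lt_single n m x : n = m.+1 -> 0 <= count_lt (p n x) 0 m j 1 ->
  G x <= count_lt (p n x) 0 m j 1 + pois_err F f t n x.
Proof.
move=> nm u0; have p0 := ballmass_ge0 F t n x; have p1 := ballmass_le1 F t n x.
have g1 := pois_lt_le1 j (pois_arg_ge0 t_gt0 fF x).
rewrite /pois_err addrC -lerBlDr le_min; apply/andP; split; first by lra.
have := @pois_lt_approx R (count_lt (p n x) 0) (p n x) 0 p0 (lexx _).
rewrite addr0 => /(_ p1 (fun _ _ => erefl) (fun _ _ _ => erefl) m j 1%N).
rewrite mulr0 pois_lt_at0 mulr1.
have : `|pois_lt j (m%:R * p n x) - G x| <= density_err F f t n x + 2 * p n x.
  by apply: (pois_lt_ballmass F j t_gt0 fF); rewrite nm ?addn2// ltnW// ltnW.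
set u := count_lt _ _ _ _ _; set a := pois_lt j (_ * p n x); set g := G x.
have n0 : 0 < n%:R :> R by rewrite nm ltr0n.
have -> : (2 * (n%:R * p n x) + 4 * (n%:R * p n x) ^+ 2) / n%:R =
    2 * p n x + 4 * n%:R * p n x ^+ 2 by field; rewrite gt_eqF.
have mn : m%:R <= n%:R :> R by rewrite ler_nat nm.
have : m%:R * p n x ^+ 2 <= n%:R * p n x ^+ 2 by rewrite ler_wpM2r// exprn_ge0.
have : 0 <= n%:R * p n x ^+ 2 by rewrite mulr_ge0// exprn_ge0.
by rewrite !ler_norml => h1 h2 /andP[h3 h4] /andP[h5 h6]; rewrite /g in h3 h4 *; lra.
Qed.

Lemma count_lt_pair n m x y : n = m.+2 -> p n x + p n y <= 1 ->
  count_lt (p n x) (p n y) m j j <= 1 ->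
  count_lt (p n x) (p n y) m j j <= G x * G y + pois_err F f t n x + pois_err F f t n y.
Proof.
move=> nm pxy u1.
have px0 := ballmass_ge0 F t n x; have py0 := ballmass_ge0 F t n y.
have g0 z := pois_lt_ge0 j (pois_arg_ge0 t_gt0 fF z).
have e0 z := pois_err_ge0 F f t n z.
have gg : 0 <= G x * G y by rewrite mulr_ge0.
have [h|h] := leP 1 (pois_err F f t n x); first by have := e0 y; lra.
have [h'|h'] := leP 1 (pois_err F f t n y); first by have := e0 x; lra.
have n0 : 0 < n%:R :> R by rewrite nm ltr0n.
have E z : pois_err F f t n z < 1 -> pois_err F f t n z =
    density_err F f t n z + (2 * p n z + 4 * n%:R * p n z ^+ 2).
  rewrite {1}/pois_err gt_min ltxx/= => ?; rewrite /pois_err min_r ?ltW//.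
  by congr (_ + _); field; rewrite gt_eqF.
rewrite (E _ h) (E _ h').
have := @pois_lt_approx R (count_lt (p n x) (p n y)) (p n x) (p n y) px0 py0 pxy
  (fun _ _ => erefl) (fun _ _ _ => erefl) m j j.
have : `|pois_lt j (m%:R * p n x) * pois_lt j (m%:R * p n y) - G x * G y| <=
  (density_err F f t n x + 2 * p n x) + (density_err F f t n y + 2 * p n y).
  by apply: pois_lt_mul_le; rewrite nm ?addn2// ltnW// ltnW.
set u := count_lt _ _ _ _ _; set ab := pois_lt _ _ * pois_lt _ _; set g := G x * G y.
have mn : m%:R <= n%:R :> R by rewrite ler_nat nm ltnW// ltnW.
have sq : (p n x + p n y) ^+ 2 <= 2 * (p n x ^+ 2 + p n y ^+ 2).
  by have := sqr_ge0 (p n x - p n y); rewrite !expr2; lra.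
have : m%:R * (p n x + p n y) ^+ 2 <= n%:R * (2 * (p n x ^+ 2 + p n y ^+ 2)).
  by rewrite ler_pM// exprn_ge0// addr_ge0.
by rewrite !ler_norml => h1 /andP[h3 h4] /andP[h5 h6]; rewrite /g in h3 h4 *; lra.
Qed.

Lemma sample_tupleE m (s : m.-tuple nat) w :
  sample_tuple X s w = map (fun k => X k w) s :> seq T.
Proof. by rewrite /sample_tuple /= -[in RHS](map_tnth_enum s) -map_comp. Qed.

Lemma measurable_prob_section dS (S : measurableType dS) dV (V : measurableType dV)
    (v : Omega -> V) (C : set (S * V)) : measurable_fun setT v -> measurable C ->
  measurable_fun setT (fun x => P [set w | C (x, v w)]).
Proof.
move=> mv mC.
have mg : measurable_fun setT (fun z : S * Omega => (z.1, v z.2)).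
  by apply: measurable_fun_pair => //; exact: (measurableT_comp mv).
have mA : measurable ((fun z : S * Omega => (z.1, v z.2)) @^-1` C).
  by rewrite -[X in measurable X]setTI; exact: mg.
have := measurable_fun_xsection P mA; congr (measurable_fun _ _).
by apply/funext => x /=; rewrite xsectionE.
Qed.

Lemma prob_isolated_ge n i : (i < n)%N ->
  ((pois_avg F f j t)%:E <= P [set w | isolated j (@rad R d t n) (X ^~ w) n i] +
    \int[F]_x (pois_err F f t n x)%:E)%E.
Proof.
move=> ltin; set r := rad t n.
have ii : i \in iota 0 n by rewrite mem_iota.
pose s0 := rem i (iota 0 n).
have szs : size s0 == n.-1 by rewrite size_rem// size_iota.
pose s := Tuple szs.
have us : uniq (i :: s) by rewrite /= rem_uniq ?iota_uniq// mem_rem_uniq ?iota_uniq// !inE eqxx.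
pose C := [set z : T * (n.-1).-tuple T | (count (fun y => eucl_dist z.1 y <= r)%R z.2 < j)%N].
have mC : measurable C by exact: measurable_ball_count.
have -> : [set w | isolated j r (X ^~ w) n i] = [set w | C (X i w, sample_tuple X s w)].
  apply/seteqP; suff E w : isolated j r (X^~ w) n i =
      (count (fun y => eucl_dist (X i w) y <= r)%R (sample_tuple X s w) < j)%N.
    by split => w; rewrite /C/= E.
  rewrite /isolated /nbrs; congr (_ < _)%N.
  rewrite sample_tupleE count_map (permP (perm_to_rem ii))/= eqxx/= add0n.
  apply: eq_in_count => k; rewrite mem_rem_uniq ?iota_uniq// !inE => /andP[-> _].
  by [].
rewrite (law_cons indX identX us mC) -(pois_avgE F j t_gt0 fF).
have us' : uniq s by case/andP: us.
have PE x : P [set w | C (x, sample_tuple X s w)] = (count_lt (p n x) 0 n.-1 j 1)%:E.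
  have := @prob_counts_in _ _ _ P d X indX identX n.-1 s (fun y => eucl_dist x y <= r) pred0 j 1.
  move=> /(_ us' (measurable_eball_pred x r)).
  have -> : [set y : T | pred0 y] = set0 by apply/seteqP; split.
  move=> /(_ measurable0 (fun _ _ => isT)); rewrite measure0/= => <-.
  congr (P _); apply/seteqP; split => w; rewrite /counts_in/C/= ?count_pred0 ?andbT//.
rewrite -ge0_integralD//; last first.
- by apply/measurable_EFinP; exact: measurable_pois_err.
- by move=> x _; rewrite lee_fin pois_err_ge0.
- exact: (measurable_prob_section (measurable_sample_tuple X s) mC).
apply: ge0_le_integralT => x; first by rewrite lee_fin pois_lt_ge0// pois_arg_ge0.
rewrite PE -EFinD lee_fin; apply: count_lt_single; first by rewrite prednK// (leq_ltn_trans _ ltin).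
by rewrite -lee_fin -PE.
Qed.

Lemma near_vanishes : vanishes (fun n =>
  \int[F]_x (pois_err F f (2 * Num.sqrt d%:R * t) n x)%:E)%E.
Proof. by apply: pois_err_vanishes => //; rewrite !mulr_gt0// sqrtr_gt0 ltr0n. Qed.

Lemma prob_near n i k : i != k -> (0 < n)%N ->
  (P [set w | (eucl_dist (X i w) (X k w) <= 2 * Num.sqrt d%:R * @rad R d t n)%R] <=
   \int[F]_x (pois_err F f (2 * Num.sqrt d%:R * t) n x)%:E)%E.
Proof.
move=> ik n0; set t' := 2 * Num.sqrt d%:R * t; set r' := (_ * rad t n).
have r'E : r' = @rad R d t' n by rewrite /r' /rad /t' mulrA.
pose C := [set z : T * 1.-tuple T | (eucl_dist z.1 (tnth z.2 ord0) <= r')].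
have mC : measurable C.
  by apply: measurable_dist_le => //; exact: (measurableT_comp (measurable_tnth ord0)).
have uik : uniq [:: i; k] by rewrite /= inE ik.
have E w : C (X i w, sample_tuple X [tuple k] w) = (eucl_dist (X i w) (X k w) <= r')%R :> Prop.
  by rewrite /C/= /sample_tuple tnth_mktuple.
rewrite (_ : [set _ | _] = [set w | C (X i w, sample_tuple X [tuple k] w)]); last first.
  by apply/seteqP; split => w /=; rewrite E.
rewrite (law_cons indX identX uik mC).
apply: ge0_le_integralT => // x.
have -> : P [set w | C (x, sample_tuple X [tuple k] w)] = F (eball x (@rad R d t' n)).
  transitivity (P (X k @^-1` eball x (@rad R d t' n))).
    2: by rewrite identX//; exact: measurable_eball.
  by congr (P _); apply/seteqP; split => w /=;
    rewrite /C/eball/preimage/= /sample_tuple tnth_mktuple r'E.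
rewrite -[leLHS]fineK; last by apply: fin_num_measure; exact: measurable_eball.
rewrite -/(ballmass F t' n x) lee_fin le_min ballmass_le1/=.
have p0 := ballmass_ge0 F t' n x.
have n0' : 0 < n%:R :> R by rewrite ltr0n.
rewrite -[leLHS]add0r; apply: lerD; first by rewrite /density_err.
rewrite ler_pdivlMr// mulrC.
have : 0 <= (n%:R * ballmass F t' n x) ^+ 2 by rewrite sqr_ge0.
have : 0 <= n%:R * ballmass F t' n x by rewrite mulr_ge0.
lra.
Qed.

Lemma prob_isolated_pair n i k : (i < n)%N -> (k < n)%N -> i != k ->
  (P [set w | isolated j (@rad R d t n) (X ^~ w) n i && isolated j (@rad R d t n) (X ^~ w) n k] <=
   (pois_avg F f j t ^+ 2)%:E + 2%:E * \int[F]_x (pois_err F f t n x)%:E +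
   \int[F]_x (pois_err F f (2 * Num.sqrt d%:R * t) n x)%:E)%E.
Proof.
move=> ltin ltkn ik; set r := rad t n.
have r0 : 0 < r by exact: rad_gt0.
pose far (x y : T) := 2 * Num.sqrt d%:R * r < eucl_dist x y.
have ii : i \in iota 0 n by rewrite mem_iota.
have kk : k \in rem i (iota 0 n).
  by rewrite mem_rem_uniq ?iota_uniq// !inE eq_sym ik mem_iota.
have ui : uniq (rem i (iota 0 n)) by rewrite rem_uniq// iota_uniq.
pose s0 := rem k (rem i (iota 0 n)).
have s0P l : l \in s0 -> (l != k) && (l != i).
  rewrite mem_rem_uniq// inE => /andP[-> /=].
  by rewrite mem_rem_uniq ?iota_uniq// inE => /andP[].
have szs : size s0 == n.-2 by rewrite !size_rem// size_iota.
pose s := Tuple szs.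
have us' : uniq s by exact: rem_uniq.
have us : uniq [:: i, k & s].
  rewrite /= us' inE negb_or ik/= andbT; apply/andP.
  by split; apply/negP; rewrite !mem_rem_uniq ?iota_uniq// !inE ?mem_rem_uniq ?iota_uniq// ?inE eqxx ?andbF.
have sle (a b : pred nat) : {in s0, a =1 b} -> (count a s0 <= count b (iota 0 n))%N.
  move=> ab; rewrite (permP (perm_to_rem ii))/= (permP (perm_to_rem kk))/=.
  by rewrite (eq_in_count ab) addnA leq_addl.
pose B (z : T * (T * (n.-2).-tuple T)) :=
  [&& far z.1 z.2.1, (count (fun y => eucl_dist z.1 y <= r)%R z.2.2 < j)%N &
   (count (fun y => eucl_dist z.2.1 y <= r)%R z.2.2 < j)%N].
pose C := [set z | B z].
have mC : measurable C.
  rewrite (_ : C = ~` [set z : T * (T * (n.-2).-tuple T) | eucl_dist z.1 z.2.1 <= 2 * Num.sqrt d%:R * r] `&`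
    ([set z : T * (T * (n.-2).-tuple T) | (count (fun y => eucl_dist z.1 y <= r)%R z.2.2 < j)%N] `&`
     [set z : T * (T * (n.-2).-tuple T) | (count (fun y => eucl_dist z.2.1 y <= r)%R z.2.2 < j)%N])).
    have m21 : measurable_fun setT (fun z : T * (T * (n.-2).-tuple T) => z.2.1).
      exact: (measurableT_comp measurable_fst measurable_snd).
    have m22 : measurable_fun setT (fun z : T * (T * (n.-2).-tuple T) => z.2.2).
      exact: (measurableT_comp measurable_snd measurable_snd).
    apply: measurableI; first by apply: measurableC; exact: measurable_dist_le.
    by apply: measurableI; exact: measurable_ball_count.
  apply/seteqP; split => z; rewrite /C/= /B /far ltNge.
    by move=> /and3P[/negP h1 h2 h3].
  by move=> [/negP h1 [h2 h3]]; apply/and3P.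
pose near := [set w | eucl_dist (X i w) (X k w) <= 2 * Num.sqrt d%:R * r].
have mnear : measurable near by apply: measurable_dist_le; exact: measurable_funPT.
pose E := [set w | C (X i w, (X k w, sample_tuple X s w))].
have mE : measurable E.
  rewrite -[E]setTI.
  suff : measurable_fun setT (fun w => (X i w, (X k w, sample_tuple X s w))) by exact.
  apply: measurable_fun_pair; first exact: measurable_funPT.
  by apply: measurable_fun_pair; [exact: measurable_funPT|exact: measurable_sample_tuple].
apply: (@le_trans _ _ (P (E `|` near))).
  apply: le_measure; rewrite ?inE//; [|exact: measurableU|].
    rewrite (_ : [set _ | _] = [set w | isolated j r (X ^~ w) n i] `&` [set w | isolated j r (X ^~ w) n k]).
      by apply: measurableI; exact: measurable_nbrs_lt.
    by apply/seteqP; split => w /=; [move=> /andP[]|move=> [-> ->]].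
  move=> w /= /andP[wi wk].
  have [h|h] := leP (eucl_dist (X i w) (X k w)) (2 * Num.sqrt d%:R * r); [by right|left].
  rewrite /E/C/=/B/=; apply/and3P; split => //; rewrite sample_tupleE count_map/=.
    apply: leq_ltn_trans wi; apply: sle => l.
    by move=> /s0P/andP[_ ->].
  apply: leq_ltn_trans wk; apply: sle => l.
  by move=> /s0P/andP[-> _].
apply: le_trans (measureU2 _ _ _) _ => //.
apply: leeD; last by apply: prob_near => //; exact: leq_ltn_trans ltin.
rewrite -[leLHS]/(P E) (law_cons2 indX identX us mC).
have mPE := measurable_pois_err F t fF n.
have Ge0 := fun x => pois_lt_ge0 j (pois_arg_ge0 t_gt0 fF x).
have e0 := pois_err_ge0 F f t n.
have mG := measurable_pois_avg j t fF.
have avg0 : 0 <= pois_avg F f j t.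
  by rewrite -lee_fin -(pois_avgE F j t_gt0 fF); apply: integral_ge0 => x _; rewrite lee_fin.
have [e fe0 eE] := pois_err_integral F f t n.
set c := pois_avg F f j t in avg0 *.
have I (a b : R) : 0 <= a -> 0 <= b ->
    (\int[F]_y (a * G y + b + pois_err F f t n y)%:E = (a * c + b + e)%:E)%E.
  move=> a0 b0; have m1 : measurable_fun setT (fun y => a * G y) by exact: measurable_funM.
  have aG0 y : 0 <= a * G y by exact: mulr_ge0.
  under eq_integral do rewrite !EFinD.
  rewrite !ge0_integralD//; try by [move=> y _; rewrite lee_fin|exact/measurable_EFinP].
  - under eq_integral do rewrite EFinM.
    rewrite ge0_integralZl//; last 2 first.
    - exact/measurable_EFinP.
    - by move=> y _; rewrite lee_fin.
    by rewrite pois_avgE// integral_cst_probability eE -EFinM.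
  - by move=> y _; rewrite -EFinD lee_fin addr_ge0.
  - by apply: emeasurable_funD => //; exact/measurable_EFinP.
apply: (@le_trans _ _ (\int[F]_x \int[F]_y (G x * G y + pois_err F f t n x + pois_err F f t n y)%:E)%E).
  apply: ge0_le_integralT => x; first exact: integral_ge0.
  apply: ge0_le_integralT => // y.
  have [h|h] := leP (eucl_dist x y) (2 * Num.sqrt d%:R * r).
    rewrite (_ : [set _ | _] = set0); last first.
      by apply/seteqP; split => // w; rewrite /C/=/B/far/= ltNge h.
    by rewrite measure0 lee_fin !addr_ge0// mulr_ge0.
  have dj z : eucl_dist x z <= r -> ~~ (eucl_dist y z <= r).
    by apply: far_balls_disjoint => //; exact: ltW.
  have := @prob_counts_in _ _ _ P d X indX identX n.-2 s (fun z => eucl_dist x z <= r)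
    (fun z => eucl_dist y z <= r) j j us' (measurable_eball_pred x r) (measurable_eball_pred y r) dj.
  rewrite -/(ballmass F t n x) -/(ballmass F t n y) => PE.
  have CE : [set w | C (x, (y, sample_tuple X s w))] =
      counts_in X s (fun z => eucl_dist x z <= r) (fun z => eucl_dist y z <= r) j j.
    by apply/seteqP; split => w; rewrite /C/counts_in/=/B/far/= h.
  rewrite CE PE lee_fin; apply: count_lt_pair.
  - by rewrite !prednK//; move: ltin ltkn ik; clear; lia.
  - rewrite -lee_fin EFinD !fineK ?fin_num_measure//; try exact: measurable_eball_pred.
    rewrite -measureU//; try exact: measurable_eball_pred.
      by apply: probability_le1; apply: measurableU; exact: measurable_eball_pred.
    by apply/seteqP; split => // z /= [/dj/negP].
  rewrite -lee_fin -PE -CE; apply: probability_le1.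
  have := measurable_xsection x mC; rewrite xsectionE => m1.
  have := measurable_xsection y m1; rewrite xsectionE => m2.
  have := measurable_sample_tuple X s measurableT m2; by rewrite setTI.
under eq_integral do rewrite I//.
under eq_integral => x _ do rewrite mulrC addrAC.
rewrite I// eE -EFinM -EFinD lee_fin expr2; lra.
Qed.

End isolation_probability.

Section second_moment.
Context {R : realType} {dO : measure_display} {Omega : measurableType dO}
  (P : probability Omega R).

Lemma indicator_mean_sq n (A : 'I_n -> set Omega) (c eta delta : R) : (0 < n)%N ->
  (forall i, measurable (A i)) -> 0 <= c -> 0 <= eta ->
  (forall i, (c%:E <= P (A i) + delta%:E)%E) ->
  (forall i k, i != k -> (P (A i `&` A k) <= (c ^+ 2 + eta)%:E)%E) ->
  (\int[P]_w ((\sum_(i < n) n%:R^-1 * \1_(A i) w - c) ^+ 2)%:E <=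
   (n%:R^-1 + eta + 2 * c * delta)%:E)%E.
Proof.
move=> n0 mA c0 eta0 Alo Ahi.
have n0' : 0 < n%:R :> R by rewrite ltr0n.
have m1 i : measurable_fun setT (fun w => n%:R^-1 * \1_(A i) w : R).
  by apply: measurable_funM => //; exact: measurable_indic.
pose Z w : R := \sum_(i < n) n%:R^-1 * \1_(A i) w.
have mZ : measurable_fun setT Z by exact: measurable_sum.
have Z0 w : 0 <= Z w by apply: sumr_ge0 => i _; rewrite mulr_ge0// invr_ge0.
have PA i : P (A i) = (fine (P (A i)))%:E by rewrite fineK// fin_num_measure.
have EZ : (c%:E <= \int[P]_w (Z w)%:E + delta%:E)%E.
  under eq_integral do rewrite -sumEFin.
  rewrite ge0_integral_sum//; last by move=> i; exact/measurable_EFinP.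
  rewrite (eq_bigr (fun i => (n%:R^-1 * fine (P (A i)))%:E)) => [|i _]; last first.
    under eq_integral do rewrite EFinM.
    rewrite ge0_integralZl//; last by apply/measurable_EFinP; exact: measurable_indic.
    by rewrite integral_indic// setIT EFinM -PA.
  rewrite sumEFin -EFinD lee_fin -mulr_sumr.
  have : \sum_(i < n) c <= \sum_(i < n) (fine (P (A i)) + delta).
    by apply: ler_sum => i _; have := Alo i; rewrite PA lee_fin.
  have sc (a : R) : \sum_(i < n) a = n%:R * a by rewrite sumr_const card_ord mulr_natl.
  rewrite big_split/= !sc => h.
  rewrite -(ler_pM2l n0') mulrDr mulrA mulfV ?mul1r//; by rewrite gt_eqF.
have EZ2 : (\int[P]_w (Z w ^+ 2)%:E <= (n%:R^-1 + c ^+ 2 + eta)%:E)%E.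
  have -> : (\int[P]_w (Z w ^+ 2)%:E = \int[P]_w \sum_(i < n) \sum_(k < n)
      (n%:R^-1 ^+ 2 * \1_(A i `&` A k) w)%:E)%E.
    apply: eq_integral => w _; under eq_bigr do rewrite sumEFin.
    rewrite sumEFin; congr EFin; rewrite expr2 {1}/Z mulr_suml; apply: eq_bigr => i _.
    rewrite mulr_sumr; apply: eq_bigr => k _; rewrite indicI /=; ring.
  have m2 i k : measurable_fun setT (fun w => (n%:R^-1 ^+ 2 * \1_(A i `&` A k) w)%:E : \bar R).
    apply/measurable_EFinP; apply: measurable_funM => //.
    by apply: measurable_indic; exact: measurableI.
  rewrite ge0_integral_sum//; last first.
  - by move=> i w _; apply: sume_ge0 => k _; rewrite lee_fin mulr_ge0// exprn_ge0// invr_ge0.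
  - by move=> i; exact: emeasurable_sum.
  apply: (@le_trans _ _ (\sum_(i < n) \sum_(k < n)
      (n%:R^-1 ^+ 2 * (c ^+ 2 + eta + (i == k)%:R))%:E)%E).
    apply: lee_sum => i _; rewrite ge0_integral_sum//.
    apply: lee_sum => k _; under eq_integral do rewrite EFinM.
    rewrite ge0_integralZl//; last first.
      by apply/measurable_EFinP; apply: measurable_indic; exact: measurableI.
    rewrite integral_indic ?setIT//; last exact: measurableI.
    rewrite [leRHS]EFinM; apply: lee_wpmul2l; first by rewrite lee_fin exprn_ge0// invr_ge0.
    case: eqVneq => [->|ik]; last by rewrite addr0; exact: Ahi.
    rewrite setIid (le_trans (probability_le1 _ _))// lee_fin lerDr addr_ge0//.
    exact: sqr_ge0.
  under eq_bigr do rewrite sumEFin.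
  rewrite sumEFin lee_fin le_eqVlt; apply/orP; left; apply/eqP.
  have sc (a : R) : \sum_(i < n) a = n%:R * a by rewrite sumr_const card_ord mulr_natl.
  have s1 (i : 'I_n) : \sum_(k < n) (i == k)%:R = 1 :> R.
    rewrite (bigD1 i)//= eqxx big1 ?addr0// => k.
    by rewrite eq_sym => /negbTE ->.
  under eq_bigr do rewrite -mulr_sumr big_split/= sc s1.
  rewrite sc; field; by rewrite gt_eqF.
have mZc : measurable_fun setT (fun w => (Z w - c) ^+ 2).
  apply: (measurableT_comp (exprn_measurable 2)); exact: measurable_funB.
have key : (\int[P]_w ((Z w - c) ^+ 2)%:E + (2 * c)%:E * \int[P]_w (Z w)%:E =
    \int[P]_w (Z w ^+ 2)%:E + (c ^+ 2)%:E)%E.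
  rewrite -ge0_integralZl//; last 3 first.
  - exact/measurable_EFinP.
  - by move=> w _; rewrite lee_fin.
  - by rewrite lee_fin mulr_ge0.
  rewrite -(integral_cst_probability P (c ^+ 2)) -!ge0_integralD//.
  - by apply: eq_integral => w _; rewrite -EFinM -!EFinD; congr EFin; ring.
  - by move=> w _; rewrite lee_fin sqr_ge0.
  - by apply/measurable_EFinP; exact: (measurableT_comp (exprn_measurable 2)).
  - by move=> w _; rewrite lee_fin sqr_ge0.
  - by move=> w _; rewrite lee_fin sqr_ge0.
  - exact/measurable_EFinP.
  - by move=> w _; rewrite -EFinM lee_fin !mulr_ge0.
  - by apply: emeasurable_funM => //; exact/measurable_EFinP.
have a0 : (0 <= \int[P]_w ((Z w - c) ^+ 2)%:E)%E.
  by apply: integral_ge0 => w _; rewrite lee_fin sqr_ge0.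
have z0 : (0 <= \int[P]_w (Z w)%:E)%E by apply: integral_ge0 => w _; rewrite lee_fin.
have zfin : (\int[P]_w (Z w)%:E < +oo)%E.
  apply: (@le_lt_trans _ _ (\int[P]_w 1%:E)%E); last by rewrite integral_cst_probability ltry.
  apply: ge0_le_integralT => w; rewrite lee_fin//.
  apply: (@le_trans _ _ (\sum_(i < n) n%:R^-1)).
    by apply: ler_sum => i _; rewrite ler_piMr ?invr_ge0// indicE lern1 leq_b1.
  by rewrite sumr_const card_ord -[_ *+ n]mulr_natl mulfV// gt_eqF.
have -> : (\int[P]_w ((\sum_(i < n) n%:R^-1 * \1_(A i) w - c) ^+ 2)%:E =
  \int[P]_w ((Z w - c) ^+ 2)%:E)%E by [].
move: (\int[P]_w ((Z w - c) ^+ 2)%:E)%E (\int[P]_w (Z w)%:E)%E (\int[P]_w (Z w ^+ 2)%:E)%E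
  a0 z0 zfin EZ EZ2 key => [a||] [z||] [b||] // a0 z0 _; rewrite -?EFinM -?EFinD ?lee_fin => h1 h2 [h3].
nra.
Qed.

End second_moment.

Section isolated_fraction.
Context {R : realType} {dO : measure_display} {Omega : measurableType dO}
  {P : probability Omega R} {d : nat}.
Local Notation T := (d.-tuple R).
Variables (X : nat -> {RV P >-> T}) (f : T -> R) (j : nat).
Hypothesis indX : mutually_independent X.
Hypothesis d_gt0 : (0 < d)%N.
Hypothesis fF : prob_density f.
Hypothesis fX : forall i, has_density (X i) f.

Let F : probability T R := distribution P (X 0%N).

Definition isol_frac r n w : R :=
  \sum_(i < n) n%:R^-1 * (isolated j r (X ^~ w) n i)%:R.

Lemma measurable_isolated r n i : measurable [set w | isolated j r (X ^~ w) n i].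
Proof. exact: measurable_nbrs_lt. Qed.

Lemma isol_fracE r n w : isol_frac r n w =
  \sum_(i < n) n%:R^-1 * \1_[set w | isolated j r (X ^~ w) n i] w.
Proof. by apply: eq_bigr => i _; rewrite indic_bool. Qed.

Lemma measurable_isol_frac r n : measurable_fun setT (isol_frac r n).
Proof.
rewrite (_ : isol_frac r n = fun w => \sum_(i < n) n%:R^-1 * \1_[set w | isolated j r (X ^~ w) n i] w).
  apply: measurable_sum => i; apply: measurable_funM => //; apply: measurable_indic.
  exact: measurable_isolated.
by apply/funext => w; exact: isol_fracE.
Qed.

Lemma isol_frac_cvg t : 0 < t ->
  vanishes (fun n => \int[P]_w (`|isol_frac (@rad R d t n) n w - pois_avg F f j t|)%:E)%E.
Proof.
move=> t0 e e0.
set c := pois_avg F f j t.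
pose pe t n := (\int[F]_x (pois_err F f t n x)%:E)%E.
have pe0 s n : 0 < s -> (0 <= pe s n)%E.
  by move=> s0; apply: integral_ge0 => x _; rewrite lee_fin pois_err_ge0.
have FE A (mA : measurable A) := distribution_density (fX 0%N) mA.
pose t' := 2 * Num.sqrt d%:R * t.
have t'0 : 0 < t' by rewrite !mulr_gt0// sqrtr_gt0 ltr0n.
have c0 : 0 <= c.
  by rewrite -lee_fin -(pois_avgE F j t0 fF); apply: integral_ge0 => x _; rewrite lee_fin pois_lt_ge0// pois_arg_ge0.
have e2 : 0 < e / 2 by rewrite divr_gt0.
have H : vanishes (fun n => (e / 2)^-1%:E *
    ((1 / n%:R)%:E + (2 + 2 * c)%:E * pe t n + pe t' n))%E.
  apply: vanishesZ; first by rewrite invr_ge0 ltW.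
    move=> n; apply: adde_ge0; last exact: pe0.
    apply: adde_ge0; first by rewrite lee_fin divr_ge0.
    by apply: mule_ge0; [rewrite lee_fin addr_ge0// mulr_ge0|exact: pe0].
  apply: vanishesD; last exact: (pois_err_vanishes d_gt0 t'0 fF FE).
  apply: vanishesD; first exact: vanishes_div_nat.
  apply: vanishesZ; [by rewrite addr_ge0// mulr_ge0|by move=> n; exact: pe0|].
  exact: (pois_err_vanishes d_gt0 t0 fF FE).
near=> n.
have n0 : (0 < n)%N by near: n; exact: nbhs_infty_gt.
have [a a0 aE] := pois_err_integral F f t n; have [b b0 bE] := pois_err_integral F f t' n.
have step : (\int[P]_w ((isol_frac (@rad R d t n) n w - c) ^+ 2)%:E <=
    (1 / n%:R)%:E + (2 + 2 * c)%:E * pe t n + pe t' n)%E.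
  under eq_integral do rewrite isol_fracE.
  apply: le_trans (@indicator_mean_sq R _ _ P n _ c (2 * a + b) a n0 _ c0 _ _ _) _.
  - by move=> i; exact: measurable_isolated.
  - by rewrite addr_ge0// mulr_ge0.
  - by move=> i; rewrite -aE; exact: prob_isolated_ge.
  - move=> i k ik.
    have : (P [set w | isolated j (@rad R d t n) (X ^~ w) n i && isolated j (@rad R d t n) (X ^~ w) n k] <=
      (c ^+ 2)%:E + 2%:E * pe t n + pe t' n)%E.
      exact: (prob_isolated_pair j indX t0 fF fX (ltn_ord i) (ltn_ord k) ik).
    rewrite /pe aE bE -EFinM -!EFinD addrA; apply: le_trans.
    rewrite le_eqVlt; apply/orP; left; apply/eqP; congr (P _).
    by apply/seteqP; split => w /=; [move=> [-> ->]|move=> /andP[]].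
  by rewrite /pe aE bE -EFinM -!EFinD lee_fin div1r; lra.
apply: (@le_trans _ _ ((e / 2)%:E + (e / 2)^-1%:E * \int[P]_w ((isol_frac (@rad R d t n) n w - c) ^+ 2)%:E)%E).
  rewrite -(integral_cst_probability P (e / 2)) -ge0_integralZl//; last 3 first.
  - apply/measurable_EFinP; apply: (measurableT_comp (exprn_measurable 2)).
    by apply: measurable_funB => //; exact: measurable_isol_frac.
  - by move=> w _; rewrite lee_fin sqr_ge0.
  - by rewrite lee_fin invr_ge0 ltW.
  rewrite -ge0_integralD//; last 3 first.
  - by move=> w _; rewrite lee_fin ltW.
  - by move=> w _; rewrite -EFinM lee_fin mulr_ge0 ?sqr_ge0// invr_ge0 ltW.
  - apply: emeasurable_funM => //; apply/measurable_EFinP; apply: (measurableT_comp (exprn_measurable 2)).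
    by apply: measurable_funB => //; exact: measurable_isol_frac.
  apply: ge0_le_integralT => w; first by rewrite lee_fin.
  rewrite -EFinM -EFinD lee_fin; set u := isol_frac _ _ _ - _.
  rewrite -(ler_pM2l e2) mulrDr mulrA mulfV ?gt_eqF// mul1r -real_normK ?num_real//.
  have := sqr_ge0 (`|u| - e / 2); have : 0 <= `|u| by []. nra.
rewrite [e in leRHS]splitr EFinD; apply: leeD => //.
apply: (@le_trans _ _ ((e / 2)^-1%:E *
    ((1 / n%:R)%:E + (2 + 2 * c)%:E * pe t n + pe t' n))%E); last by near: n; exact: H.
by apply: lee_wpmul2l => //; rewrite lee_fin invr_ge0 ltW.
Unshelve. all: by end_near. Qed.

End isolated_fraction.

(** * Isolated points: tail bound *)

Section isolated_points.
Context {R : realType} {d : nat}.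
Local Notation T := (d.-tuple R).
Variables (x : nat -> T) (n j : nat) (r : R).
Local Notation iso := (isolated j r x n).

Lemma isolated_cell (p : pred T) :
  (forall y z, p y -> p z -> eucl_dist y z <= r) ->
  (count (fun i => iso i && p (x i)) (iota 0 n) <= j)%N.
Proof.
move=> pr; have [/hasP[i]|/hasPn h] := boolP (has (fun i => iso i && p (x i)) (iota 0 n)); last first.
  by rewrite (eq_in_count (a2 := pred0)) ?count_pred0// => i /h /negbTE.
move=> ii /andP[isoi pi].
apply: (@leq_trans (count (fun k => p (x k)) (iota 0 n))).
  by apply: sub_count => k /andP[].
rewrite (permP (perm_to_rem ii))/= pi add1n.
apply: leq_ltn_trans isoi; rewrite /nbrs (permP (perm_to_rem ii))/= eqxx/=.
rewrite -!size_filter; apply: uniq_leq_size; first by rewrite filter_uniq// rem_uniq// iota_uniq.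
move=> k; rewrite !mem_filter => /andP[pk ki]; rewrite ki andbT pr// andbT.
by move: ki; rewrite mem_rem_uniq ?iota_uniq// inE => /andP[].
Qed.

Lemma isolated_cover (K : finType) (p : pred T) (cell : T -> K) :
  (forall y z, p y -> p z -> cell y = cell z -> eucl_dist y z <= r) ->
  (count (fun i => iso i && p (x i)) (iota 0 n) <= #|K| * j)%N.
Proof.
move=> pr.
rewrite -sum_nat_const; apply: leq_trans (_ : _ <= \sum_(c : K)
    count (fun i => iso i && (p (x i) && (cell (x i) == c))) (iota 0 n))%N _; last first.
  apply: leq_sum => c _; apply: (@isolated_cell (fun y => p y && (cell y == c))) => y z.
  by move=> /andP[py /eqP cy] /andP[pz /eqP cz]; apply: pr => //; rewrite cy cz.
under eq_bigr do rewrite count_iota.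
rewrite count_iota exchange_big/=; apply: leq_sum => k _.
rewrite (bigD1 (cell (x k)))//= eqxx andbT; exact: leq_addr.
Qed.

Lemma eucl_norm_ge0 (y : T) : 0 <= eucl_norm y.
Proof. exact: sqrtr_ge0. Qed.

Lemma eucl_dist_ball_le (L : R) (y z : T) : eucl_norm y < L -> eucl_norm z < L ->
  eucl_dist y z <= Num.sqrt d%:R * (2 * L).
Proof.
move=> yL zL; apply: eucl_dist_le => [|i].
  by rewrite mulr_ge0// ltW// (le_lt_trans (eucl_norm_ge0 y)).
have := le_lt_trans (eucl_norm_coord y i) yL; have := le_lt_trans (eucl_norm_coord z i) zL.
by have := ler_normB (tnth y i) (tnth z i); lra.
Qed.

Lemma isolated_in_ball (L : R) (m : nat) : 0 < L -> (0 < m)%N ->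
  Num.sqrt d%:R * (2 * L / m%:R) <= r ->
  (count (fun i => iso i && (eucl_norm (x i) < L)%R) (iota 0 n) <= m ^ d * j)%N.
Proof.
move=> L0 m0 Lr; case: m m0 Lr => // m _ Lr.
pose u (y : T) (i : 'I_d) : nat := Num.truncn ((tnth y i + L) / (2 * L / m.+1%:R)).
pose cell (y : T) : {ffun 'I_d -> 'I_m.+1} := [ffun i => inord (u y i)].
have e0 : 0 < 2 * L / m.+1%:R by rewrite !(divr_gt0, mulr_gt0).
have -> : (m.+1 ^ d = #|{ffun 'I_d -> 'I_m.+1}|)%N by rewrite card_ffun !card_ord.
apply: (@isolated_cover _ (fun y => eucl_norm y < L) cell) => y z yL zL yz.
apply: le_trans Lr; apply: eucl_dist_le => [|i]; first exact: ltW.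
have co (v : T) : eucl_norm v < L -> - L < tnth v i < L.
  by move=> vL; rewrite -ltr_norml (le_lt_trans _ vL)//; exact: eucl_norm_coord.
have uP v : eucl_norm v < L -> (u v i)%:R <= (tnth v i + L) / (2 * L / m.+1%:R) < (u v i).+1%:R.
  move=> vL; apply: truncn_itv; rewrite divr_ge0 ?ltW//.
  by have /andP[] := co _ vL; lra.
have um v : eucl_norm v < L -> (u v i < m.+1)%N.
  move=> vL; have /andP[h _] := uP _ vL; rewrite -(ltr_nat R).
  apply: le_lt_trans h _; rewrite ltr_pdivrMr// mulrCA mulfV ?mulr1//.
  by have /andP[] := co _ vL; lra.
have : u y i = u z i.
  have := congr1 (fun f : {ffun 'I_d -> 'I_m.+1} => val (f i)) yz.
  by rewrite /= !ffunE !inordK// um.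
move: e0 (uP _ yL) (uP _ zL) => + + + E; rewrite E; move: (2 * L / _) => e e0.
rewrite !ler_pdivlMr// !ltr_pdivrMr// -natr1 mulrDl mul1r.
move=> /andP[h1 h2] /andP[h3 h4]; rewrite ler_norml; apply/andP; split; lra.
Qed.

Lemma isolated_count_le (L : R) : (j < n)%N -> 0 < r -> 0 < L ->
  (count iso (iota 0 n))%:R <= j%:R * (4 * Num.sqrt d%:R * L / r) ^+ d +
     j.+1%:R * (count (fun i => L <= eucl_norm (x i)) (iota 0 n))%:R :> R.
Proof.
move=> jn r0 L0; set nout := count (fun i => L <= eucl_norm (x i)) _.
have split_count m : (count (fun i => iso i && (eucl_norm (x i) < L)%R) (iota 0 n) <= m)%N ->
    (count iso (iota 0 n) <= m + nout)%N.
  move=> h; apply: leq_trans (leq_add h (leqnn nout)).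
  rewrite /nout !count_iota -big_split/=; apply: leq_sum => k _.
  by rewrite ltNge; case: (iso k); case: (L <= _).
set v := 2 * Num.sqrt d%:R * L / r.
have v0 : 0 <= v by rewrite /v divr_ge0 ?(ltW r0)// !mulr_ge0// ltW.
have -> : 4 * Num.sqrt d%:R * L / r = 2 * v by rewrite /v; ring.
have [v1|v1] := leP v 1.
  have h : (count iso (iota 0 n) <= j.+1 * nout)%N.
    have Lr : Num.sqrt d%:R * (2 * L / 1%:R) <= r.
      move: v1; rewrite /v ler_pdivrMr// mul1r divr1; apply: le_trans.
      by rewrite le_eqVlt; apply/orP; left; apply/eqP; ring.
    have [nout0|nout0] := posnP nout; last 1 first.
      have := split_count _ (isolated_in_ball L0 (ltn0Sn 0) Lr).
      rewrite exp1n mul1n => /leq_trans; apply.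
      by rewrite mulSn addnC leq_add2l leq_pmulr.
    rewrite nout0 muln0 leqn0; apply/eqP.
    have ain i : i \in iota 0 n -> eucl_norm (x i) < L.
      move=> ii; rewrite ltNge; apply/negP => h.
      by move: nout0; apply/eqP; rewrite -lt0n /nout -has_count; apply/hasP; exists i.
    rewrite (eq_in_count (a2 := pred0)) ?count_pred0// => i ii /=.
    apply/negbTE; rewrite /isolated -leqNgt /nbrs (permP (perm_to_rem ii))/= eqxx/=.
    rewrite (eq_in_count (a2 := predT)) ?count_predT ?size_rem// ?size_iota.
      by move: jn; case: n.
    move=> k /=; rewrite mem_rem_uniq ?iota_uniq// inE => /andP[-> /ain kL] /=.
    by apply: le_trans (eucl_dist_ball_le (ain _ ii) kL) _; rewrite -[2 * L]divr1.
  rewrite -(ler_nat R) natrM in h; apply: le_trans h _; rewrite lerDr.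
  by rewrite mulr_ge0// exprn_ge0// mulr_ge0.
pose m := (Num.truncn v).+1.
have vm : v < m%:R by exact: truncnS_gt.
have mv : m%:R <= 2 * v.
  by have /andP[h _] := truncn_itv v0; rewrite /m -natr1; lra.
have h : (count iso (iota 0 n) <= m ^ d * j + nout)%N.
  apply: split_count; apply: isolated_in_ball => //.
  rewrite mulrA ler_pdivrMr ?ltr0n//.
  move: vm; rewrite /v ltr_pdivrMr// => /ltW; rewrite [m%:R * r]mulrC; apply: le_trans.
  by rewrite le_eqVlt; apply/orP; left; apply/eqP; ring.
rewrite -(ler_nat R) natrD natrM natrX in h; apply: le_trans h _; apply: lerD.
  by rewrite mulrC ler_wpM2l// lerXn2r ?nnegrE// mulr_ge0.
by rewrite -natrM ler_nat leq_pmull.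
Qed.

End isolated_points.

Section isolated_tail.
Context {R : realType} {dO : measure_display} {Omega : measurableType dO}
  {P : probability Omega R} {d : nat}.
Local Notation T := (d.-tuple R).
Variables (X : nat -> {RV P >-> T}) (f : T -> R) (j : nat) (rho : R).
Hypothesis d_gt0 : (0 < d)%N.
Hypothesis fF : prob_density f.
Hypothesis fX : forall i, has_density (X i) f.
Hypothesis rho_ge0 : 0 <= rho.
Hypothesis mom_fin : (moment rho f < +oo)%E.

Let mf : measurable_fun setT f. Proof. by case: fF. Qed.
Let f0 x : 0 <= f x. Proof. by case: fF. Qed.

Lemma momentE : moment rho f = (fine (moment rho f))%:E.
Proof.
rewrite fineK// ge0_fin_numE//; apply: integral_ge0 => x _.
by rewrite lee_fin mulr_ge0// powR_ge0.
Qed.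

Lemma prob_norm_ge (L : R) i : 0 < L ->
  (P [set w | (L <= eucl_norm (X i w))%R] <= (L `^ (- rho) * fine (moment rho f))%:E)%E.
Proof.
move=> L0.
have mB : measurable [set y : T | L <= eucl_norm y].
  rewrite -[X in measurable X]setTI; apply: measurable_fun_le => //.
  exact: measurable_eucl_norm.
have := fX i mB; rewrite /preimage/= => ->.
have mn : measurable_fun setT (fun x : T => eucl_norm x `^ rho * f x).
  apply: measurable_funM => //; apply: (measurableT_comp (measurable_powR rho)).
  exact: measurable_eucl_norm.
rewrite EFinM -momentE /moment -ge0_integralZl//; last 3 first.
- exact/measurable_EFinP.
- by move=> x _; rewrite lee_fin mulr_ge0// powR_ge0.
- by rewrite lee_fin powR_ge0.
rewrite [leLHS]integral_mkcond; apply: ge0_le_integralT => x.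
  by rewrite patchE; case: ifP => // _; rewrite lee_fin.
rewrite patchE; case: ifPn => [|_]; last first.
  by rewrite mule_ge0// lee_fin ?mulr_ge0 ?powR_ge0.
rewrite inE/= => Lx; rewrite -EFinM lee_fin mulrA ler_peMl//.
rewrite powRN -ler_pdivrMl ?invr_gt0 ?powR_gt0// invrK mulr1.
by rewrite ge0_ler_powR// nnegrE ?eucl_norm_ge0// ltW.
Qed.

Definition tail_const : R :=
  j%:R * (4 * Num.sqrt d%:R) ^+ d + j.+1%:R * fine (moment rho f).

Lemma tail_const_ge0 : 0 <= tail_const.
Proof.
rewrite addr_ge0// mulr_ge0// ?exprn_ge0 ?mulr_ge0//.
by apply: fine_ge0; apply: integral_ge0 => x _; rewrite lee_fin mulr_ge0// powR_ge0.
Qed.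

(* The radius [t ^ (d / (d + rho))] of the large ball balances the number of
   cells against the mass outside of it. *)
Lemma isol_frac_tail t n : 0 < t -> (j < n)%N ->
  (\int[P]_w (isol_frac X j (@rad R d t n) n w)%:E <=
   (tail_const * t `^ (- (d%:R * rho / (d%:R + rho))))%:E)%E.
Proof.
move=> t0 jn; have n0 : (0 < n)%N by exact: leq_ltn_trans jn.
have n0' : 0 < n%:R :> R by rewrite ltr0n.
have d0' : 0 < d%:R :> R by rewrite ltr0n.
have dr : 0 < d%:R + rho by rewrite ltr_wpDr.
set s := d%:R * rho / (d%:R + rho).
pose L := t `^ (d%:R / (d%:R + rho)).
have L0 : 0 < L by exact: powR_gt0.
have r0 := @rad_gt0 R d t t0 n.
have LE : L `^ (- rho) = t `^ (- s).
  by rewrite /L -powRrM; congr (_ `^ _); rewrite /s; field; rewrite gt_eqF.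
have cellE : n%:R^-1 * (4 * Num.sqrt d%:R * L / @rad R d t n) ^+ d =
    (4 * Num.sqrt d%:R) ^+ d * t `^ (- s).
  rewrite !exprMn exprVn.
  have -> : n%:R^-1 * (4 ^+ d * Num.sqrt d%:R ^+ d * L ^+ d * (@rad R d t n ^+ d)^-1) =
      4 ^+ d * Num.sqrt d%:R ^+ d * (L ^+ d * (n%:R * @rad R d t n ^+ d)^-1).
    by rewrite invfM; ring.
  rewrite rad_exp//; congr (_ * _).
  have -> : L ^+ d = t `^ (d%:R / (d%:R + rho) * d%:R) by rewrite powRrM powR_mulrn// powR_ge0.
  have -> : (t ^+ d)^-1 = t `^ (- d%:R) by rewrite powRN powR_mulrn// ltW.
  rewrite -powRD; last by rewrite (gt_eqF t0) implybT.
  by congr (_ `^ _); rewrite /s; field; rewrite gt_eqF.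
have mo i : measurable [set w | (L <= eucl_norm (X i w))%R].
  rewrite -[X in measurable X]setTI; apply: measurable_fun_le => //.
  apply: (@measurableT_comp _ _ _ _ _ _ (@eucl_norm R d)); [exact: measurable_eucl_norm|exact: measurable_funPT].
have pw w : isol_frac X j (@rad R d t n) n w <=
    j%:R * (4 * Num.sqrt d%:R) ^+ d * t `^ (- s) +
    \sum_(i < n) n%:R^-1 * j.+1%:R * \1_[set w | (L <= eucl_norm (X i w))%R] w.
  have := isolated_count_le (X ^~ w) jn r0 L0; rewrite !count_iota !natr_sum => h.
  have ni : 0 <= n%:R^-1 :> R by rewrite invr_ge0 ltW.
  have := ler_wpM2l ni h; rewrite mulrDr mulrCA cellE mulrA.
  rewrite /isol_frac -mulr_sumr => /le_trans; apply; rewrite mulrA lerD2l mulr_sumr.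
  by apply: ler_sum => i _; rewrite indic_bool.
have m1 i : measurable_fun setT (fun w => (n%:R^-1 * j.+1%:R *
    \1_[set w | (L <= eucl_norm (X i w))%R] w)%:E : \bar R).
  apply/measurable_EFinP; apply: measurable_funM => //; exact: measurable_indic.
have A0 : 0 <= j%:R * (4 * Num.sqrt d%:R) ^+ d * t `^ (- s).
  by rewrite !mulr_ge0// ?exprn_ge0 ?powR_ge0// mulr_ge0.
apply: (@le_trans _ _ (\int[P]_w ((j%:R * (4 * Num.sqrt d%:R) ^+ d * t `^ (- s))%:E +
    \sum_(i < n) (n%:R^-1 * j.+1%:R * \1_[set w | (L <= eucl_norm (X i w))%R] w)%:E))%E).
  apply: ge0_le_integralT => w; last by rewrite sumEFin -EFinD lee_fin.
  by rewrite lee_fin; apply: sumr_ge0 => i _; rewrite mulr_ge0// invr_ge0.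
rewrite ge0_integralD//; last 2 first.
- by move=> w _; apply: sume_ge0 => i _; rewrite lee_fin !mulr_ge0// invr_ge0.
- exact: emeasurable_sum.
rewrite integral_cst_probability ge0_integral_sum//.
rewrite [tail_const * _]mulrDl EFinD; apply: leeD => //.
apply: (@le_trans _ _ (\sum_(i < n) (n%:R^-1 * j.+1%:R * (L `^ (- rho) * fine (moment rho f)))%:E)%E).
  apply: lee_sum => i _; under eq_integral do rewrite EFinM.
  have c0 : (0 <= (n%:R^-1 * j.+1%:R)%:E :> \bar R)%E by rewrite lee_fin mulr_ge0// invr_ge0.
  rewrite ge0_integralZl//; last by apply/measurable_EFinP; exact: measurable_indic.
  rewrite integral_indic// setIT [leRHS]EFinM; apply: lee_wpmul2l => //.
  exact: prob_norm_ge.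
rewrite sumEFin lee_fin sumr_const card_ord LE -[_ *+ n]mulr_natl.
rewrite le_eqVlt; apply/orP; left; apply/eqP; field; by rewrite gt_eqF.
Qed.

End isolated_tail.

(** * Nearest-neighbour distances *)

(* [undup] keeps last occurrences. *)
Lemma count_undup_map (K : eqType) (x : nat -> K) (p : pred K) m n :
  count p (undup (map x (iota m n))) =
  (\sum_(k < n) (p (x (m + k)%N) && all (fun l => x l != x (m + k)%N)
     (iota (m + k).+1 (n - k.+1))))%N.
Proof.
elim: n m => [|n IH] m; first by rewrite big_ord0.
rewrite big_ord_recl addn0 /= subSS subn0.
have -> : all (fun l => x l != x m) (iota m.+1 n) = (x m \notin map x (iota m.+1 n)).
  apply/allP/idP => [h|/negP h l ll]; last by apply/eqP => e; apply: h; rewrite -e map_f.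
  by apply/negP => /mapP[l ll e]; have := h l ll; rewrite e eqxx.
transitivity ((p (x m) && (x m \notin map x (iota m.+1 n))) + count p (undup (map x (iota m.+1 n))))%N.
  by case: ifP => /= h; rewrite ?andbF ?andbT.
rewrite IH; congr (_ + _)%N; apply: eq_bigr => k _.
by rewrite /bump/= add1n addSnnS subSS.
Qed.

Section order_statistic.
Context {R : realType}.

Lemma lt_nth_sort (s : seq R) (r : R) k : (k < size s)%N ->
  (r < nth 0 (sort <=%R s) k) = (count (fun v => v <= r)%R s <= k)%N.
Proof.
move=> ks; have ss : sorted <=%R (sort <=%R s) by exact: sort_le_sorted.
have pc : count (fun v => v <= r)%R s = count (<= r)%R (sort <=%R s).
  by apply: (permP _ _); rewrite perm_sym perm_sort.
rewrite pc; have [h|h] := leqP.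
  by apply: nth_count_gt => //; rewrite h size_sort.
by apply/negbTE; rewrite -leNgt; exact: nth_count_le.
Qed.

End order_statistic.

Lemma eucl_dist_le0 {R : realType} {d : nat} (y z : d.-tuple R) :
  (eucl_dist y z <= 0) = (y == z).
Proof. by rewrite -eucl_dist_eq0 eq_le eucl_dist_ge0 andbT. Qed.

Section nearest_neighbour.
Context {R : realType} {d : nat}.
Local Notation T := (d.-tuple R).
Variables (x : nat -> T) (n : nat).

Definition is_last k := all (fun l => x l != x k) (iota k.+1 (n - k.+1)).

Lemma count_fset_iota (p : pred T) :
  count p [fset x k | k in iota 0 n]%fset = (\sum_(k < n) (p (x k) && is_last k))%N.
Proof.
transitivity (count p (undup (map x (iota 0 n)))); last by rewrite count_undup_map.
apply: (permP _ _); apply: uniq_perm; rewrite ?fset_uniq ?undup_uniq// => y.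
rewrite mem_undup; apply/imfsetP/mapP => -[k /= kn ->]; by exists k.
Qed.

Lemma count_fsetD1 (p : pred T) (S : {fset T}) y :
  count p (S `\ y)%fset = count (fun z => (z != y) && p z) S.
Proof.
transitivity (count (predI p (predC1 y)) S); last by apply: eq_count => z /=; rewrite andbC.
rewrite -count_filter; apply: (permP _ _); apply: uniq_perm.
- exact: fset_uniq.
- by rewrite filter_uniq// fset_uniq.
by move=> z; rewrite mem_filter !inE.
Qed.

Lemma lt_nn_dist j (y : T) (S : {fset T}) (r : R) : (0 < j)%N -> y \in S -> 0 <= r ->
  (r < nn_dist j y S) = (j < count predT S)%N &&
    (count (fun z => (z != y) && (eucl_dist y z <= r)%R) S < j)%N.
Proof.
move=> j0 yS r0; rewrite count_predT /nn_dist -/(#|` S|); case: ifP => [jS|_] /=; last first.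
  by apply/negbTE; rewrite -leNgt.
rewrite lt_nth_sort; last first.
  rewrite size_map; move: jS; rewrite (cardfsD1 y) yS add1n ltnS => jS.
  by rewrite prednK.
by rewrite count_map count_fsetD1 -ltnS prednK.
Qed.

Lemma nn_dist_ge0 j (y : T) (S : {fset T}) : 0 <= nn_dist j y S.
Proof.
rewrite /nn_dist; case: ifP => // _.
set s := sort _ _; have [h|h] := ltnP j.-1 (size s); last by rewrite nth_default.
have : all (fun v => 0 <= v) s.
  by rewrite /s all_sort; apply/allP => v /mapP[z _ ->]; exact: eucl_dist_ge0.
by move=> /all_nthP; apply.
Qed.

Lemma lt_nn_dist_sample j i (r : R) : (0 < j)%N -> (i < n)%N -> 0 <= r ->
  (r < nn_dist j (x i) [fset x k | k in iota 0 n]%fset) =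
  (j < \sum_(k < n) is_last k)%N &&
  (\sum_(k < n) ([&& x k != x i, eucl_dist (x i) (x k) <= r & is_last k])%R < j)%N.
Proof.
move=> j0 ltin r0; rewrite lt_nn_dist//; last by apply/imfsetP; exists i => //=; rewrite mem_iota.
rewrite !count_fset_iota; congr (_ && (_ < _)%N).
by apply: eq_bigr => k _; rewrite andbA.
Qed.

Lemma lt_nn_dist_uniq j i (r : R) : (0 < j)%N -> (i < n)%N -> 0 <= r ->
  {in iota 0 n &, injective x} ->
  (r < nn_dist j (x i) [fset x k | k in iota 0 n]%fset) =
  (j < n)%N && isolated j r x n i.
Proof.
move=> j0 ltin r0 ux.
have L (k : 'I_n) : is_last k.
  apply/allP => l; rewrite mem_iota subnKC// => /andP[kl ln].
  apply/eqP => /ux; rewrite !mem_iota/= ln ltn_ord => /(_ isT isT) lk.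
  by rewrite lk ltnn in kl.
rewrite lt_nn_dist_sample//; congr (_ && _).
  by under eq_bigr do rewrite L; rewrite sum_nat_const card_ord muln1.
rewrite /isolated /nbrs count_iota; congr (_ < _)%N; apply: eq_bigr => k _.
rewrite L andbT; congr (nat_of_bool (_ && _)); congr (~~ _).
apply/eqP/eqP => [/ux|->//]; rewrite !mem_iota/= ltin ltn_ord; exact.
Qed.

End nearest_neighbour.

Section nn_dist_rv.
Context {R : realType} {dO : measure_display} {Omega : measurableType dO}
  {P : probability Omega R} {d : nat}.
Local Notation T := (d.-tuple R).
Variables (X : nat -> {RV P >-> T}) (j : nat).
Hypothesis j_gt0 : (0 < j)%N.

Lemma measurable_rv_neq i k : measurable [set w | X i w != X k w].
Proof.
rewrite (_ : [set _ | _] = ~` [set w | eucl_dist (X i w) (X k w) <= 0]); last first.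
  by apply/seteqP; split => w /=; rewrite eucl_dist_le0 => /negP.
by apply: measurableC; apply: measurable_dist_le; exact: measurable_funPT.
Qed.

Lemma measurable_is_last n k : measurable [set w | is_last (X ^~ w) n k].
Proof.
rewrite (_ : [set _ | _] = \bigcap_(l in [set` iota k.+1 (n - k.+1)]) [set w | X l w != X k w]).
  by apply: fin_bigcap_measurable => // l _; exact: measurable_rv_neq.
apply/seteqP; split => w /=; first by move=> /allP h l; exact: h.
by move=> h; apply/allP => l ll; exact: h.
Qed.

Lemma measurable_nn_dist n i : (i < n)%N ->
  measurable_fun setT (fun w => nn_dist j (X i w) (sample X n w)).
Proof.
move=> ltin mD; apply: (measurability _ (RGenOInfty.measurableE R)) => //.
move=> /= _ [_ [r -> <-]]; rewrite setTI.
have [r0|r0] := ltP r 0.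
  rewrite (_ : _ @^-1` _ = setT)//; apply/seteqP; split => // w _ /=.
  by rewrite in_itv/= andbT (lt_le_trans r0)// nn_dist_ge0.
rewrite (_ : _ @^-1` _ = ~` [set w | (\sum_(k < n) is_last (X ^~ w) n k < j.+1)%N] `&`
  [set w | (\sum_(k < n) ([&& X k w != X i w, eucl_dist (X i w) (X k w) <= r & is_last (X ^~ w) n k])%R < j)%N]).
  apply: measurableI.
    by apply: measurableC; apply: (@measurable_count_lt R) => k; exact: measurable_is_last.
  apply: (@measurable_count_lt R) => k.
  rewrite (_ : [set _ | _] = [set w | X k w != X i w] `&`
     ([set w | eucl_dist (X i w) (X k w) <= r] `&` [set w | is_last (X ^~ w) n k])); last first.
    by apply/seteqP; split => w /=; [move=> /and3P[]|move=> [? [? ?]]; apply/and3P].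
  apply: measurableI; first exact: measurable_rv_neq.
  apply: measurableI; last exact: measurable_is_last.
  by apply: measurable_dist_le; exact: measurable_funPT.
apply/seteqP; split => w; rewrite /preimage/= in_itv/= andbT /sample lt_nn_dist_sample//.
  by move=> /andP[h1 h2]; split => //; apply/negP; rewrite -leqNgt.
by move=> [/negP h1 h2]; rewrite -leqNgt in h1; apply/andP.
Qed.

End nn_dist_rv.

Section distinct.
Context {R : realType} {dO : measure_display} {Omega : measurableType dO}
  {P : probability Omega R} {d : nat}.
Local Notation T := (d.-tuple R).
Variables (X : nat -> {RV P >-> T}) (f : T -> R).
Hypothesis indX : mutually_independent X.
Hypothesis d_gt0 : (0 < d)%N.
Hypothesis fF : prob_density f.
Hypothesis fX : forall i, has_density (X i) f.

Lemma prob_eq0 i k : i != k -> P (~` [set w | X i w != X k w]) = 0%E.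
Proof.
move=> ik; apply/eqP; rewrite eq_le measure_ge0 andbT; apply/lee_addgt0Pr => e e0.
rewrite add0e.
have [N _ NP] := near_vanishes d_gt0 (ltr01 : (0 < 1 :> R)) fF fX e0.
have := NP N.+1 (leqnSn N); apply: le_trans.
have h := prob_near 1 indX fX ik (ltn0Sn N).
apply: le_trans h.
apply: le_measure; rewrite ?inE.
- by apply: measurableC; exact: measurable_rv_neq.
- by apply: measurable_dist_le; exact: measurable_funPT.
move=> w /= /negP; rewrite negbK -eucl_dist_le0 => /le_trans; apply.
by rewrite mulr_ge0// ?mulr_ge0// ltW// rad_gt0.
Qed.

Lemma ae_distinct n : {ae P, forall w, {in iota 0 n &, injective (X ^~ w)}}.
Proof.
apply: (@negligibleS _ _ _ _ (\bigcup_i \bigcup_k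
    (if i != k then ~` [set w | X i w != X k w] else set0))); last first.
  apply: negligible_bigcup => i; apply: negligible_bigcup => k.
  case: ifPn => ik; last exact: negligible_set0.
  apply/negligibleP; last exact: prob_eq0.
  by apply: measurableC; exact: measurable_rv_neq.
move=> w /= h; apply: contrapT => hU; apply: h => i k _ _ e.
apply/eqP; apply: contrapT => /negP ik; apply: hU.
by exists i => //; exists k => //; rewrite ik /= e eqxx.
Qed.

End distinct.

(** * Layers and convergence in L^q *)

Section weights.
Context {R : realType}.
Implicit Types e u : R.
Local Notation mu := (@lebesgue_measure R).

Definition weight e u : R := (0 < u)%R%:R * Num.max 1 u `^ e.

Lemma weight_ge0 e u : 0 <= weight e u.
Proof. by rewrite mulr_ge0// powR_ge0. Qed.

Lemma measurable_pos_indic : measurable_fun setT (fun u : R => (0 < u)%R%:R : R).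
Proof.
rewrite (_ : (fun _ => _) = \1_(`]0, +oo[%classic : set R)); first exact: measurable_indic.
apply/funext => u; rewrite -(indic_bool R (fun u => 0 < u)).
by congr (\1_ _ _); apply/seteqP; split => z; rewrite /= in_itv/= andbT.
Qed.

Lemma measurable_weight e : measurable_fun setT (weight e).
Proof.
apply: measurable_funM; first exact: measurable_pos_indic.
by apply: (measurableT_comp (measurable_powR e)); exact: measurable_maxr.
Qed.

Lemma powR_cvgy0 e : 0 < e -> (x : R) `^ (- e) @[x --> +oo] --> 0.
Proof.
move=> e0; apply/cvgrPdist_lt => a a0; near=> x.
have x0 : 0 < x by near: x; exact: nbhs_pinfty_gt.
rewrite sub0r normrN ger0_norm ?powR_ge0//.
have ax : (a^-1) `^ e^-1 < x by near: x; apply: nbhs_pinfty_gt; rewrite num_real.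
rewrite powRN -[ltRHS]invrK ltf_pV2 ?posrE ?invr_gt0 ?powR_gt0//.
have -> : a^-1 = ((a^-1) `^ e^-1) `^ e.
  by rewrite -powRrM mulVf ?powRr1 ?gt_eqF// invr_ge0 ltW.
by apply: gt0_ltr_powR; rewrite ?nnegrE ?powR_ge0 ?(ltW x0).
Unshelve. all: by end_near. Qed.

Lemma integral_powR_tail e : 1 < e -> (\int[mu]_(x in `[1%R, +oo[) (x `^ (- e))%:E = (1 / (e - 1))%:E)%E.
Proof.
move=> e1; have e1' : 0 < e - 1 by rewrite subr_gt0.
pose G (x : R) : R := - (x `^ (- (e - 1)) / (e - 1)).
have dG (x : R) : 0 < x -> is_derive x 1 G (x `^ (- e)).
  move=> x0.
  have xin : x \in `]0%R, +oo[ by rewrite in_itv/= x0.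
  have d1 : is_derive x 1 (@powR R ^~ (- (e - 1))) (- (e - 1) * x `^ (- e)).
    apply: DeriveDef; first exact: derivable_powR.
    rewrite -derive1E powR_derive1//; congr (_ * _ `^ _); ring.
  rewrite [X in is_derive _ _ X](_ : G = (- (e - 1)^-1) *: (@powR R ^~ (- (e - 1)))); last first.
    by apply/funext => y; rewrite /G; change (- (y `^ (- (e - 1)) / (e - 1)) = - (e - 1)^-1 * y `^ (- (e - 1))); rewrite mulNr mulrC.
  apply: (is_derive_eq (is_deriveZ _ d1)).
  rewrite /GRing.scale/=; field; by rewrite gt_eqF.
rewrite (@ge0_continuous_FTC2y _ _ G 1 0).
- by rewrite /G powR1 sub0e -EFinN opprK.
- by move=> x _; exact: powR_ge0.
- apply: continuous_in_subspaceT => x; rewrite inE/= in_itv/= andbT => x1.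
  have x0 : 0 < x by exact: lt_le_trans x1.
  apply: differentiable_continuous; apply/derivable1_diffP; apply: derivable_powR.
  by rewrite in_itv/= x0.
- rewrite /G -[X in _ --> X](_ : - (0 / (e - 1)) = 0); last by rewrite mul0r oppr0.
  by apply: cvgN; apply: cvgMl; exact: powR_cvgy0.
- by move=> x x1; have [] := dG x (lt_trans ltr01 x1).
- apply: cvg_at_right_filter; apply: differentiable_continuous.
  by apply/derivable1_diffP; have [] := dG 1 ltr01.
- move=> x; rewrite in_itv/= andbT => x1; rewrite derive1E.
  by apply: derive_val; exact: dG (lt_trans ltr01 x1).
Qed.

Lemma weight_integrable e : 1 < e -> (\int[mu]_u (weight (- e) u)%:E < +oo)%E.
Proof.
move=> e1.
pose h u : \bar R := (\1_(`[0%R, 1%R]%classic : set R) u)%:E.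
pose k : R -> \bar R := (fun u => (u `^ (- e))%:E) \_ (`[1%R, +oo[ : set R).
have mh : measurable_fun setT h by apply/measurable_EFinP; exact: measurable_indic.
have mk : measurable_fun setT k.
  apply: (iffLR (measurable_restrictT _ _)) => //.
  by apply: measurable_funTS; apply/measurable_EFinP; exact: measurable_powR.
have k0 u : (0 <= k u)%E by rewrite /k patchE; case: ifP => // _; rewrite lee_fin powR_ge0.
apply: (@le_lt_trans _ _ (\int[mu]_u (h u + k u))%E).
  apply: ge0_le_integralT => u; first by rewrite lee_fin weight_ge0.
  rewrite /weight; case: (ltP 0 u) => u0; last first.
    rewrite mul0r; apply: adde_ge0 => //; by rewrite /h lee_fin.
  rewrite mul1r; case: (leP u 1) => u1.
    rewrite powR1 /h indicE mem_set/=; last by rewrite in_itv/= (ltW u0).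
    by rewrite leeDl.
  rewrite /k patchE mem_set/=; last by rewrite in_itv/= ltW.
  by rewrite leeDr// lee_fin.
rewrite ge0_integralD//; last by move=> u _; rewrite /h lee_fin.
have -> : (\int[mu]_u h u = 1)%E.
  rewrite /h integral_indic//= setIT lebesgue_measure_itv/= lte_fin ltr01.
  by rewrite -EFinB subr0.
have -> : (\int[mu]_u k u = (1 / (e - 1))%:E)%E.
  by rewrite /k -integral_mkcond integral_powR_tail.
by rewrite -EFinD ltry.
Qed.

End weights.

Section layer_norm.
Context {R : realType} {dO : measure_display} {Omega : measurableType dO}
  (P : probability Omega R).
Variables (q : nat) (kappa : R).
Hypothesis q12 : q = 1%N \/ q = 2%N.
Hypothesis kappa_gt : q%:R < kappa.
Local Notation mu := (@lebesgue_measure R).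

Definition layer_exp : R := (q%:R - 1) * (kappa / 2).

Definition layer_cst : R := 1 + fine (\int[mu]_u (weight (- (kappa / 2)) u)%:E).

Lemma layer_cst_gt0 : 0 < layer_cst.
Proof.
rewrite ltr_wpDr//; apply: fine_ge0; apply: integral_ge0 => u _.
by rewrite lee_fin weight_ge0.
Qed.

Lemma layer_exp_integrable : (\int[mu]_u (weight (layer_exp - kappa) u)%:E < +oo)%E.
Proof.
rewrite -[layer_exp - _]opprK; apply: weight_integrable.
by move: kappa_gt; rewrite /layer_exp; case: q12 => ->; lra.
Qed.

(* For [q = 2] this is the Cauchy-Schwarz inequality with weight [u ^ (kappa / 2)],
   in the form of the arithmetic-geometric mean inequality. *)
Lemma layer_norm_le (D : R -> R) (a : R) : measurable_fun setT D ->
  (forall u, 0 <= D u) -> (forall u, D u <= 1) -> (forall u, u <= 0 -> D u = 0) ->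
  0 <= a -> (a%:E <= \int[mu]_u (D u)%:E)%E ->
  ((a ^+ q)%:E <= layer_cst%:E * \int[mu]_u (weight layer_exp u * D u)%:E)%E.
Proof.
move=> mD D0 D1 Dneg a0 aD.
have W1 : 1 <= layer_cst.
  by rewrite lerDl; apply: fine_ge0; apply: integral_ge0 => u _; rewrite lee_fin weight_ge0.
have I0 e : (0 <= \int[mu]_u (weight e u * D u)%:E)%E.
  by apply: integral_ge0 => u _; rewrite lee_fin mulr_ge0// weight_ge0.
have mwD e : measurable_fun setT (fun u => (weight e u * D u)%:E).
  by apply/measurable_EFinP; apply: measurable_funM => //; exact: measurable_weight.
case: q12 => q1; rewrite /layer_exp q1.
  rewrite subrr mul0r expr1 (le_trans aD)//.
  have -> : (\int[mu]_u (D u)%:E = \int[mu]_u (weight 0 u * D u)%:E)%E.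
    apply: eq_integral => u _; rewrite /weight powRr0 mulr1; case: ltP => u0; first by rewrite mul1r.
    by rewrite mul0r Dneg.
  by rewrite -[leLHS]mul1e; apply: lee_wpmul2r.
have -> : (2 - 1) * (kappa / 2) = kappa / 2 :> R by ring.
have k2 : 1 < kappa / 2 by move: kappa_gt; rewrite q1; lra.
have Wfin := weight_integrable k2.
set w1 := (\int[mu]_u (weight (- (kappa / 2)) u)%:E)%E in Wfin.
have w10 : (0 <= w1)%E by apply: integral_ge0 => u _; rewrite lee_fin weight_ge0.
have w1E : w1 = (fine w1)%:E by rewrite fineK// ge0_fin_numE.
have [->|ane] := eqVneq a 0.
  by rewrite expr0n/= mule_ge0// lee_fin ltW// layer_cst_gt0.
have {}a0 : 0 < a by rewrite lt_neqAle eq_sym ane.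
have W0 := layer_cst_gt0.
pose lam := layer_cst / a.
have lam0 : 0 < lam by rewrite divr_gt0.
have step : (a%:E <= (lam / 2)%:E * \int[mu]_u (weight (kappa / 2) u * D u)%:E + (1 / (2 * lam))%:E * w1)%E.
  rewrite -ge0_integralZl//; last 3 first.
  - exact: mwD.
  - by move=> u _; rewrite lee_fin mulr_ge0// weight_ge0.
  - by rewrite lee_fin divr_ge0// ltW.
  have mw : measurable_fun setT (fun u : R => (weight (- (kappa / 2)) u)%:E).
    by apply/measurable_EFinP; exact: measurable_weight.
  rewrite -ge0_integralZl//; last 2 first.
  - by move=> u _; rewrite lee_fin weight_ge0.
  - by rewrite lee_fin divr_ge0// mulr_ge0// ltW.
  rewrite -ge0_integralD//; last 4 first.
  - move=> u _; apply: mule_ge0; rewrite lee_fin; first by rewrite divr_ge0// ltW.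
    by rewrite mulr_ge0// weight_ge0.
  - by apply: emeasurable_funM => //; exact: mwD.
  - move=> u _; apply: mule_ge0; rewrite lee_fin ?weight_ge0//.
    by rewrite divr_ge0// mulr_ge0// ltW.
  - by apply: emeasurable_funM => //; exact: mw.
  apply: le_trans aD _; apply: ge0_le_integralT => u; first by rewrite lee_fin.
  rewrite -!EFinM -EFinD lee_fin.
  case: (ltP 0 u) => u0; last by rewrite Dneg// /weight (le_gtF u0) !mul0r !mulr0 addr0.
  rewrite /weight u0 !mul1r powRN; set b := _ `^ _.
  have b0 : 0 < b by rewrite powR_gt0// lt_max ltr01.
  rewrite -subr_ge0.
  have -> : lam / 2 * (b * D u) + (2 * lam)^-1 * b^-1 - D u =
      (lam / 2 * b * D u ^+ 2 - D u + 1 / (2 * lam * b)) + lam / 2 * b * (D u * (1 - D u)).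
    by field; rewrite !gt_eqF.
  rewrite addr_ge0//; last first.
    apply: mulr_ge0; last by rewrite mulr_ge0// subr_ge0.
    by apply: mulr_ge0; [apply: divr_ge0 => //; exact: ltW|exact: ltW].
  have -> : lam / 2 * b * D u ^+ 2 - D u + 1 / (2 * lam * b) = (lam * b * D u - 1) ^+ 2 / (2 * lam * b).
    by field; rewrite !gt_eqF.
  apply: divr_ge0; first exact: sqr_ge0.
  by apply: mulr_ge0; [apply: mulr_ge0 => //; exact: ltW|exact: ltW].
move: step (I0 (kappa / 2)); rewrite w1E.
have w1W : fine w1 <= layer_cst by rewrite /layer_cst -/w1 lerDr.
have fw0 : 0 <= fine w1 by exact: fine_ge0.
case: (\int[mu]_u (weight (kappa / 2) u * D u)%:E)%E => [B||]//; last first.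
  by move=> _ _; rewrite gt0_muley ?leey// lte_fin.
rewrite -!EFinM -EFinD !lee_fin => h B0.
have h2 : 1 / (2 * lam) * fine w1 <= a / 2.
  have -> : 1 / (2 * lam) * fine w1 = a / 2 * (fine w1 / layer_cst).
    by rewrite /lam; field; rewrite !gt_eqF.
  by rewrite ler_piMr ?divr_ge0 ?(ltW a0)// ler_pdivrMr// mul1r.
have h3 : a <= lam * B by lra.
by rewrite expr2 -[leRHS]mulrC -ler_pdivlMr// mulrC; move: h3; rewrite /lam mulrAC.
Qed.

End layer_norm.

Section layer_moments.
Context {R : realType} {dO : measure_display} {Omega : measurableType dO}
  (P : probability Omega R).
Variables (q : nat) (kappa : R).
Hypothesis q12 : q = 1%N \/ q = 2%N.
Hypothesis kappa_gt : q%:R < kappa.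
Local Notation mu := (@lebesgue_measure R).
Local Notation wt := (weight (layer_exp q kappa)).

Lemma layer_moment_le (D : R -> Omega -> R) (A : Omega -> R) :
  measurable_fun setT (fun z : measurableTypeR R * Omega => D z.1 z.2) ->
  (forall u w, 0 <= D u w) -> (forall u w, D u w <= 1) ->
  (forall u w, u <= 0 -> D u w = 0) ->
  (forall w, 0 <= A w) -> (forall w, ((A w)%:E <= \int[mu]_u (D u w)%:E)%E) ->
  (\int[P]_w ((A w) ^+ q)%:E <=
   (layer_cst kappa)%:E * \int[mu]_u ((wt u)%:E * \int[P]_w (D u w)%:E))%E.
Proof.
move=> mD D0 D1 Dneg A0 AD.
have c0 := layer_cst_gt0 kappa.
have mF : measurable_fun setT (fun z : Omega * measurableTypeR R => (wt z.2 * D z.2 z.1)%:E).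
  apply/measurable_EFinP; apply: measurable_funM.
    by apply: (measurableT_comp (measurable_weight _)).
  apply: (measurableT_comp mD (g := fun z : Omega * measurableTypeR R => (z.2, z.1))).
  exact: measurable_fun_pair.
have F0 w u : (0 <= (wt u * D u w)%:E)%E by rewrite lee_fin mulr_ge0// weight_ge0.
apply: (@le_trans _ _ (\int[P]_w ((layer_cst kappa)%:E * \int[mu]_u (wt u * D u w)%:E))%E).
  apply: ge0_le_integralT => w; first by rewrite lee_fin exprn_ge0.
  apply: layer_norm_le => //; last by move=> u; exact: Dneg.
  exact: (measurable_section2 w mD).
rewrite ge0_integralZl//; last 3 first.
- exact: (@measurable_tonelli _ _ _ _ _ mu (fun w u => (wt u * D u w)%:E)).
- by move=> w _; apply: integral_ge0.
- by rewrite lee_fin ltW.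
rewrite (@tonelli_swap _ _ _ _ _ P mu (fun w u => (wt u * D u w)%:E))//.
rewrite le_eqVlt; apply/orP; left; apply/eqP; congr (_ * _)%E.
apply: eq_integral => u _; under eq_integral do rewrite EFinM.
rewrite ge0_integralZl//; last 2 first.
- by move=> w _; rewrite lee_fin.
- by rewrite lee_fin weight_ge0.
by apply/measurable_EFinP; exact: (measurable_section1 u mD).
Qed.

Section moment_bounds.
Variables (D : nat -> R -> Omega -> R) (A : nat -> Omega -> R) (K : R).
Hypothesis mD : forall n, measurable_fun setT (fun z : measurableTypeR R * Omega => D n z.1 z.2).
Hypothesis D_ge0 : forall n u w, 0 <= D n u w.
Hypothesis D_le1 : forall n u w, D n u w <= 1.
Hypothesis D_neg : forall n u w, u <= 0 -> D n u w = 0.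
Hypothesis A_ge0 : forall n w, 0 <= A n w.
Hypothesis AD : forall n w, ((A n w)%:E <= \int[mu]_u (D n u w)%:E)%E.
Hypothesis K_ge0 : 0 <= K.
Hypothesis DK : forall n u, 0 < u ->
  (\int[P]_w (D n u w)%:E <= (K * Num.max 1 u `^ (- kappa))%:E)%E.

Let dom u : \bar R := (K%:E * (weight (layer_exp q kappa - kappa) u)%:E)%E.

Let dom_ge0 u : (0 <= dom u)%E.
Proof. by rewrite mule_ge0// lee_fin ?weight_ge0. Qed.

Let measurable_dom : measurable_fun setT dom.
Proof. by apply: emeasurable_funM => //; apply/measurable_EFinP; exact: measurable_weight. Qed.

Let int_dom_fin : (\int[mu]_u dom u < +oo)%E.
Proof.
rewrite /dom ge0_integralZl//.
- by apply: lte_mul_pinfty => //; exact: layer_exp_integrable.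
- by apply/measurable_EFinP; exact: measurable_weight.
- by move=> u _; rewrite lee_fin weight_ge0.
Qed.

Let ED_ge0 n u : (0 <= (wt u)%:E * \int[P]_w (D n u w)%:E)%E.
Proof.
by apply: mule_ge0; [rewrite lee_fin weight_ge0|apply: integral_ge0 => w _; rewrite lee_fin].
Qed.

Let ED_le n u : ((wt u)%:E * \int[P]_w (D n u w)%:E <= dom u)%E.
Proof.
have [u0|u0] := ltP 0 u; last first.
  by rewrite [wt u]/weight (le_gtF u0) mul0r mul0e.
apply: (@le_trans _ _ ((wt u)%:E * (K * Num.max 1 u `^ (- kappa))%:E)%E).
  by apply: lee_wpmul2l; [rewrite lee_fin weight_ge0|exact: DK].
rewrite /dom -!EFinM lee_fin /weight u0 !mul1r mulrCA -powRD//.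
by apply/implyP => _; rewrite gt_eqF// lt_max ltr01.
Qed.

Let measurable_ED n : measurable_fun setT (fun u => ((wt u)%:E * \int[P]_w (D n u w)%:E)%E).
Proof.
apply: emeasurable_funM; first by apply/measurable_EFinP; exact: measurable_weight.
apply: (@measurable_tonelli _ _ _ _ _ P (fun (u : measurableTypeR R) w => (D n u w)%:E)).
  exact/measurable_EFinP.
by move=> u w; rewrite lee_fin.
Qed.

Lemma layer_moment_fin n : (\int[P]_w ((A n w) ^+ q)%:E < +oo)%E.
Proof.
apply: le_lt_trans (layer_moment_le (mD n) (D_ge0 n) (D_le1 n) (D_neg n) (A_ge0 n) (AD n)) _.
apply: lte_mul_pinfty => //; first exact/ltW/layer_cst_gt0.
by apply: le_lt_trans int_dom_fin; apply: ge0_le_integralT.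
Qed.

Lemma layer_moment_vanishes :
  (forall u, 0 < u -> vanishes (fun n => \int[P]_w (D n u w)%:E)%E) ->
  vanishes (fun n => \int[P]_w ((A n w) ^+ q)%:E)%E.
Proof.
move=> Dv.
apply: (@vanishes_le _ _ (fun n => (layer_cst kappa)%:E *
    \int[mu]_u ((wt u)%:E * \int[P]_w (D n u w)%:E))%E).
  by move=> n; exact: layer_moment_le (mD n) (D_ge0 n) (D_le1 n) (D_neg n) (A_ge0 n) (AD n).
apply: vanishesZ; first exact/ltW/layer_cst_gt0.
  by move=> n; apply: integral_ge0.
apply: (@dominated_vanishes _ _ _ mu setT _ dom) => //.
- move=> u _; have [u0|u0] := ltP 0 u; last first.
    apply: vanishes_le (@vanishes0 R) => n.
    by rewrite [wt u]/weight (le_gtF u0) mul0r mul0e.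
  apply: vanishesZ; [exact: weight_ge0| |exact: Dv].
  by move=> n; apply: integral_ge0 => w _; rewrite lee_fin.
- apply/integrableP; split => //.
  have -> : (\int[mu]_u `|dom u| = \int[mu]_u dom u)%E => //.
  by apply: eq_integral => u _; rewrite gee0_abs.
Qed.

End moment_bounds.

End layer_moments.

Section layers.
Context {R : realType} {dO : measure_display} {Omega : measurableType dO}
  {P : probability Omega R} {d : nat}.
Local Notation T := (d.-tuple R).
Variables (X : nat -> {RV P >-> T}) (f : T -> R) (j : nat) (alpha : R).
Hypothesis indX : mutually_independent X.
Hypothesis d_gt0 : (0 < d)%N.
Hypothesis j_gt0 : (0 < j)%N.
Hypothesis alpha_gt0 : 0 < alpha.
Hypothesis fF : prob_density f.
Hypothesis fX : forall i, has_density (X i) f.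
Local Notation mu := (@lebesgue_measure R).

Let F : probability T R := distribution P (X 0%N).
Let mf : measurable_fun setT f. Proof. by case: fF. Qed.
Let f0 x : 0 <= f x. Proof. by case: fF. Qed.

Definition scaled_nn n i w : R :=
  (n%:R `^ (d%:R)^-1 * nn_dist j (X i w) (sample X n w)) `^ alpha.

Definition nn_layer n u w : R := \sum_(i < n) n%:R^-1 * layer (scaled_nn n i w) u.

Lemma measurable_scaled_nn n (i : 'I_n) : measurable_fun setT (scaled_nn n i).
Proof.
apply: (measurableT_comp (measurable_powR alpha)); apply: measurable_funM => //.
exact: measurable_nn_dist.
Qed.

Lemma layer_ge0 (y u : R) : 0 <= layer y u. Proof. exact: ler0n. Qed.

Lemma nn_layer_ge0 n u w : 0 <= nn_layer n u w.
Proof. by apply: sumr_ge0 => i _; rewrite mulr_ge0// ?invr_ge0// layer_ge0. Qed.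

Lemma nn_layer_le1 n u w : nn_layer n u w <= 1.
Proof.
have [->|n0] := posnP n; first by rewrite /nn_layer big_ord0.
apply: (@le_trans _ _ (\sum_(i < n) n%:R^-1)).
  by apply: ler_sum => i _; rewrite ler_piMr ?invr_ge0// lern1 leq_b1.
by rewrite sumr_const card_ord -[_ *+ n]mulr_natl mulfV// pnatr_eq0 -lt0n.
Qed.

Lemma nn_layer_neg n u w : u <= 0 -> nn_layer n u w = 0.
Proof. by move=> u0; apply: big1 => i _; rewrite /layer (le_gtF u0) mulr0. Qed.

Lemma measurable_nn_layer n :
  measurable_fun setT (fun z : measurableTypeR R * Omega => nn_layer n z.1 z.2).
Proof.
apply: measurable_sum => i; apply: measurable_funM => //; apply: measurable_layer => //.
by apply: (measurableT_comp (measurable_scaled_nn i)).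
Qed.

Lemma S_stat_layers n w :
  ((n%:R^-1 * S_stat j alpha X n w)%:E = \int[mu]_u (nn_layer n u w)%:E)%E.
Proof.
rewrite /S_stat big_mkord mulr_sumr -sumEFin.
under [RHS]eq_integral do rewrite -sumEFin.
rewrite ge0_integral_sum//; last 2 first.
- move=> i; apply/measurable_EFinP; apply: measurable_funM => //.
  exact: measurable_layer.
- by move=> i u _; rewrite lee_fin mulr_ge0// ?invr_ge0// layer_ge0.
apply: eq_bigr => i _; under eq_integral do rewrite EFinM.
rewrite ge0_integralZl//; last 2 first.
- by apply/measurable_EFinP; exact: measurable_layer.
- by move=> u _; rewrite lee_fin layer_ge0.
by rewrite integral_layer ?powR_ge0// -EFinM.
Qed.

Lemma nn_layer_isolated n u w : (0 < n)%N -> 0 < u ->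
  {in iota 0 n &, injective (X ^~ w)} ->
  nn_layer n u w = (j < n)%N%:R * isol_frac X j (@rad R d (u `^ alpha^-1) n) n w.
Proof.
move=> n0 u0 Xw; rewrite /nn_layer /isol_frac mulr_sumr; apply: eq_bigr => i _.
rewrite mulrCA; congr (_ * _); rewrite /layer u0/= -natrM mulnb; congr (_%:R).
rewrite -(@lt_nn_dist_uniq _ _ (X ^~ w)) ?ltW ?rad_gt0 ?powR_gt0//.
rewrite /scaled_nn -/(sample X n w); set D := nn_dist _ _ _.
have D0 : 0 <= D by exact: nn_dist_ge0.
set a := n%:R `^ _.
have a0 : 0 < a by rewrite powR_gt0// ltr0n.
have aD0 : 0 <= a * D by rewrite mulr_ge0// ltW.
have -> : @rad R d (u `^ alpha^-1) n = u `^ alpha^-1 / a.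
  by rewrite /rad (maxn_idPr n0) powRN.
rewrite ltr_pdivrMr// [D * a]mulrC; congr nat_of_bool.
have uE : u = (u `^ alpha^-1) `^ alpha by rewrite -powRrM mulVf ?gt_eqF// powRr1// ltW.
apply/idP/idP => h.
  rewrite ltNge; apply/negP => h'.
  have := ge0_ler_powR (ltW alpha_gt0) _ _ h'; rewrite -uE !nnegrE powR_ge0 => /(_ aD0 isT).
  by rewrite leNgt h.
by rewrite [ltLHS]uE; apply: gt0_ltr_powR; rewrite ?nnegrE ?powR_ge0.
Qed.

Definition limit_layer u : R := (0 < u)%R%:R * pois_avg F f j (u `^ alpha^-1).

Let pois_avg_ge0 t : 0 < t -> 0 <= pois_avg F f j t.
Proof.
move=> t0; rewrite -lee_fin -(pois_avgE F j t0 fF); apply: integral_ge0 => x _.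
by rewrite lee_fin pois_lt_ge0// pois_arg_ge0.
Qed.

Lemma pois_avg_le1 t : 0 < t -> pois_avg F f j t <= 1.
Proof.
move=> t0; rewrite -lee_fin -(pois_avgE F j t0 fF) -(integral_cst_probability F 1).
by apply: ge0_le_integralT => x; rewrite lee_fin ?pois_lt_ge0 ?pois_lt_le1// pois_arg_ge0.
Qed.

Lemma limit_layer_ge0 u : 0 <= limit_layer u.
Proof.
rewrite /limit_layer; case: ltP => u0; rewrite ?mul0r// mul1r.
by rewrite pois_avg_ge0// powR_gt0.
Qed.

Lemma limit_layer_le1 u : limit_layer u <= 1.
Proof.
rewrite /limit_layer; case: ltP => u0; rewrite ?mul0r// mul1r.
by rewrite pois_avg_le1// powR_gt0.
Qed.

Lemma continuous_pois_lt m : continuous (pois_lt m : R -> R).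
Proof.
move=> x; apply: differentiable_continuous.
by apply/derivable1_diffP; have [] := is_derive_pois_lt m x.
Qed.

Lemma measurable_layer_integrand : measurable_fun setT
  (fun z : measurableTypeR R * T =>
    (0 < z.1)%R%:R * pois_lt j (ball_vol R d * (z.1 `^ alpha^-1) ^+ d * f z.2)).
Proof.
apply: measurable_funM.
  exact: (measurableT_comp (@measurable_pos_indic R)).
apply: (measurableT_comp (continuous_measurable_fun (@continuous_pois_lt j))).
apply: measurable_funM; last exact: (measurableT_comp mf).
apply: measurable_funM => //; apply: (measurableT_comp (exprn_measurable d)).
exact: (measurableT_comp (measurable_powR alpha^-1)).
Qed.

Lemma limit_layerE u : ((limit_layer u)%:E = \int[F]_x
   ((0 < u)%R%:R * pois_lt j (ball_vol R d * (u `^ alpha^-1) ^+ d * f x))%:E)%E.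
Proof.
rewrite /limit_layer; case: ltP => u0; last first.
  by rewrite mul0r integral0_eq// => x _; rewrite mul0r.
rewrite mul1r -pois_avgE ?powR_gt0//.
by apply: eq_integral => x _; rewrite mul1r.
Qed.

Lemma measurable_limit_layer : measurable_fun setT limit_layer.
Proof.
apply/measurable_EFinP; rewrite (_ : EFin \o _ = fun u => \int[F]_x
   ((0 < u)%R%:R * pois_lt j (ball_vol R d * (u `^ alpha^-1) ^+ d * f x))%:E)%E; last first.
  by apply/funext => u; rewrite -limit_layerE.
apply: (@measurable_tonelli _ _ _ _ _ F (fun (u : measurableTypeR R) x =>
   ((0 < u)%R%:R * pois_lt j (ball_vol R d * (u `^ alpha^-1) ^+ d * f x))%:E)).
  by apply/measurable_EFinP; exact: measurable_layer_integrand.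
move=> u x; rewrite lee_fin; case: ltP => u0; rewrite ?mul0r// mul1r.
by rewrite pois_lt_ge0// pois_arg_ge0// powR_gt0.
Qed.

End layers.

Section convergence.
Context {R : realType} {dO : measure_display} {Omega : measurableType dO}
  {P : probability Omega R} {d : nat}.
Local Notation T := (d.-tuple R).
Variables (X : nat -> {RV P >-> T}) (f : T -> R) (j q : nat) (alpha rho : R).
Hypothesis indX : mutually_independent X.
Hypothesis d_gt0 : (0 < d)%N.
Hypothesis j_gt0 : (0 < j)%N.
Hypothesis alpha_gt0 : 0 < alpha.
Hypothesis fF : prob_density f.
Hypothesis fX : forall i, has_density (X i) f.
Hypothesis rho_ge0 : 0 <= rho.
Hypothesis mom_fin : (moment rho f < +oo)%E.
Hypothesis q12 : q = 1%N \/ q = 2%N.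
Let kappa := d%:R * rho / (d%:R + rho) / alpha.
Hypothesis kappa_gt : q%:R < kappa.
Local Notation mu := (@lebesgue_measure R).

Local Notation V := (nn_layer X j alpha).
Local Notation c := (limit_layer X f j alpha).
Let C := tail_const f j rho.

Let C_ge0 : 0 <= C. Proof. exact: tail_const_ge0. Qed.

Lemma measurable_nn_layer_at n u : measurable_fun setT (V n u).
Proof. exact: (measurable_section1 u (measurable_nn_layer X alpha j_gt0 n)). Qed.

Lemma nn_layer_mean n u : 0 < u ->
  (\int[P]_w (V n u w)%:E <= (C * u `^ (- kappa))%:E)%E.
Proof.
move=> u0; have t0 : 0 < u `^ alpha^-1 by exact: powR_gt0.
have B0 : 0 <= C * u `^ (- kappa) by rewrite mulr_ge0// powR_ge0.
have [->|n0] := posnP n.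
  by rewrite integral0_eq ?lee_fin// => w _; rewrite /nn_layer big_ord0.
rewrite (ge0_ae_eq_integral (g := fun w => ((j < n)%N%:R *
    isol_frac X j (@rad R d (u `^ alpha^-1) n) n w)%:E))//; last first.
- apply: filterS (ae_distinct indX d_gt0 fF fX n) => w Xw _.
  by congr EFin; exact: nn_layer_isolated.
- move=> w _; rewrite lee_fin mulr_ge0//; apply: sumr_ge0 => i _.
  by rewrite mulr_ge0// invr_ge0.
- by move=> w _; rewrite lee_fin nn_layer_ge0.
- by apply/measurable_EFinP; apply: measurable_funM => //; exact: measurable_isol_frac.
- by apply/measurable_EFinP; exact: measurable_nn_layer_at.
case: ltnP => jn; last by rewrite integral0_eq ?lee_fin// => w _; rewrite mul0r.
under eq_integral do rewrite mul1r.
apply: le_trans (isol_frac_tail d_gt0 fF fX rho_ge0 mom_fin t0 jn) _.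
rewrite lee_fin -powRrM le_eqVlt; apply/orP; left; apply/eqP; congr (_ * _ `^ _).
by rewrite /kappa; field; rewrite !gt_eqF// ltr_wpDr// ltr0n.
Qed.

Let measurable_diff n u : measurable_fun setT (fun w => (`|V n u w - c u|)%:E).
Proof.
apply/measurable_EFinP; apply: measurableT_comp => //; apply: measurable_funB => //.
exact: measurable_nn_layer_at.
Qed.

Lemma nn_layer_cvg u : 0 < u -> vanishes (fun n => \int[P]_w (`|V n u w - c u|)%:E)%E.
Proof.
move=> u0; have t0 : 0 < u `^ alpha^-1 by exact: powR_gt0.
move=> e e0; near=> n.
have jn : (j < n)%N by near: n; exact: nbhs_infty_gt.
have n0 : (0 < n)%N by exact: leq_ltn_trans jn.
rewrite (ge0_ae_eq_integral (g := fun w => (`|isol_frac X j (@rad R d (u `^ alpha^-1) n) n w -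
    pois_avg (distribution P (X 0%N)) f j (u `^ alpha^-1)|)%:E))//; last 2 first.
- apply/measurable_EFinP; apply: measurableT_comp => //; apply: measurable_funB => //.
  exact: measurable_isol_frac.
- apply: filterS (ae_distinct indX d_gt0 fF fX n) => w Xw _.
  by rewrite /limit_layer u0 mul1r nn_layer_isolated// jn mul1r.
near: n; exact: isol_frac_cvg.
Unshelve. all: by end_near. Qed.

Lemma limit_layer_tail u : 0 < u -> c u <= C * u `^ (- kappa).
Proof.
move=> u0; rewrite -lee_fin; apply/lee_addgt0Pr => e e0.
have [N _ NP] := nn_layer_cvg u0 e0.
have := NP N (leqnn N); have := nn_layer_mean N u0.
move=> h1 h2; apply: le_trans (leeD h1 h2).
rewrite -(integral_cst_probability P (c u)) -ge0_integralD//; last 2 first.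
- by move=> w _; rewrite lee_fin nn_layer_ge0.
- by apply/measurable_EFinP; exact: measurable_nn_layer_at.
apply: ge0_le_integralT => w; first by rewrite lee_fin limit_layer_ge0.
by rewrite -EFinD lee_fin; have := ler_norm (c u - V N u w); rewrite distrC; lra.
Qed.

Let K := 1 + 2 * C.

Let K_ge0 : 0 <= K. Proof. by rewrite addr_ge0// mulr_ge0. Qed.

Lemma le_layer_bound (a : \bar R) u : 0 < u -> (a <= 1)%E -> (a <= (2 * C * u `^ (- kappa))%:E)%E ->
  (a <= (K * Num.max 1 u `^ (- kappa))%:E)%E.
Proof.
move=> u0 a1 au; case: (leP u 1) => u1.
  by rewrite powR1 mulr1 (le_trans a1)// lee_fin lerDl mulr_ge0.
by rewrite (le_trans au)// lee_fin ler_wpM2r ?powR_ge0// lerDr.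
Qed.

Lemma nn_layer_bound n u : 0 < u ->
  (\int[P]_w (V n u w)%:E <= (K * Num.max 1 u `^ (- kappa))%:E)%E.
Proof.
move=> u0; apply: le_layer_bound => //.
  rewrite -(integral_cst_probability P 1); apply: ge0_le_integralT => w.
    by rewrite lee_fin nn_layer_ge0.
  by rewrite lee_fin nn_layer_le1.
apply: le_trans (nn_layer_mean n u0) _; rewrite lee_fin ler_wpM2r ?powR_ge0//.
by rewrite ler_peMl// ler1n.
Qed.

Lemma layer_diff_le1 n u w : `|V n u w - c u| <= 1.
Proof.
have := nn_layer_ge0 X j alpha n u w; have := nn_layer_le1 X j alpha n u w.
have := limit_layer_ge0 X j alpha fF u; have := limit_layer_le1 X j alpha fF u.
by rewrite ler_norml; move=> *; apply/andP; split; lra.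
Qed.

Lemma layer_diff_bound n u : 0 < u ->
  (\int[P]_w (`|V n u w - c u|)%:E <= (K * Num.max 1 u `^ (- kappa))%:E)%E.
Proof.
move=> u0; apply: le_layer_bound => //.
  rewrite -(integral_cst_probability P 1); apply: ge0_le_integralT => w.
    by rewrite lee_fin.
  by rewrite lee_fin layer_diff_le1.
apply: (@le_trans _ _ (\int[P]_w ((V n u w)%:E + (c u)%:E))%E).
  apply: ge0_le_integralT => w; first by rewrite lee_fin.
  rewrite -EFinD lee_fin.
  have := nn_layer_ge0 X j alpha n u w; have := limit_layer_ge0 X j alpha fF u.
  by rewrite ler_norml; move=> *; apply/andP; split; lra.
rewrite ge0_integralD//; last 3 first.
- by move=> w _; rewrite lee_fin nn_layer_ge0.
- by apply/measurable_EFinP; exact: measurable_nn_layer_at.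
- by move=> w _; rewrite lee_fin limit_layer_ge0.
rewrite integral_cst_probability.
have -> : 2 * C * u `^ (- kappa) = C * u `^ (- kappa) + C * u `^ (- kappa) by ring.
by rewrite EFinD; apply: leeD; [exact: nn_layer_mean|rewrite lee_fin limit_layer_tail].
Qed.

Definition nn_limit : R := fine (\int[mu]_u (c u)%:E).

Let mc : measurable_fun setT c.
Proof. exact: measurable_limit_layer. Qed.

Lemma nn_limitE : (\int[mu]_u (c u)%:E = nn_limit%:E)%E.
Proof.
rewrite /nn_limit fineK// ge0_fin_numE; last first.
  by apply: integral_ge0 => u _; rewrite lee_fin limit_layer_ge0.
have k1 : 1 < kappa by apply: le_lt_trans kappa_gt; rewrite ler1n; case: q12 => ->.
apply: (@le_lt_trans _ _ (\int[mu]_u (K%:E * (weight (- kappa) u)%:E))%E).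
  apply: ge0_le_integralT => u; first by rewrite lee_fin limit_layer_ge0.
  case: (ltP 0 u) => u0; last first.
    rewrite /limit_layer (le_gtF u0) mul0r mule_ge0// lee_fin ?weight_ge0//.
  rewrite -EFinM /weight u0 mul1r; apply: le_layer_bound => //.
    by rewrite lee_fin limit_layer_le1.
  rewrite lee_fin (le_trans (limit_layer_tail u0))// ler_wpM2r ?powR_ge0//.
  by rewrite ler_peMl// ler1n.
rewrite ge0_integralZl//.
- by apply: lte_mul_pinfty => //; exact: weight_integrable.
- by apply/measurable_EFinP; exact: measurable_weight.
- by move=> u _; rewrite lee_fin weight_ge0.
Qed.

Lemma S_stat_ge0 n w : 0 <= n%:R^-1 * S_stat j alpha X n w.
Proof.
rewrite -lee_fin S_stat_layers//; apply: integral_ge0 => u _.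
by rewrite lee_fin nn_layer_ge0.
Qed.

Lemma measurable_diff_joint n : measurable_fun setT
  (fun z : measurableTypeR R * Omega => `|V n z.1 z.2 - c z.1|).
Proof.
apply: measurableT_comp => //; apply: measurable_funB.
  exact: measurable_nn_layer.
exact: (measurableT_comp mc).
Qed.

Lemma S_stat_diff_le n w :
  ((`|n%:R^-1 * S_stat j alpha X n w - nn_limit|)%:E <= \int[mu]_u (`|V n u w - c u|)%:E)%E.
Proof.
have mV := measurable_section2 w (measurable_nn_layer X alpha j_gt0 n).
apply: (@norm_integralB_le _ _ R mu (fun u => V n u w) c _ _ mV mc _ _ _ nn_limitE).
- by move=> u; exact: nn_layer_ge0.
- by move=> u; exact: limit_layer_ge0.
- by rewrite -S_stat_layers.
Qed.

Lemma S_stat_moment_fin n :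
  (\int[P]_w ((n%:R^-1 * S_stat j alpha X n w) ^+ q)%:E < +oo)%E.
Proof.
apply: (@layer_moment_fin _ _ _ P q kappa q12 kappa_gt V
  (fun n w => n%:R^-1 * S_stat j alpha X n w) K).
- by move=> m; exact: measurable_nn_layer.
- exact: nn_layer_ge0.
- exact: nn_layer_le1.
- exact: nn_layer_neg.
- exact: S_stat_ge0.
- by move=> m w; rewrite S_stat_layers.
- exact: K_ge0.
- exact: nn_layer_bound.
Qed.

Lemma S_stat_cvg :
  vanishes (fun n => \int[P]_w (`|n%:R^-1 * S_stat j alpha X n w - nn_limit| ^+ q)%:E)%E.
Proof.
apply: (@layer_moment_vanishes _ _ _ P q kappa q12 kappa_gt
  (fun n u w => `|V n u w - c u|)
  (fun n w => `|n%:R^-1 * S_stat j alpha X n w - nn_limit|) K) => //.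
- exact: measurable_diff_joint.
- exact: layer_diff_le1.
- move=> n u w u0; rewrite nn_layer_neg// /limit_layer (le_gtF u0) mul0r subrr normr0//.
- exact: S_stat_diff_le.
- exact: layer_diff_bound.
- exact: nn_layer_cvg.
Qed.

Lemma measurable_S_stat n : measurable_fun setT (fun w => n%:R^-1 * S_stat j alpha X n w).
Proof.
apply: measurable_funM => //; rewrite /S_stat.
under eq_fun do rewrite big_mkord.
by apply: measurable_sum => i; exact: measurable_scaled_nn.
Qed.

End convergence.

(** * The limit constant *)

Section gamma_poisson.
Context {R : realType}.
Local Notation mu := (@lebesgue_measure R).

Lemma measurable_expRN : measurable_fun setT (fun x : R => expR (- x)).
Proof.
apply: continuous_measurable_fun => x.
by apply: (@continuous_comp _ _ _ -%R expR); [exact: opp_continuous|exact: continuous_expR].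
Qed.

Lemma ltr_powRl (a p r : R) : 0 < a -> 0 <= p -> 0 <= r -> (p `^ a < r `^ a) = (p < r).
Proof.
move=> a0 p0 r0; apply/idP/idP => h; last by apply: gt0_ltr_powR; rewrite ?nnegrE.
by rewrite ltNge; apply/negP => /(ge0_ler_powR (ltW a0)); rewrite !nnegrE => /(_ r0 p0); rewrite leNgt h.
Qed.

Lemma pois_term_le (k : nat) (x : R) : 0 < x ->
  x ^+ k / k`!%:R * expR (- x) <= k.+1%:R / x.
Proof.
move=> x0.
have h : x ^+ k.+1 / (k.+1)`!%:R * expR (- x) <= 1.
  apply: le_trans (pois_lt_le1 k.+2 (ltW x0)); rewrite pois_ltS lerDr.
  exact/pois_lt_ge0/ltW.
rewrite ler_pdivlMr// -[leRHS]mulr1.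
have -> : x ^+ k / k`!%:R * expR (- x) * x = k.+1%:R * (x ^+ k.+1 / (k.+1)`!%:R * expR (- x)).
  rewrite factS natrM exprS; field.
  by rewrite nat1r !pnatr_eq0 -lt0n fact_gt0.
by rewrite ler_wpM2l.
Qed.

Lemma pois_lt_cvgy (m : nat) : pois_lt m x @[x --> +oo] --> (0 : R).
Proof.
elim: m => [|m IH].
  by under eq_cvg do rewrite pois_lt0; exact: cvg_cst.
suff h : x ^+ m / m`!%:R * expR (- x) @[x --> +oo] --> (0 : R).
  rewrite (_ : pois_lt m.+1 = pois_lt m \+ (fun x => x ^+ m / m`!%:R * expR (- x))); last first.
    by apply/funext => x; exact: pois_ltS.
  have -> : nbhs (0 : R) = nbhs (0 + 0 : R) by rewrite addr0.
  exact: cvgD.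
apply/cvgrPdist_lt => e e0; near=> x.
have x0 : 0 < x by near: x; exact: nbhs_pinfty_gt.
rewrite sub0r normrN ger0_norm; last by rewrite mulr_ge0 ?expR_ge0// divr_ge0// exprn_ge0// ltW.
apply: le_lt_trans (pois_term_le m x0) _; rewrite ltr_pdivrMr// -ltr_pdivrMl// mulrC.
by near: x; apply: nbhs_pinfty_gt; rewrite num_real.
Unshelve. all: by end_near. Qed.

Lemma integral_pois_tail (m : nat) (l : R) : 0 <= l ->
  (\int[mu]_(x in `[l, +oo[) (x ^+ m / m`!%:R * expR (- x))%:E = (pois_lt m.+1 l)%:E)%E.
Proof.
move=> l0.
have dG (x : R) : is_derive x 1 (- pois_lt m.+1) (x ^+ m / m`!%:R * expR (- x)).
  apply: (is_derive_eq (is_deriveN (is_derive_pois_lt m.+1 x))).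
  by rewrite /= pois_ltS opprB addrC addKr.
have cG (x : R) : {for x, continuous (- pois_lt m.+1)}.
  by apply: differentiable_continuous; apply/derivable1_diffP; have [] := dG x.
rewrite (@ge0_continuous_FTC2y _ _ (- pois_lt m.+1) l 0).
- by rewrite sub0e -EFinN /= opprK.
- by move=> x lx; rewrite mulr_ge0 ?expR_ge0// divr_ge0// exprn_ge0// (le_trans l0).
- apply: continuous_subspaceT => x.
  apply: cvgM; last by apply: (@continuous_comp _ _ _ -%R expR); [exact: opp_continuous|exact: continuous_expR].
  by apply: cvgM; [exact: exprn_continuous|exact: cvg_cst].
- by rewrite -oppr0; apply: cvgN; exact: pois_lt_cvgy.
- by move=> x _; have [] := dG x.
- by apply: cvg_at_right_filter; exact: cG.
- by move=> x _; rewrite derive1E; apply: derive_val; exact: dG.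
Qed.

Definition gamma_density (m : nat) (x : R) : R :=
  (0 < x)%R%:R * (x ^+ m / m`!%:R * expR (- x)).

Lemma gamma_density_ge0 m x : 0 <= gamma_density m x.
Proof.
rewrite /gamma_density; case: ltP => x0; rewrite ?mul0r// mul1r.
by rewrite mulr_ge0 ?expR_ge0// divr_ge0// exprn_ge0// ltW.
Qed.

Lemma measurable_gamma_term m : measurable_fun setT (fun x : R => x ^+ m / m`!%:R * expR (- x)).
Proof.
apply: measurable_funM; first by apply: measurable_funM => //; exact: exprn_measurable.
exact: measurable_expRN.
Qed.

Lemma measurable_gamma_density m : measurable_fun setT (gamma_density m).
Proof.
by apply: measurable_funM; [exact: measurable_pos_indic|exact: measurable_gamma_term].
Qed.

Lemma pois_lt_integral (m : nat) (l : R) : 0 <= l ->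
  ((pois_lt m.+1 l)%:E = \int[mu]_x ((l < x)%R%:R * gamma_density m x)%:E)%E.
Proof.
move=> l0; rewrite -integral_pois_tail// -integral_itv_obnd_cbnd; last first.
  by apply: measurable_funTS; apply/measurable_EFinP; exact: measurable_gamma_term.
rewrite integral_mkcond; apply: eq_integral => x _.
rewrite patchE; case: ifPn => [|/negP]; rewrite inE/= in_itv/= andbT.
  by move=> lx; rewrite /gamma_density lx (le_lt_trans l0 lx) !mul1r.
by move=> /negP/negbTE ->; rewrite mul0r.
Qed.

Lemma integral_gamma (s : R) (m : nat) : m%:R <= s -> s <= m.+1%:R ->
  (\int[mu]_x ((0 < x)%R%:R * (x `^ s * expR (- x)))%:E = (Gamma_fun (s + 1))%:E)%E.
Proof.
move=> ms sm.
have s0 : 0 <= s by exact: le_trans ms.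
have mT : measurable_fun setT (fun x : R => (0 < x)%R%:R * (x `^ s * expR (- x))).
  apply: measurable_funM; first exact: measurable_pos_indic.
  apply: measurable_funM; first exact: measurable_powR.
  exact: measurable_expRN.
have T0 x : 0 <= (0 < x)%R%:R * (x `^ s * expR (- x)) :> R.
  by rewrite !mulr_ge0 ?powR_ge0 ?expR_ge0.
have -> : Gamma_fun (s + 1) = fine (\int[mu]_x ((0 < x)%R%:R * (x `^ s * expR (- x)))%:E)%E.
  rewrite /Gamma_fun /Rintegral integral_mkcond; congr fine; apply: eq_integral => x _.
  rewrite patchE; case: ifPn => [|/negP]; rewrite inE/= in_itv/= andbT.
    by move=> ->; rewrite mul1r addrK.
  by move=> /negP/negbTE ->; rewrite mul0r.
rewrite fineK// ge0_fin_numE; last by apply: integral_ge0 => x _; rewrite lee_fin.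
have D1 k : (\int[mu]_x (gamma_density k x)%:E = 1)%E.
  have := pois_lt_integral k (lexx 0); rewrite pois_lt_at0 => ->.
  apply: eq_integral => x _; rewrite /gamma_density; case: ltP => x0; last by rewrite !mul0r.
  by rewrite !mul1r.
apply: (@le_lt_trans _ _ (\int[mu]_x ((gamma_density 0 x)%:E + ((m.+1)`!%:R)%:E * (gamma_density m.+1 x)%:E))%E).
  apply: ge0_le_integralT => x; first by rewrite lee_fin.
  rewrite -EFinM -EFinD lee_fin /gamma_density; case: ltP => x0; last by rewrite !mul0r mulr0 addr0.
  rewrite !mul1r fact0 invr1 mul1r.
  have -> : (m.+1)`!%:R * (x ^+ m.+1 / (m.+1)`!%:R * expR (- x)) = x ^+ m.+1 * expR (- x).
    by field; rewrite pnatr_eq0 -lt0n fact_gt0.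
  have E0 := expR_ge0 (- x).
  have [x1|x1] := leP x 1.
    rewrite -[leLHS]addr0; apply: lerD; last by rewrite mulr_ge0// exprn_ge0// ltW.
    rewrite ler_piMl//; have := ge0_ler_powR s0 _ _ x1; rewrite !nnegrE powR1; apply => //.
    exact: ltW.
  rewrite -[leLHS]add0r; apply: lerD => //; apply: ler_wpM2r => //.
  by rewrite -powR_mulrn ?(ltW x0)// ler_powR// ltW.
rewrite ge0_integralD//; last 4 first.
- by move=> x _; rewrite lee_fin gamma_density_ge0.
- by apply/measurable_EFinP; exact: measurable_gamma_density.
- by move=> x _; rewrite -EFinM lee_fin mulr_ge0// gamma_density_ge0.
- by apply: emeasurable_funM => //; apply/measurable_EFinP; exact: measurable_gamma_density.
rewrite ge0_integralZl//; last 2 first.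
- by apply/measurable_EFinP; exact: measurable_gamma_density.
- by move=> x _; rewrite lee_fin gamma_density_ge0.
by rewrite !D1 -EFinM -EFinD ltry.
Qed.

Lemma Gamma_nat (m : nat) : Gamma_fun m.+1%:R = m`!%:R :> R.
Proof.
have := pois_lt_integral m (lexx 0); rewrite pois_lt_at0 => h.
have : ((m`!%:R : R)%:E * 1 = m`!%:R%:E * \int[mu]_x ((0 < x)%R%:R * gamma_density m x)%:E)%E.
  by rewrite -h.
rewrite mule1 -ge0_integralZl//; last 2 first.
- apply/measurable_EFinP; apply: measurable_funM; first exact: measurable_pos_indic.
  exact: measurable_gamma_density.
- by move=> x _; rewrite lee_fin mulr_ge0// gamma_density_ge0.
rewrite -natr1.
have [] := (lexx (m%:R : R), ler_nat R m m.+1); rewrite leqnSn => h1 h2.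
move=> E; apply: EFin_inj; rewrite -(integral_gamma h1 h2) E.
apply: eq_integral => x _; rewrite -EFinM /gamma_density; case: ltP => x0; last by rewrite !mul0r mulr0.
rewrite !mul1r powR_mulrn ?ltW//; congr EFin; field.
by rewrite pnatr_eq0 -lt0n fact_gt0.
Qed.

(* Both sides are the mass under the gamma density of the region
   [l (u ^ (1 / alpha)) ^ d < x], sliced along [u] and along [x]. *)
Lemma integral_pois_layer (m d : nat) (alpha l : R) : (0 < d)%N -> 0 < alpha -> alpha < d%:R -> 0 < l ->
  (\int[mu]_u ((0 < u)%R%:R * pois_lt m.+1 (l * (u `^ alpha^-1) ^+ d))%:E =
   (l `^ (- (alpha / d%:R)) * (Gamma_fun (m.+1%:R + alpha / d%:R) / Gamma_fun m.+1%:R))%:E)%E.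
Proof.
move=> d0 a0 ad l0.
have d0' : 0 < d%:R :> R by rewrite ltr0n.
set a := alpha / d%:R.
have aa0 : 0 < a by rewrite divr_gt0.
have a1 : a < 1 by rewrite ltr_pdivrMr// mul1r.
pose Y (x : R) := (Num.max 0 x / l) `^ a.
have mY : measurable_fun setT Y.
  apply: (measurableT_comp (measurable_powR a)); apply: measurable_funM => //.
  exact: measurable_maxr.
have Y0 x : 0 <= Y x by exact: powR_ge0.
have LE (u x : R) : 0 < u -> (l * (u `^ alpha^-1) ^+ d < x) = (u < Y x).
  move=> u0.
  have uE : u = ((u `^ alpha^-1) ^+ d) `^ a.
    rewrite -powR_mulrn ?powR_ge0// -!powRrM /a.
    have -> : alpha^-1 * (d%:R * (alpha / d%:R)) = 1 by field; rewrite !gt_eqF.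
    by rewrite powRr1// ltW.
  have v0 : 0 <= (u `^ alpha^-1) ^+ d by rewrite exprn_ge0// powR_ge0.
  rewrite [u in RHS]uE /Y ltr_powRl// ?divr_ge0// ?le_max ?lexx ?(ltW l0)//.
  rewrite ltr_pdivlMr// [RHS]lt_max [_ * l]mulrC.
  by rewrite [X in X || _]ltNge mulr_ge0 ?(ltW l0).
have pos (u : R) : 0 <= l * (u `^ alpha^-1) ^+ d.
  by rewrite mulr_ge0 ?(ltW l0)// exprn_ge0// powR_ge0.
transitivity (\int[mu]_u \int[mu]_x (layer (Y x) u * gamma_density m x)%:E)%E.
  apply: eq_integral => u _; rewrite /layer; case: (ltP 0 u) => u0; last first.
    by rewrite mul0r integral0_eq// => x _; rewrite mul0r.
  rewrite mul1r pois_lt_integral//; apply: eq_integral => x _.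
  by rewrite LE.
have mF : measurable_fun setT (fun z : measurableTypeR R * measurableTypeR R => (layer (Y z.2) z.1 * gamma_density m z.2)%:E).
  apply/measurable_EFinP; apply: measurable_funM.
    by apply: measurable_layer => //; exact: (measurableT_comp mY).
  exact: (measurableT_comp (measurable_gamma_density m)).
rewrite (@tonelli_swap _ _ _ _ _ mu mu (fun u x => (layer (Y x) u * gamma_density m x)%:E))//; last first.
  by move=> u x; rewrite lee_fin mulr_ge0 ?gamma_density_ge0// layer_ge0.
have l1 : 0 <= l `^ (- a) / m`!%:R by rewrite divr_ge0// powR_ge0.
transitivity (\int[mu]_x ((l `^ (- a) / m`!%:R)%:E * ((0 < x)%R%:R * (x `^ (m%:R + a) * expR (- x)))%:E))%E.
  apply: eq_integral => x _; under eq_integral do rewrite EFinM.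
  rewrite ge0_integralZr//; last 3 first.
  - by apply/measurable_EFinP; exact: measurable_layer.
  - by move=> u _; rewrite lee_fin layer_ge0.
  - by rewrite lee_fin gamma_density_ge0.
  rewrite integral_layer// -!EFinM /gamma_density; congr EFin.
  case: (ltP 0 x) => x0; last by rewrite !mul0r !mulr0.
  rewrite !mul1r /Y max_r ?ltW// powRM ?invr_ge0 ?(ltW x0) ?(ltW l0)//.
  rewrite powRD; last by rewrite (gt_eqF x0) implybT.
  rewrite powR_mulrn ?ltW// -powR_inv1 ?(ltW l0)// -powRrM mulN1r; ring.
rewrite ge0_integralZl//; last 2 first.
- apply/measurable_EFinP; apply: measurable_funM; first exact: measurable_pos_indic.
  apply: measurable_funM; first exact: measurable_powR.
  exact: measurable_expRN.
- by move=> x _; rewrite lee_fin !mulr_ge0 ?powR_ge0 ?expR_ge0.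
rewrite (@integral_gamma _ m); last 2 first.
- by rewrite lerDl ltW.
- by rewrite -natr1 lerD2l ltW.
rewrite -EFinM Gamma_nat -natr1; congr EFin.
have -> : m%:R + a + 1 = m%:R + 1 + a by ring.
by rewrite mulrA mulrAC.
Qed.

End gamma_poisson.

Section limit_constant.
Context {R : realType} {dO : measure_display} {Omega : measurableType dO}
  {P : probability Omega R} {d : nat}.
Local Notation T := (d.-tuple R).
Variables (X : nat -> {RV P >-> T}) (f : T -> R) (j : nat) (alpha : R).
Hypothesis d_gt0 : (0 < d)%N.
Hypothesis j_gt0 : (0 < j)%N.
Hypothesis alpha_gt0 : 0 < alpha.
Hypothesis alpha_lt : alpha < d%:R.
Hypothesis fF : prob_density f.
Hypothesis fX : forall i, has_density (X i) f.
Local Notation mu := (@lebesgue_measure R).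

Let F : probability T R := distribution P (X 0%N).
Let mf : measurable_fun setT f. Proof. by case: fF. Qed.
Let f0 x : 0 <= f x. Proof. by case: fF. Qed.

Let FE A (mA : measurable A) := distribution_density (fX 0%N) mA.

Lemma ball_vol_gt0 : 0 < ball_vol R d.
Proof.
have [E G0] := @ball_vol_gamma R d d_gt0.
rewrite -(pmulr_lgt0 _ G0) E; exact/powR_gt0/pi_gt0.
Qed.

Lemma limit_layer_integral : (\int[mu]_u (limit_layer X f j alpha u)%:E =
  (unit_ball_vol R d `^ (- (alpha / d%:R)) *
    (Gamma_fun (j%:R + alpha / d%:R) / Gamma_fun j%:R))%:E *
  I_int (1 - alpha / d%:R) f)%E.
Proof.
rewrite -ball_vol_unit_ball//; set b := ball_vol R d; set a := alpha / d%:R.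
have b0 : 0 < b := ball_vol_gt0.
have d0' : 0 < d%:R :> R by rewrite ltr0n.
have a1 : a < 1 by rewrite ltr_pdivrMr// mul1r.
set G := Gamma_fun (j%:R + a) / Gamma_fun j%:R.
pose g u x : R := (0 < u)%R%:R * pois_lt j (b * (u `^ alpha^-1) ^+ d * f x).
have g0 u x : 0 <= g u x.
  rewrite /g; case: ltP => u0; rewrite ?mul0r// mul1r pois_lt_ge0//.
  by rewrite !mulr_ge0 ?(ltW b0)// exprn_ge0// powR_ge0.
have mg : measurable_fun setT (fun z : measurableTypeR R * T => g z.1 z.2).
  exact: measurable_layer_integrand.
transitivity (\int[mu]_u \int[leb d]_x (g u x * f x)%:E)%E.
  apply: eq_integral => u _; rewrite limit_layerE//.
  apply: (integral_density mf f0 FE).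
    exact: (measurable_section1 (u : measurableTypeR R) mg).
  exact: g0.
rewrite (@tonelli_swap _ _ _ _ _ mu (leb d) (fun u x => (g u x * f x)%:E)); last 2 first.
- apply/measurable_EFinP; apply: measurable_funM => //; exact: (measurableT_comp mf).
- by move=> u x; rewrite lee_fin mulr_ge0.
have gu x : measurable_fun setT (fun u : R => (g u x)%:E).
  by apply/measurable_EFinP; exact: (measurable_section2 x mg).
transitivity (\int[leb d]_x ((b `^ (- a) * G)%:E * (f x `^ (1 - a))%:E))%E.
  apply: eq_integral => x _.
  have [fx|fx] := eqVneq (f x) 0.
    rewrite fx powR0 ?mule0; last by rewrite subr_eq0 gt_eqF.
    by rewrite integral0_eq// => u _; rewrite mulr0.
  have fx0 : 0 < f x by rewrite lt_neqAle eq_sym fx f0.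
  under eq_integral do rewrite EFinM.
  rewrite ge0_integralZr//; last 3 first.
  - exact: gu.
  - by move=> u _; rewrite lee_fin.
  - by rewrite lee_fin.
  have -> : (\int[mu]_u (g u x)%:E = \int[mu]_u ((0 < u)%R%:R *
      pois_lt j.-1.+1 ((b * f x) * (u `^ alpha^-1) ^+ d))%:E)%E.
    by apply: eq_integral => u _; rewrite prednK// /g mulrAC.
  rewrite integral_pois_layer ?mulr_gt0// prednK// -/a -/G -!EFinM; congr EFin.
  rewrite powRM ?(ltW b0)// powRD; last by apply/implyP => _; rewrite gt_eqF.
  by rewrite powRr1//; ring.
rewrite ge0_integralZl//; last 3 first.
- by apply/measurable_EFinP; apply: (measurableT_comp (measurable_powR _)).
- by move=> x _; rewrite lee_fin powR_ge0.
- rewrite lee_fin mulr_ge0 ?powR_ge0// /G divr_ge0//;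
  by rewrite /Gamma_fun /Rintegral; apply: fine_ge0; apply: integral_ge0 => t _;
    rewrite lee_fin mulr_ge0 ?powR_ge0 ?expR_ge0.
Qed.

End limit_constant.

Section Lnorm_nat.
Context {R : realType} {dO : measure_display} {Omega : measurableType dO}
  (P : probability Omega R) (q : nat).
Hypothesis q_gt0 : (0 < q)%N.

Lemma Lnorm_natE (g : Omega -> R) :
  ('N[P]_(q%:R)%:E[EFin \o g] = (\int[P]_w (`|g w| ^+ q)%:E) `^ q%:R^-1)%E.
Proof.
rewrite unlock; congr (_ `^ _)%E; apply: eq_integral => w _.
by rewrite -[(`|_|)%E]/((`|g w|)%:E) poweR_EFin powR_mulrn.
Qed.

Lemma Lnorm_nat_le (g : Omega -> R) (e : R) : 0 <= e ->
  (\int[P]_w (`|g w| ^+ q)%:E <= (e ^+ q)%:E)%E -> ('N[P]_(q%:R)%:E[EFin \o g] <= e%:E)%E.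
Proof.
move=> e0 ge; rewrite Lnorm_natE.
have -> : e%:E = ((e ^+ q)%:E `^ q%:R^-1)%E.
  rewrite poweR_EFin -powR_mulrn// -powRrM mulfV ?powRr1//.
  by rewrite pnatr_eq0 -lt0n.
apply: gt0_ler_poweR => //; rewrite ?invr_ge0// in_itv/= leey andbT.
  by apply: integral_ge0 => w _; rewrite lee_fin exprn_ge0.
by rewrite lee_fin exprn_ge0.
Qed.

Lemma in_Lfun_nat (g : Omega -> R) : measurable_fun setT g ->
  (\int[P]_w (`|g w| ^+ q)%:E < +oo)%E -> g \in Lfun P (q%:R)%:E.
Proof.
move=> mg gfin; rewrite !inE/=; apply/andP; split; rewrite inE//=.
by rewrite /finite_norm Lnorm_natE poweR_lty.
Qed.

End Lnorm_nat.

Theorem theorem3 (R : realType) (dO : measure_display)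
  (Omega : measurableType dO) (P : probability Omega R)
  (d j q : nat) (alpha : R) (f : d.-tuple R -> R)
  (X : nat -> {RV P >-> d.-tuple R}) :
  (1 <= d)%N -> (1 <= j)%N -> (q = 1%N \/ q = 2%N) ->
  0 < alpha -> alpha < d%:R / q%:R ->
  prob_density f ->
  mutually_independent X ->
  (forall i, has_density (X i) f) ->
  (I_int (1 - alpha / d%:R) f < +oo)%E ->
  ((q%:R * alpha * d%:R / (d%:R - q%:R * alpha))%:E < critical_moment f)%E ->
  cvg_Lspace P (q%:R)%:E
    (fun n w => n%:R^-1 * S_stat j alpha X n w)
    (cst (unit_ball_vol R d `^ (- (alpha / d%:R)) *
          (Gamma_fun (j%:R + alpha / d%:R) / Gamma_fun j%:R) *
          fine (I_int (1 - alpha / d%:R) f))).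
Proof.
move=> d1 j1 q12 a0 ad fF indX fX Ifin.
have q0 : (0 < q)%N by case: q12 => ->.
have q0' : 0 < q%:R :> R by rewrite ltr0n.
have q1' : 1 <= q%:R :> R by rewrite ler1n.
have d0' : 0 < d%:R :> R by rewrite ltr0n.
have qad : q%:R * alpha < d%:R by rewrite mulrC -ltr_pdivlMr.
have ad1 : alpha < d%:R by apply: le_lt_trans qad; rewrite ler_peMl// ltW.
move=> /ereal_sup_gt[_ [rho [rho0 momrho] <-]]; rewrite lte_fin => rhoK.
have kq : q%:R < d%:R * rho / (d%:R + rho) / alpha.
  have dr : 0 < d%:R + rho by rewrite ltr_wpDr.
  have dq : 0 < d%:R - q%:R * alpha by rewrite subr_gt0.
  rewrite ltr_pdivlMr// ltr_pdivlMr//; move: rhoK; rewrite ltr_pdivrMr//; lra.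
have I0 : (0 <= I_int (1 - alpha / d%:R) f)%E.
  by apply: integral_ge0 => x _; rewrite lee_fin powR_ge0.
set c := _ * fine _.
have cE : c = nn_limit X f j alpha.
  rewrite /nn_limit limit_layer_integral//.
  by rewrite -[I_int _ _]fineK ?ge0_fin_numE.
have mS n := measurable_S_stat X alpha j1 n.
split.
- move=> n; apply: in_Lfun_nat => //.
  have -> : (\int[P]_w (`|n%:R^-1 * S_stat j alpha X n w| ^+ q)%:E =
      \int[P]_w ((n%:R^-1 * S_stat j alpha X n w) ^+ q)%:E)%E.
    by apply: eq_integral => w _; rewrite ger0_norm// S_stat_ge0.
  exact: (S_stat_moment_fin indX d1 j1 a0 fF fX rho0 momrho q12 kq).
- apply: in_Lfun_nat => //.
  by rewrite (integral_cst_probability P (`|c| ^+ q)) ltry.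
apply: vanishes_cvg => [n|e e0]; first exact: Lnorm_ge0.
have eq0 : 0 < e ^+ q by rewrite exprn_gt0.
have := S_stat_cvg indX d1 j1 a0 fF fX rho0 momrho q12 kq eq0.
apply: filterS => n; rewrite -cE => h.
exact: (@Lnorm_nat_le _ _ _ P q q0 (fun w => n%:R^-1 * S_stat j alpha X n w - c) e (ltW e0) h).
Qed.
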